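(* Let $d\ge 2$ and $n\ge 1$ be integers. For $\vec{k}=(k_1,\dots,k_n)$ with each $k_i\in\{2,3,\dots\}$, let $G^{\vec{k}}$ be the graph with vertex set $\mathbb{Z}^d$ and bonds parallel to the coordinate axes of lengths $1,\ k_1,\ k_1k_2,\ \dots,\ k_1k_2\cdots k_n$. Let $p_c(\mathbb{Z}^{d(n+1)})$ be the ordinary site percolation threshold of $\mathbb{Z}^{d(n+1)}$ with nearest neighbor connections. Then $$\lim_{k_i\to\infty,\ \forall i} p_c(G^{\vec{k}})=p_c(\mathbb{Z}^{d(n+1)}),$$ i.e. for every $\varepsilon>0$ there is $K$ such that $|p_c(G^{\vec{k}})-p_c(\mathbb{Z}^{d(n+1)})|<\varepsilon$ whenever $k_i\ge K$ for all $i=1,\dots,n$.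
   Context: Bernoulli site percolation on a graph $G=(\mathbb{V},\mathbb{E})$ with countably infinite vertex set: each vertex is independently open with probability $p$ and closed with probability $1-p$; $\mathbb{P}_p$ is the corresponding product measure on $\{0,1\}^{\mathbb{V}}$. Two vertices $u,v$ are connected if there is a finite self-avoiding path in $G$ from $v$ to $u$ all of whose vertices (including endpoints) are open. The cluster $C_v$ is the set of vertices connected to $v$, and $\theta_v^G(p)=\mathbb{P}_p(\#C_v=\infty)$. The percolation threshold of a connected graph $G$ is $p_c(G)=\sup\{p\in[0,1]:\theta_v^G(p)=0\}$, which does not depend on $v$. For a positive integer $m$, $\mathbb{E}_m$ is the set of unordered pairs $\langle v,u\rangle$ of vertices of $\mathbb{Z}^d$ for which there is an index $i\in\{1,\dots,d\}$ with $|v_i-u_i|=m$ and $v_j=u_j$ for all $j\neq i$. The graph $G^{\vec{k}}$ is $\left(\mathbb{Z}^d,\ \mathbb{E}_1\cup\bigcup_{i=1}^n\mathbb{E}_{k_1 k_2\cdots k_i}\right)$. The graph $\mathbb{Z}^{m}$ has as edges the pairs of vertices at $\ell^1$-distance $1$. *)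

(* Defs.v *)
From HB Require Import structures.
From mathcomp Require Import all_boot all_order all_algebra.
From mathcomp Require Import all_classical all_reals all_analysis.
From mathcomp Require Import measurable_realfun interval_inference.
From mathcomp Require Import lra.
Set Implicit Arguments.
Unset Strict Implicit.
Unset Printing Implicit Defensive.
Import Order.TTheory GRing.Theory Num.Theory.

Local Open Scope classical_set_scope.
Local Open Scope ring_scope.

Definition cylinder (V : countType) (s : seq V) (eta : V -> bool) :
    set (V -> bool) := [set w : V -> bool | {in s, w =1 eta}].

Definition cylinders (V : countType) : set (set (V -> bool)) :=
  [set cylinder x.1 x.2 | x in [set: seq V * (V -> bool)]].

(* {0,1}^V with the product sigma-algebra; w v = true means that v is open *)
Definition config (V : countType) := g_sigma_algebraType (cylinders (V := V)).

Definition product_law (R : realType) (V : countType) (p : {i01 R})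
    (P : probability (config V) R) : Prop :=
  forall (s : seq V) (eta : V -> bool), uniq s ->
    P (cylinder s eta) = (\prod_(v <- s) bernoulli_pmf p%:num (eta v))%:E.

(* The coordinate process of the expanding map T of [0, 1[ that is affine from
   [0, p[ onto [0, 1[ and from [p, 1[ onto [0, 1[ is i.i.d. Bernoulli(p) under
   Lebesgue measure; transporting it along pickle : V -> nat shows that the
   infinite product measure exists. *)
Section product_law_exists.
Variables (R : realType) (p : R).
Hypotheses (p0 : 0 <= p) (p1 : p <= 1).

Let T (x : R) : R := if x < p then p^-1 * x else (1 - p)^-1 * (x - p).
Let b (n : nat) (x : R) : bool := iter n T x < p.
Let U := uniform_prob (@ltr01 R).
Let pmf := bernoulli_pmf p.

Let pmf_ge0 c : 0 <= pmf c.
Proof. by apply: bernoulli_pmf_ge0; rewrite p0. Qed.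

Let mT : measurable_fun setT T.
Proof.
rewrite /T; apply: measurable_fun_if => //=.
- exact: measurable_fun_ltr.
- by apply: measurable_funTS; apply: measurable_funM => //; exact: measurable_funB.
Qed.

Let mb n : measurable_fun setT (b n).
Proof.
rewrite /b; apply: measurable_fun_ltr => //.
elim: n => [|n IHn] /=; first exact: measurable_id.
exact: (measurableT_comp mT IHn).
Qed.

Let prefix_itv N : forall s : nat -> bool, exists a : R,
  [/\ 0 <= a, a + \prod_(0 <= n < N) pmf (s n) <= 1 &
   [set x | 0 <= x < 1 /\ forall n, (n < N)%N -> b n x = s n] =
   `[a, a + \prod_(0 <= n < N) pmf (s n)[%classic].
Proof.
have hp0 := p0; have hp1 := p1.
elim: N => [s|N IHN s].
  exists 0; rewrite big_nil add0r; split => //.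
  apply/seteqP; split => x /=; rewrite in_itv /=; first by case.
  by move=> ->; split.
have [a [a0 a1 aE]] := IHN (fun n => s n.+1).
set w := \prod_(0 <= n < N) _ in a1 aE.
have w0 : 0 <= w by apply: prodr_ge0 => *; exact: pmf_ge0.
rewrite big_nat_recl // -/w.
have stepE x : (0 <= x < 1 /\ forall n, (n < N.+1)%N -> b n x = s n) <->
    [/\ 0 <= x < 1, (x < p) = s 0%N, 0 <= T x < 1 & a <= T x < a + w].
  have TE : (0 <= T x < 1 /\ forall n, (n < N)%N -> b n (T x) = s n.+1) <->
            a <= T x < a + w.
    by have := congr1 (@^~ (T x)) aE; rewrite /= in_itv /= => ->.
  split.
    move=> [x01 H].
    have T01 : 0 <= T x < 1.
      move: x01 => /andP[x0 x1]; rewrite /T; case: ltP => xp.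
        have pp : 0 < p by lra.
        by rewrite mulr_ge0 ?invr_ge0 //= mulrC ltr_pdivrMr // mul1r.
      have pp : 0 < 1 - p by lra.
      rewrite mulr_ge0 ?invr_ge0 ?subr_ge0 //= mulrC ltr_pdivrMr // mul1r.
      by lra.
    split => //; first by rewrite -(H 0%N).
    apply/TE; split => // n nN.
    by rewrite -(H n.+1) // /b iterSr.
  move=> [x01 s0 T01 /TE[_ H]]; split => // -[_|n nN]; first by rewrite -s0.
  by rewrite -H // /b iterSr.
case s0 : (s 0%N); rewrite /pmf /bernoulli_pmf /=.
  exists (p * a); split.
  - exact: mulr_ge0.
  - by rewrite -mulrDr mulr_ile1 // addr_ge0.
  - apply/seteqP; split => x; rewrite /= in_itv /=.
      move=> /stepE[/andP[x0 x1]]; rewrite s0 => xp _; rewrite /T xp.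
      have pp : 0 < p by lra.
      by rewrite mulrC ler_pdivlMr // ltr_pdivrMr // -mulrDr !(mulrC p).
    move=> /andP[ax xa].
    have pw : 0 < p * w by lra.
    have pp : 0 < p.
      by rewrite lt_neqAle p0 andbT; apply: contraTneq pw => <-; rewrite mul0r ltxx.
    have xp : x < p.
      apply: (lt_le_trans xa); rewrite -mulrDr -[leRHS]mulr1.
      exact: ler_wpM2l.
    have x0 : 0 <= x by apply: le_trans ax; exact: mulr_ge0.
    have H : a <= T x < a + w.
      by rewrite /T xp mulrC ler_pdivlMr // ltr_pdivrMr // -!(mulrC p) mulrDr ax.
    have /andP[H1 H2] := H.
    have T01 : 0 <= T x < 1 by rewrite (le_trans a0 H1) (lt_le_trans H2 a1).
    have x01 : 0 <= x < 1 by rewrite x0 (lt_le_trans xp p1).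
    by apply/stepE; split; rewrite ?xp ?s0.
exists (p + (1 - p) * a); have q0 : 0 <= 1 - p by lra.
have qa : 0 <= (1 - p) * a by exact: mulr_ge0.
have qaw : (1 - p) * (a + w) <= 1 - p.
  by rewrite -[leRHS]mulr1; exact: ler_wpM2l.
split.
- lra.
- by rewrite -addrA -mulrDr; lra.
- apply/seteqP; split => x; rewrite /= in_itv /=.
    move=> /stepE[/andP[x0 x1]]; rewrite s0 => xp _; rewrite /T xp.
    have pp : 0 < 1 - p by move/negbT: xp; rewrite -leNgt; lra.
    rewrite mulrC ler_pdivlMr // ltr_pdivrMr // !(mulrC _ (1 - p)).
    by move=> /andP[]; rewrite mulrDr => *; lra.
  move=> /andP[ax xa].
  have pw : 0 < (1 - p) * w by lra.
  have pp : 0 < 1 - p.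
    by rewrite lt_neqAle q0 andbT; apply: contraTneq pw => <-; rewrite mul0r ltxx.
  have xp : (x < p) = false by apply/negbTE; rewrite -leNgt; lra.
  have H : a <= T x < a + w.
    rewrite /T xp mulrC ler_pdivlMr // ltr_pdivrMr // !(mulrC _ (1 - p)).
    by rewrite mulrDr; lra.
  move: qaw; rewrite mulrDr => qaw.
  have /andP[H1 H2] := H.
  have T01 : 0 <= T x < 1 by rewrite (le_trans a0 H1) (lt_le_trans H2 a1).
  have x01 : 0 <= x < 1 by apply/andP; split; lra.
  by apply/stepE; split; rewrite ?xp ?s0.
Qed.

Let measurable_bits (Q : pred nat) (s : nat -> bool) N :
  measurable [set x | forall n, (n < N)%N -> Q n -> b n x = s n].
Proof.
rewrite [X in measurable X](_ : _ =
    \bigcap_(n in [set n | (n < N)%N && Q n]) (b n @^-1` [set s n])).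
  apply: bigcap_measurableType => n _.
  by rewrite -[X in measurable X]setTI; exact: mb.
apply/seteqP; split => x /= H n; first by move=> /andP[]; exact: H.
by move=> nN Qn; apply: H; rewrite /= nN.
Qed.

Let U_prefix N (s : nat -> bool) :
  U [set x | forall n, (n < N)%N -> b n x = s n] =
  (\prod_(0 <= n < N) pmf (s n))%:E.
Proof.
have [a [a0 a1 aE]] := prefix_itv N s.
set w := \prod_(0 <= n < N) _ in a1 aE *.
have w0 : 0 <= w by apply: prodr_ge0 => *; exact: pmf_ge0.
have mE : measurable [set x | forall n, (n < N)%N -> b n x = s n].
  have := measurable_bits predT s N.
  by congr measurable; apply/seteqP; split => x /= H n nN; [exact: H|move=> _; exact: H].
have mU A : measurable A -> U A = (\int[lebesgue_measure]_(x in A `&` `[0%R, 1%R]%classic) 1)%E.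
  move=> mA; rewrite [LHS]integral_uniform_pdf.
  apply: eq_integral => x; rewrite inE /= in_itv /= => -[_ x01].
  by rewrite /uniform_pdf x01 subr0 invr1.
rewrite mU // integral_cst ?mul1e /=; last exact: measurableI.
have -> : [set x | forall n, (n < N)%N -> b n x = s n] `&` `[0, 1]%classic =
    `[a, a + w[%classic `|`
     ([set x | forall n, (n < N)%N -> b n x = s n] `&` [set 1]).
  rewrite -aE; apply/seteqP; split => x /=; rewrite in_itv /=.
    move=> [H /andP[x0]]; rewrite le_eqVlt => /orP[/eqP x1|x1]; [by right|left].
    by rewrite x0 x1.
  move=> [[/andP[x0 x1] H]|[H x1]]; split => //; first by rewrite x0 ltW.
  by rewrite x1 ler01 lexx.
rewrite measureU //=; last 2 first.
- exact: measurableI.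
- apply/seteqP; split => x //=; rewrite in_itv /= => -[/andP[_ xa] [_ x1]].
  by move: xa; rewrite x1 ltNge a1.
have -> : lebesgue_measure
    ([set x | forall n, (n < N)%N -> b n x = s n] `&` [set 1]) = 0%E.
  apply/eqP; rewrite eq_le measure_ge0 andbT -(lebesgue_measure_set1 (1 : R)).
  by apply: le_measure; rewrite ?inE //; exact: measurableI.
rewrite adde0 lebesgue_measure_itv /= lte_fin ltrDl; case: ifPn => [_|]; first by rewrite -EFinB addrAC subrr add0r.
by rewrite -leNgt => w0'; congr EFin; apply/le_anti; rewrite w0 w0'.
Qed.

Let U_bits N (A : pred nat) M : (M <= N)%N -> forall s : nat -> bool,
  U [set x | forall n, (n < N)%N -> (n < N - M)%N || A n -> b n x = s n] =
  (\prod_(0 <= n < N | (n < N - M)%N || A n) pmf (s n))%:E.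
Proof.
elim: M => [_ s|M IHM MN s].
  rewrite subn0; transitivity (U [set x | forall n, (n < N)%N -> b n x = s n]).
    congr (U _); apply/seteqP; split => x /= H n nN; last by move=> _; exact: H.
    by apply: H => //; rewrite nN.
  rewrite U_prefix; congr EFin; rewrite big_nat [RHS]big_nat_cond.
  by apply: eq_bigl => n /=; case: ltnP => //=; rewrite andbF.
have {}IHM := IHM (ltnW MN).
set m := (N - M.+1)%N.
have mE : (N - M)%N = m.+1 by rewrite /m subnSK.
have mN : (m < N)%N by rewrite /m -mE leq_subr.
rewrite mE in IHM.
have ltE n : n != m -> (n < m.+1)%N = (n < m)%N.
  by move=> nm; rewrite ltnS leq_eqVlt (negbTE nm).
case Am : (A m).
  have QE n : (n < m)%N || A n = (n < m.+1)%N || A n.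
    by have [->|nm] := eqVneq n m; [rewrite Am !orbT|rewrite ltE].
  transitivity (U [set x | forall n,
      (n < N)%N -> (n < m.+1)%N || A n -> b n x = s n]).
    by congr (U _); apply/seteqP; split => x /= H n nN Qn; apply: H => //;
      move: Qn; rewrite QE.
  by rewrite IHM; congr EFin; apply: eq_bigl => n; rewrite QE.
pose s' c n := if n == m then c else s n.
have -> : [set x | forall n, (n < N)%N -> (n < m)%N || A n -> b n x = s n] =
   [set x | forall n, (n < N)%N -> (n < m.+1)%N || A n -> b n x = s' true n] `|`
   [set x | forall n, (n < N)%N -> (n < m.+1)%N || A n -> b n x = s' false n].
  apply/seteqP; split => x /=.
    move=> H; have H' n : (n < N)%N -> (n < m.+1)%N || A n ->
        b n x = s' (b m x) n.
      rewrite /s'; case: (eqVneq n m) => [-> //|nm nN].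
      by rewrite ltE //; exact: H.
    by case: (b m x) H' => H'; [left|right].
  move=> H n nN Qn.
  have nm : n != m.
    by apply: contraTneq Qn => ->; rewrite ltnn Am.
  by case: H => /(_ n nN); rewrite ltE // /s' (negbTE nm); exact.
rewrite /U measureU /=; last 3 first.
- exact: (measurable_bits (fun n => (n < m.+1)%N || A n)).
- exact: (measurable_bits (fun n => (n < m.+1)%N || A n)).
- apply/seteqP; split => x //= -[/(_ m mN) + /(_ m mN)].
  by rewrite ltnSn /s' eqxx => -> // /(_ isT).
rewrite -!/U !IHM -EFinD; congr EFin.
have sE c : \prod_(0 <= n < N | (n < m.+1)%N || A n) pmf (s' c n) =
    pmf c * \prod_(0 <= n < N | (n < m)%N || A n) pmf (s n).
  rewrite -big_filter (bigD1_seq m) /= ?filter_uniq ?iota_uniq //; last first.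
    by rewrite mem_filter ltnSn mem_index_iota.
  rewrite big_filter_cond.
  rewrite {1}/s' eqxx; congr (_ * _).
  rewrite (eq_bigr (fun n => pmf (s n))); last first.
    by move=> n /andP[_ nm]; rewrite /s' (negbTE nm).
  apply: eq_bigl => n; have [->|nm] := eqVneq n m.
    by rewrite andbF ltnn Am.
  by rewrite ltE // andbT.
by rewrite !sE -mulrDl /pmf /bernoulli_pmf subrKC mul1r.
Qed.

Lemma bits_law (t : seq nat) (s : nat -> bool) : uniq t ->
  U [set x | {in t, forall n, b n x = s n}] = (\prod_(n <- t) pmf (s n))%:E.
Proof.
move=> ut; pose N := (\max_(n <- t) n).+1.
have tN n : n \in t -> (n < N)%N by move=> nt; rewrite ltnS; exact: leq_bigmax_seq.
have := U_bits (mem t) (leqnn N) s; rewrite subnn => E.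
transitivity (U [set x | forall n, (n < N)%N -> (n < 0)%N || mem t n -> b n x = s n]).
  congr (U _); apply/seteqP; split => x /= H n.
    by move=> _ nt; exact: H.
  by move=> nt; apply: H => //; exact: tN.
rewrite E; congr EFin; rewrite -big_filter; apply: perm_big.
apply: uniq_perm => //; first by rewrite filter_uniq ?iota_uniq.
move=> n; rewrite mem_filter mem_index_iota /=.
by case nt : (n \in t) => //=; exact: tN.
Qed.

Variable V : countType.

Let X (x : R) : config V := fun v => b (pickle v) x.

Let mX : measurable_fun setT X.
Proof.
apply: (@measurability _ _ _ _ _ X (cylinders (V := V))) => //.
move=> _ [_ [[s eta] _ <-] <-]; rewrite setTI /=.
rewrite [X in measurable X](_ : _ =
   \bigcap_(v in [set` s]) (b (pickle v) @^-1` [set eta v])).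
  apply: fin_bigcap_measurable => // v _.
  by rewrite -[X in measurable X]setTI; exact: mb.
by apply/seteqP; split => x /= H v vs; exact: H.
Qed.

Lemma bits_product_law : exists P : probability (config V) R,
  forall (s : seq V) (eta : V -> bool), uniq s ->
    P (cylinder s eta) = (\prod_(v <- s) bernoulli_pmf p (eta v))%:E.
Proof.
have mX' : @measurable_fun _ _ (measurableTypeR R) (config V) setT X := mX.
pose Y : {mfun measurableTypeR R >-> config V} := HB.pack X (@isMeasurableFun.Build _ _ (measurableTypeR R) (config V) X mX').
exists (distribution U Y) => s eta us.
pose sg n := if unpickle n is Some v then eta v else false.
have -> : \prod_(v <- s) bernoulli_pmf p (eta v) =
          \prod_(n <- map pickle s) pmf (sg n).
  by rewrite big_map; apply: eq_bigr => v _; rewrite /sg pickleK.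
rewrite -bits_law; last by rewrite map_inj_uniq //; exact: pcan_inj pickleK.
rewrite /distribution /pushforward /=; congr (U _).
apply/seteqP; split => x /= H.
  by move=> _ /mapP[v vs ->]; rewrite /sg pickleK; exact: H.
by move=> v vs; have := H _ (map_f pickle vs); rewrite /sg pickleK.
Qed.

End product_law_exists.

Lemma product_law_exists (R : realType) (V : countType) (p : {i01 R}) :
  exists P : probability (config V) R, product_law p P.
Proof. by apply: bits_product_law. Qed.

Lemma cylinder_measurable (V : countType) (s : seq V) (eta : V -> bool) :
  measurable (cylinder s eta : set (config V)).
Proof. by apply: sub_sigma_algebra; exists (s, eta). Qed.

Lemma product_law_unique (R : realType) (V : countType) (p : {i01 R})
    (P Q : probability (config V) R) : product_law p P -> product_law p Q ->
  forall A, measurable A -> P A = Q A.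
Proof.
move=> HP HQ A mA; pose G := cylinders (V := V) `|` [set set0].
have cG s eta : G (cylinder s eta) by left; exists (s, eta).
have c0 : cylinder [::] (fun _ : V => true) = setT by apply/seteqP; split.
apply: (@g_sigma_algebra_measure_unique _ _ (config V) G _ (fun _ => setT)).
- by move=> _ [[[s eta] _ <-]|->]; [exact: cylinder_measurable|exact: measurable0].
- by move=> _; rewrite -c0.
- by rewrite bigcup_const.
- move=> B C [[[s eta] _ <-]|->]; last by rewrite set0I; right.
  move=> [[[t zeta] _ <-]|->]; last by rewrite setI0; right.
  have [->|/set0P[w [ws wt]]] := eqVneq (cylinder s eta `&` cylinder t zeta) set0.
    by right.
  rewrite (_ : _ `&` _ = cylinder (s ++ t) w) //.
  apply/seteqP; split => u.
    move=> [us ut] v; rewrite mem_cat => /orP[] vs.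
      by rewrite us // ws.
    by rewrite ut // wt.
  move=> H; split => v vs; rewrite H ?mem_cat ?vs ?orbT //; [exact: ws|exact: wt].
- move=> _ [[[s eta] _ <-]|->]; last by rewrite !measure0.
  have -> : cylinder s eta = cylinder (undup s) eta.
    by apply/seteqP; split => w /= H v vs; apply: H; move: vs; rewrite mem_undup.
  exact: etrans (HP _ _ (undup_uniq s)) (esym (HQ _ _ (undup_uniq s))).
- by move=> k; exact: le_lt_trans (probability_le1 P measurableT) (ltry _).
- have sub : cylinders (V := V) `<=` G by move=> B; left.
  exact: (sub_sigma_algebra2 sub mA).
Qed.

Definition site_measure (R : realType) (V : countType) (p : {i01 R}) :
    probability (config V) R := projT1 (cid (product_law_exists V p)).

Lemma site_measureP (R : realType) (V : countType) (p : {i01 R}) :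
  product_law p (site_measure V p).
Proof. exact: projT2 (cid (product_law_exists V p)). Qed.

Definition open_connected (V : countType) (adj : rel V) (w : config V)
    (v u : V) : Prop :=
  exists s : seq V,
    [/\ path adj v s, last v s = u, uniq (v :: s) & all w (v :: s)].

Definition cluster (V : countType) (adj : rel V) (w : config V) (v : V) :
  set V := [set u | open_connected adj w v u].

Definition percolates (V : countType) (adj : rel V) (v : V) :
  set (config V) := [set w | infinite_set (cluster adj w v)].

Lemma measurable_percolates (V : countType) (adj : rel V) (v : V) :
  measurable (percolates adj v).
Proof.
have mU (I : countType) (D : set I) (F : I -> set (config V)) :
    (forall i, D i -> measurable (F i)) -> measurable (\bigcup_(i in D) F i).
  move=> mF; rewrite bigcup_mkcond; apply: countable_bigcupT_measurable => // i.
  by case: ifPn => // /set_mem; exact: mF.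
have mC u : measurable [set w : config V | open_connected adj w v u].
  rewrite [X in measurable X](_ : _ = \bigcup_(s in
      [set s | [/\ path adj v s, last v s = u & uniq (v :: s)]])
      cylinder (v :: s) (fun=> true)).
    by apply: mU => // s _; exact: cylinder_measurable.
  apply/seteqP; split => w.
    by move=> [s [ps ls us /allP aw]]; exists s.
  by move=> [s [ps ls us] aw]; exists s; split => //; apply/allP => x /aw.
rewrite [X in measurable X](_ : _ = ~` \bigcup_(F in [set: seq V])
   \bigcap_(u in [set u | u \notin F]) ~` [set w | open_connected adj w v u]).
  apply: measurableC; apply: (mU) => // F _.
  rewrite -[X in measurable X]setCK setC_bigcap; apply: measurableC.
  apply: mU => // u _.
  by rewrite setCK; exact: mC.
apply/seteqP; split => w /= H.
  move=> [F _ HF]; apply: H.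
  apply: (@sub_finite_set _ _ [set` F]); last exact: finite_seq.
  by move=> u wu /=; apply: contrapT => /negP uF; exact: HF wu.
move=> /finite_seqP[F FE]; apply: H; exists F => // u /= uF wu.
by move/negP: uF; apply; have : cluster adj w v u := wu; rewrite FE.
Qed.

Definition theta (R : realType) (V : countType) (adj : rel V) (v : V)
  (p : {i01 R}) : \bar R := site_measure V p (percolates adj v).

(* For a connected graph the value does not depend on the base vertex v. *)
Definition pc (R : realType) (V : countType) (adj : rel V) (v : V) : R :=
  sup [set p%:num | p in [set p : {i01 R} | theta adj v p = 0%E]].

Definition bond (d m : nat) : rel 'rV[int]_d := fun u v =>
  [exists i, (`|v 0 i - u 0 i| == m%:Z) &&
     [forall j, (j != i) ==> (v 0 j == u 0 j)]].

(* With 0-based indices, the i-th long bond has length k_0 k_1 ... k_i. *)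
Definition Gk_adj (d n : nat) (k : 'I_n -> nat) : rel 'rV[int]_d := fun u v =>
  bond 1 u v || [exists i : 'I_n, bond (\prod_(j < n | (j <= i)%N) k j)%N u v].

Definition Zd_adj (m : nat) : rel 'rV[int]_m := fun u v =>
  \sum_i `|v 0 i - u 0 i| == 1.

(* Main.v *)
(* Lower bound. Send the coordinate (i, j) of Z^(d(n+1)) to the axis i of Z^d with
   weight k_1 ... k_j. Every bond of G^k lifts along this projection, so an
   exploration of the cluster of 0 in G^k can be simulated in Z^(d(n+1)) by
   always examining fresh vertices: theta for G^k is at most theta for
   Z^(d(n+1)).

   Upper bound. When the k_i are large the projection is injective on a slab that
   is planar along two coordinates of largest weight and bounded in all others,
   so it suffices that slabs percolate just above the threshold (Grimmett and
   Marstrand). If theta(p) > 0, then with high probability a large cube is joined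
   inside a box to a fully open cube, a seed, behind any prescribed quarter of
   any face of the box. After sprinkling, seeds are grown from seeds along a
   coarse planar lattice, steered towards the axes of its corridors, and each
   step fails with small probability whatever the past. Call a 3 x 3 block of
   coarse blocks bad when at least two of these are bad: bad blocks of level k
   are so unlikely that the coarse cluster of the origin is large with
   probability at least 1/2. Everything happens in finite lists of independent
   bits; the infinite product measure enters through cylinders only. *)
Require Import Defs.
From mathcomp Require Import all_boot all_order all_algebra.
From mathcomp Require Import all_classical all_reals all_analysis.
From mathcomp Require Import perm lra ring zify.
Set Implicit Arguments.
Unset Strict Implicit.
Unset Printing Implicit Defensive.
Import Order.TTheory GRing.Theory Num.Theory.
Local Open Scope ring_scope.

(** * Finite product expectations *)

(** The obstacle is the negative information that earlier steps leave behind: vertices found closed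
    surround the reached set. Each step owns a layer of independent bits of density [del] that gives
    such vertices a second chance. A crossing that is likely in an untouched box forces many of them
    to lead to a target, so one of them opens with high probability. A coarse site takes 32 steps:
    16 to cross the corridor from its parent and four for each of four arms. Sites close enough to
    read the same vertex are told apart by the parities of their coordinates, so 4 * 32 = 128 layers
    suffice, and the density rises only from [p] to [1 - (1 - p) * (1 - del) ^+ 128]. Steps depend
    on the past, so what is bounded is the probability that a given set of labelled steps all fail:
    [eps] to the number of labels. A bad block of level k contains 2^k failed labels, chosen in
    2304^(2^k) / 72 ways; 2304 is 72 * 32, with 72 ordered pairs of distinct cells and 32 steps.
    Hence [eps] is 1 / (4 * 2304), which makes the sum over all levels at most 1/2. Neither
    ergodicity nor uniqueness of the infinite cluster enters: a finite-volume argument shows that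
    large cubes have long arms. *)

Notation ind P := ((`[< P >] : bool)%:R).

Section Expectation.
Context {R : realFieldType} {T : eqType}.
Implicit Types (q : T -> R) (f g : (T -> bool) -> R) (w : T -> bool) (s : seq T).

Definition upd w t b : T -> bool := fun u => if u == t then b else w u.

(* The bits in s are resampled independently, t being open with probability
   q t; the other bits are those of w. *)
Fixpoint Ex q s f w : R :=
  if s is t :: s' then
    q t * Ex q s' f (upd w t true) + (1 - q t) * Ex q s' f (upd w t false)
  else f w.

Definition Pr q s (A : (T -> bool) -> Prop) w := Ex q s (fun w' => ind (A w')) w.

Definition dep (I : T -> Prop) (S : Type) (f : (T -> bool) -> S) :=
  forall w w', (forall t, I t -> w t = w' t) -> f w = f w'.

Definition incr f := forall w w', (forall t, w t -> w' t) -> f w <= f w'.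

Definition prob q := forall t, 0 <= q t <= 1.

Lemma updxx w t b : upd w t b t = b.
Proof. by rewrite /upd eqxx. Qed.

Lemma upd_neq w t b u : u != t -> upd w t b u = w u.
Proof. by rewrite /upd => /negbTE ->. Qed.

Lemma upd_upd w t b c : upd (upd w t b) t c = upd w t c.
Proof. by apply/funext => u; rewrite /upd; case: eqP. Qed.

Lemma upd_comm w t u b c : t != u ->
  upd (upd w t b) u c = upd (upd w u c) t b.
Proof.
move=> tu; apply/funext => x; rewrite /upd.
by have [->|//] := eqVneq x u; rewrite eq_sym (negbTE tu).
Qed.

Lemma Ex_eq q s f g w : f =1 g -> Ex q s f w = Ex q s g w.
Proof. by move=> fg; congr (Ex _ _ _ _); apply/funext. Qed.

Lemma Ex_cst q s c w : Ex q s (fun=> c) w = c.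
Proof. by elim: s w => //= t s IH w; rewrite !IH; ring. Qed.

Lemma ExD q s f g w : Ex q s (fun w => f w + g w) w = Ex q s f w + Ex q s g w.
Proof. by elim: s w => //= t s IH w; rewrite !IH; ring. Qed.

Lemma ExZ q s c f w : Ex q s (fun w => c * f w) w = c * Ex q s f w.
Proof. by elim: s w => //= t s IH w; rewrite !IH; ring. Qed.

Lemma ExB q s f g w : Ex q s (fun w => f w - g w) w = Ex q s f w - Ex q s g w.
Proof. by elim: s w => //= t s IH w; rewrite !IH; ring. Qed.

Lemma Ex_sum q s (J : Type) (r : seq J) (F : J -> (T -> bool) -> R) w :
  Ex q s (fun w => \sum_(j <- r) F j w) w = \sum_(j <- r) Ex q s (F j) w.
Proof.
elim: r => [|j r IH].
  rewrite big_nil -[RHS](Ex_cst q s 0 w); apply: Ex_eq => w'.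
  by rewrite big_nil.
by rewrite big_cons -IH -ExD; apply: Ex_eq => w'; rewrite big_cons.
Qed.

Lemma le_Ex q s f g w : prob q -> (forall w, f w <= g w) ->
  Ex q s f w <= Ex q s g w.
Proof.
move=> hq fg; elim: s w => //= t s IH w.
have /andP[q0 q1] := hq t.
by apply: lerD; apply: ler_wpM2l => //; rewrite subr_ge0.
Qed.

Lemma Ex_ge0 q s f w : prob q -> (forall w, 0 <= f w) -> 0 <= Ex q s f w.
Proof. by move=> hq f0; rewrite -(Ex_cst q s 0 w); apply: le_Ex. Qed.

Lemma ind_ge0 (P : Prop) : 0 <= ind P :> R.
Proof. exact: ler0n. Qed.

Lemma ind_le1 (P : Prop) : ind P <= 1 :> R.
Proof. by rewrite lern1; case: asbool. Qed.

Lemma ind_le (P Q : Prop) : (P -> Q) -> ind P <= ind Q :> R.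
Proof. by move=> PQ; rewrite ler_nat; case: (asboolP P) => // /PQ/asboolT ->. Qed.

Lemma Pr_ge0 q s A w : prob q -> 0 <= Pr q s A w.
Proof. by move=> hq; apply: Ex_ge0 => // w'; exact: ind_ge0. Qed.

Lemma Pr_le1 q s A w : prob q -> Pr q s A w <= 1.
Proof. by move=> hq; rewrite -(Ex_cst q s 1 w); apply: le_Ex => // w'; exact: ind_le1. Qed.

Lemma le_Pr q s (A B : (T -> bool) -> Prop) w : prob q -> (forall w, A w -> B w) ->
  Pr q s A w <= Pr q s B w.
Proof. by move=> hq AB; apply: le_Ex => // w'; apply: ind_le; exact: AB. Qed.

Lemma eq_Pr q s (A B : (T -> bool) -> Prop) w : (forall w, A w <-> B w) ->
  Pr q s A w = Pr q s B w.
Proof. by move=> AB; apply: Ex_eq => w'; rewrite (asbool_equiv_eq (AB w')). Qed.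

Lemma PrC q s A w : Pr q s (fun w => ~ A w) w = 1 - Pr q s A w.
Proof.
rewrite /Pr -[X in X - _](Ex_cst q s 1 w) -ExB; apply: Ex_eq => w'.
by rewrite asbool_neg; case: asbool; rewrite /= ?subrr ?subr0.
Qed.

Lemma Pr_or q s A B w : prob q ->
  Pr q s (fun w => A w \/ B w) w <= Pr q s A w + Pr q s B w.
Proof.
move=> hq; rewrite /Pr -ExD; apply: le_Ex => // w'; rewrite -natrD ler_nat asbool_or.
by do 2!case: asbool.
Qed.

Lemma Pr_exists q s (J : eqType) (r : seq J) (A : J -> (T -> bool) -> Prop) w : prob q ->
  Pr q s (fun w => exists2 j, j \in r & A j w) w <= \sum_(j <- r) Pr q s (A j) w.
Proof.
move=> hq; rewrite /Pr -Ex_sum; apply: le_Ex => // w'.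
case: asboolP => [[j jr Aj]|_]; last by apply: sumr_ge0 => j _; exact: ind_ge0.
rewrite (big_rem j) //= asboolT // lerDl.
by apply: sumr_ge0 => i _; exact: ind_ge0.
Qed.

Lemma Ex_nd q s f t : (forall w b, f (upd w t b) = f w) ->
  forall w b, Ex q s f (upd w t b) = Ex q s f w.
Proof.
move=> nd; elim: s => //= u s IH w b.
have [->|tu] := eqVneq t u; first by rewrite !upd_upd.
by rewrite !(upd_comm _ _ _ tu) !IH.
Qed.

Lemma Ex_swap q t u s f w : Ex q (t :: u :: s) f w = Ex q (u :: t :: s) f w.
Proof.
have [->//|tu] := eqVneq t u.
by rewrite /= !(upd_comm w _ _ tu); ring.
Qed.

Lemma Ex_rem q t s f w : t \in s -> Ex q s f w = Ex q (t :: rem t s) f w.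
Proof.
elim: s w => // u s IH w; rewrite inE /=; have [->//|ut] := eqVneq t u.
move=> ts.
transitivity (Ex q (u :: t :: rem t s) f w); first by rewrite /= !IH.
by rewrite Ex_swap.
Qed.

Lemma Ex_drop q t s f w : (forall w b, f (upd w t b) = f w) ->
  Ex q (t :: s) f w = Ex q s f w.
Proof. by move=> nd; rewrite /= !(Ex_nd _ _ nd); ring. Qed.

Lemma dep_nd (I : T -> Prop) (S : Type) (f : (T -> bool) -> S) t : dep I f -> ~ I t ->
  forall w b, f (upd w t b) = f w.
Proof.
move=> df nI w b; apply: df => u Iu; apply: upd_neq.
by apply: contra_notN nI => /eqP <-.
Qed.

(** Bits that [f] does not read integrate out, and the base configuration matters only at the bits
    of [I] that are never sampled. [Ex_base] and [Ex_widen] are the cases where [I] is the sample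
    list itself. *)
Lemma Ex_incl q (I : T -> Prop) f s' : dep I f -> forall s w w', uniq s -> uniq s' ->
  {subset s <= s'} -> (forall t, I t -> t \in s' -> t \in s) ->
  (forall t, I t -> t \notin s' -> w t = w' t) ->
  Ex q s' f w = Ex q s f w'.
Proof.
move=> df; elim: s' => [|t s' IH] s w w' us us' ss Is ww.
  have -> : s = [::] by case: s ss {us Is} => // x s /(_ x); rewrite inE eqxx => /(_ isT).
  by apply: df => t It; exact: ww.
have /andP[ts' us''] := us'.
have [ts|ts] := boolP (t \in s).
  rewrite (Ex_rem _ _ _ ts) /=.
  have E b : Ex q s' f (upd w t b) = Ex q (rem t s) f (upd w' t b).
    apply: IH => //; first exact: rem_uniq.
    - move=> u; rewrite (mem_rem_uniq _ us) !inE => /andP[ut us1].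
      by have := ss _ us1; rewrite inE (negbTE ut).
    - move=> u Iu us1; rewrite (mem_rem_uniq _ us) !inE.
      rewrite (Is u) ?inE ?us1 ?orbT ?andbT //.
      by apply: contraNneq ts' => <-.
    - move=> u Iu us1; rewrite /upd; have [//|ut] := eqVneq u t.
      by apply: ww => //; rewrite inE negb_or ut.
  by rewrite !E.
have nI : ~ I t by move=> It; case/negP: ts; apply: Is; rewrite // inE eqxx.
rewrite Ex_drop; last exact: dep_nd df nI.
apply: IH => //.
- move=> u us1; have := ss _ us1; rewrite inE => /orP[/eqP ut|//].
  by rewrite -ut us1 in ts.
- by move=> u Iu us1; apply: Is => //; rewrite inE us1 orbT.
- move=> u Iu us1; apply: ww => //; rewrite inE negb_or us1 andbT.
  by apply: contra_notN nI => /eqP <-.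
Qed.

Lemma Ex_base q f s w w' : dep (fun t => t \in s) f -> uniq s ->
  Ex q s f w = Ex q s f w'.
Proof. by move=> df us; apply: (Ex_incl q df) => // t ->. Qed.

Lemma Ex_widen q f s s' w w' : dep (fun t => t \in s) f -> uniq s -> uniq s' ->
  {subset s <= s'} -> Ex q s' f w = Ex q s f w'.
Proof. by move=> df us us' ss; apply: (Ex_incl q df) => // t /ss ->. Qed.

(** Each sampled bit is ignored by at least one of the two factors, which can then be pulled out of
    the average over that bit. *)
Lemma Ex_indep q s f g (I J : T -> Prop) w : dep I f -> dep J g ->
  (forall t, I t -> J t -> False) ->
  Ex q s (fun w => f w * g w) w = Ex q s f w * Ex q s g w.
Proof.
move=> df dg IJ; elim: s w => //= t s IH w; rewrite !IH.
have [It|nI] := pselect (I t).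
  have nd := dep_nd dg (IJ t It); rewrite !(Ex_nd q s nd); ring.
have nd := dep_nd df nI; rewrite !(Ex_nd q s nd); ring.
Qed.

Lemma Ex_incr q s f : prob q -> incr f -> incr (Ex q s f).
Proof.
move=> hq mf; elim: s => //= t s IH w w' ww.
have /andP[q0 q1] := hq t.
apply: lerD; apply: ler_wpM2l; rewrite ?subr_ge0 //; apply: IH => u; rewrite /upd;
  by case: eqP => // _; exact: ww.
Qed.

Lemma Ex_upd_le q s f w t : prob q -> incr f ->
  Ex q s f (upd w t false) <= Ex q s f (upd w t true).
Proof.
by move=> hq mf; apply: (@Ex_incr q s f hq mf) => u; rewrite /upd; case: eqP.
Qed.

Lemma Harris q s f g w : prob q -> incr f -> incr g ->
  Ex q s f w * Ex q s g w <= Ex q s (fun w => f w * g w) w.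
Proof.
move=> hq mf mg; elim: s w => //= t s IH w.
have fle := Ex_upd_le s w t hq mf; have gle := Ex_upd_le s w t hq mg.
have := IH (upd w t true); have := IH (upd w t false).
have /andP[q0 q1] := hq t.
set a0 := Ex q s f _ in fle *; set a1 := Ex q s f _ in fle *.
set b0 := Ex q s g _ in gle *; set b1 := Ex q s g _ in gle *.
set c0 := Ex q s _ _; set c1 := Ex q s _ _ => h0 h1.
(* The covariance due to the bit [t] alone: this product is exactly the difference of the two sides
   of the next inequality. *)
have d0 : 0 <= q t * (1 - q t) * ((a1 - a0) * (b1 - b0)).
  by rewrite !mulr_ge0 // subr_ge0.
apply: (@le_trans _ _ (q t * (a1 * b1) + (1 - q t) * (a0 * b0))).
  by rewrite -subr_ge0; move: d0; congr (_ <= _); ring.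
by apply: lerD; apply: ler_wpM2l => //; rewrite subr_ge0.
Qed.

Lemma Harris_decr q s f g w : prob q -> incr (fun w => - f w) -> incr (fun w => - g w) ->
  Ex q s f w * Ex q s g w <= Ex q s (fun w => f w * g w) w.
Proof.
move=> hq mf mg; have := Harris s w hq mf mg.
have E h : Ex q s (fun w => - h w) w = - Ex q s h w.
  by rewrite -[RHS]mulN1r -ExZ; apply: Ex_eq => w'; rewrite mulN1r.
rewrite !E mulrNN => /le_trans; apply; rewrite le_eqVlt; apply/orP; left.
by apply/eqP; apply: Ex_eq => w'; rewrite mulrNN.
Qed.

Lemma Harris_decr_all q s (J : eqType) (r : seq J) (A : J -> (T -> bool) -> Prop) w : prob q ->
  (forall j w w', (forall t, w t -> w' t) -> A j w' -> A j w) ->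
  \prod_(j <- r) Pr q s (A j) w <= Pr q s (fun w => forall j, j \in r -> A j w) w.
Proof.
move=> hq dA.
have mA B : (forall w w', (forall t, w t -> w' t) -> B w' -> B w) ->
    incr (fun w => - ind (B w)).
  by move=> dB w1 w2 ww; rewrite lerN2; apply: ind_le; exact: dB.
elim: r => [|j r IH].
  rewrite big_nil -(Ex_cst q s 1 w); apply: le_Ex => // w'.
  by rewrite asboolT.
rewrite big_cons; apply: le_trans (_ : Pr q s (A j) w *
    Pr q s (fun w => forall j, j \in r -> A j w) w <= _).
  by apply: ler_wpM2l => //; exact: Pr_ge0.
apply: le_trans (Harris_decr _ _ hq _ _) _.
- by apply: mA => w1 w2 ww; exact: dA.
- by apply: mA => w1 w2 ww H i ir; apply: (dA _ _ w2) => //; exact: H.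
apply: le_Ex => // w'; rewrite -natrM ler_nat.
case: asboolP => // Aj; case: asboolP => // Ar; rewrite asboolT // => i.
by rewrite inE => /orP[/eqP ->//|]; exact: Ar.
Qed.

Lemma Ex_le_param q q' s f w : prob q -> prob q' -> (forall t, q t <= q' t) -> incr f ->
  Ex q s f w <= Ex q' s f w.
Proof.
move=> hq hq' qq mf; elim: s w => //= t s IH w.
have le1 := Ex_upd_le s w t hq' mf.
have := IH (upd w t true); have := IH (upd w t false).
have /andP[q0 q1] := hq t; have qt := qq t.
set a0 := Ex q s f _; set a1 := Ex q s f _.
set b0 := Ex q' s f _ in le1 *; set b1 := Ex q' s f _ in le1 * => h0 h1.
apply: (@le_trans _ _ (q t * b1 + (1 - q t) * b0)).
  by apply: lerD; apply: ler_wpM2l => //; rewrite subr_ge0.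
rewrite -subr_ge0.
have -> : q' t * b1 + (1 - q' t) * b0 - (q t * b1 + (1 - q t) * b0) =
   (q' t - q t) * (b1 - b0) by ring.
by rewrite mulr_ge0 // subr_ge0.
Qed.

(** [Ex] evaluates its integrand only at configurations obtained from [w] by resampling [s].
    Quantifying over these keeps the fact that all other bits still have their values in [w], which
    a comparison at all configurations would lose. *)
Fixpoint allc s w (P : (T -> bool) -> Prop) : Prop :=
  if s is t :: s' then allc s' (upd w t true) P /\ allc s' (upd w t false) P
  else P w.

Lemma Ex_eq_allc q s f g w : allc s w (fun w => f w = g w) -> Ex q s f w = Ex q s g w.
Proof. by elim: s w => //= t s IH w [/IH -> /IH ->]. Qed.

Lemma allc_impl s w (P Q : (T -> bool) -> Prop) : (forall w, P w -> Q w) -> allc s w P -> allc s w Q.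
Proof.
move=> PQ; elim: s w => [|t s IH] w /=; first exact: PQ.
by move=> [H1 H2]; split; exact: IH.
Qed.

Lemma allc_agree s w : allc s w (fun w' => forall t, t \notin s -> w' t = w t).
Proof.
elim: s w => //= t s IH w.
by split; apply: allc_impl (IH _) => w' H u; rewrite inE negb_or => /andP[ut us];
  rewrite H // upd_neq.
Qed.

(** Conditioning on [X] becomes a finite sum over this list. [{classic S}] supplies the equality
    test, since [X] may be a set of vertices. *)
Fixpoint vals (S : Type) s (X : (T -> bool) -> S) w : seq {classic S} :=
  if s is t :: s' then vals s' X (upd w t true) ++ vals s' X (upd w t false)
  else [:: X w].

Lemma vals_allc (S : Type) s (X : (T -> bool) -> S) w :
  allc s w (fun w' => (X w' : {classic S}) \in vals s X w).
Proof.
elim: s w => /= [w|t s IH w]; first by rewrite inE.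
split; apply: allc_impl (IH _) => w' H; by rewrite mem_cat H ?orbT.
Qed.

Lemma vals_mem (S : Type) s (X : (T -> bool) -> S) w x : x \in vals s X w ->
  exists w', x = X w'.
Proof.
elim: s w => /= [w|t s IH w]; first by rewrite inE => /eqP ->; exists w.
by rewrite mem_cat => /orP[] /IH.
Qed.

(* Conditioning on a random variable X that only reads the coordinates in
   I (X w), when the integrand then only reads the other ones: the law of the
   unread coordinates is not affected. *)
Lemma Ex_cond_le q s (S : Type) (X : (T -> bool) -> S) (I : S -> T -> Prop)
    (g : S -> (T -> bool) -> R) (h : S -> R) w : prob q ->
  (forall w w', (forall t, I (X w) t -> w t = w' t) -> X w' = X w) ->
  (forall w0, dep (fun t => ~ I (X w0) t) (g (X w0))) ->
  (forall w0, Ex q s (g (X w0)) w <= h (X w0)) ->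
  Ex q s (fun w => g (X w) w) w <= Ex q s (fun w => h (X w)) w.
Proof.
move=> hq hX hg hle.
pose xs := undup (vals s X w).
pose e (x : S) w' : R := ind (X w' = x).
have sumE (F : S -> (T -> bool) -> R) : Ex q s (fun w => F (X w) w) w =
    \sum_(x <- xs) Ex q s (fun w => e x w * F x w) w.
  rewrite -Ex_sum; apply: Ex_eq_allc; apply: allc_impl (vals_allc s X w) => w' Xw'.
  have Xx : (X w' : {classic S}) \in xs by rewrite mem_undup.
  rewrite (bigD1_seq _ Xx) ?undup_uniq //= /e asboolT // mul1r big1 ?addr0 // => x xX.
  rewrite asboolF ?mul0r // => E; by rewrite E eqxx in xX.
rewrite (sumE g) (sumE (fun x _ => h x)) big_seq [leRHS]big_seq.
apply: ler_sum => x; rewrite mem_undup => xv; have [w0 xE] := vals_mem xv; subst x.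
(* A stopping-set argument: agreement on [I (X w0)] with a configuration where [X] equals [X w0]
   forces the same value. The event therefore reads [I (X w0)] only and is independent of the
   integrand. *)
have dE : dep (I (X w0)) (e (X w0)).
  move=> w1 w2 H; rewrite /e; congr (_%:R); congr (nat_of_bool _).
  apply: asbool_equiv_eq; split => E; rewrite -E; apply: hX.
    by rewrite E.
  by rewrite E => t /H ->.
rewrite (Ex_indep q s w dE (hg w0)); last by move=> t It; exact.
rewrite (_ : Ex q s (fun w => e _ w * h _) w = Ex q s (e (X w0)) w * h (X w0)); last first.
  by rewrite mulrC -ExZ; apply: Ex_eq => w'; rewrite mulrC.
by apply: ler_wpM2l (hle w0); apply: Ex_ge0 => // w'; exact: ind_ge0.
Qed.

Lemma Ex_cond_ge q s (S : Type) (X : (T -> bool) -> S) (I : S -> T -> Prop)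
    (g : S -> (T -> bool) -> R) (h : S -> R) w : prob q ->
  (forall w w', (forall t, I (X w) t -> w t = w' t) -> X w' = X w) ->
  (forall w0, dep (fun t => ~ I (X w0) t) (g (X w0))) ->
  (forall w0, h (X w0) <= Ex q s (g (X w0)) w) ->
  Ex q s (fun w => h (X w)) w <= Ex q s (fun w => g (X w) w) w.
Proof.
move=> hq hX hg hle.
have E f : Ex q s (fun w => - f w) w = - Ex q s f w.
  by rewrite -[RHS]mulN1r -ExZ; apply: Ex_eq => w'; rewrite mulN1r.
rewrite -lerN2 -!E.
apply: (@Ex_cond_le q s S X I (fun x w => - g x w) (fun x => - h x)) => //.
- by move=> w0 w1 w2 H; rewrite (hg w0 w1 w2 H).
- by move=> w0; rewrite E lerN2.
Qed.

Lemma Ex_cat q s1 s2 f w : Ex q (s1 ++ s2) f w = Ex q s1 (Ex q s2 f) w.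
Proof. by elim: s1 w => //= t s IH w; rewrite !IH. Qed.

Lemma Ex_has_self q ts (F : bool -> R) w : uniq ts ->
  Ex q ts (fun w' => F (has w' ts)) w =
  (1 - \prod_(t <- ts) (1 - q t)) * F true + (\prod_(t <- ts) (1 - q t)) * F false.
Proof.
elim: ts F w => [|t ts IH] F w; first by move=> _; rewrite big_nil /=; ring.
move=> /= /andP[tts uts]; rewrite big_cons.
have E b : Ex q ts (fun w' => F (w' t || has w' ts)) (upd w t b) =
    Ex q ts (fun w' => F (b || has w' ts)) (upd w t b).
  apply: Ex_eq_allc; apply: allc_impl (allc_agree _ _) => w' /(_ t tts) ->.
  by rewrite updxx.
rewrite !E (IH (fun b => F (true || b))) // (IH (fun b => F (false || b))) //=.
ring.
Qed.

Lemma Ex_has q s ts (F : bool -> R) w : uniq s -> uniq ts -> {subset ts <= s} ->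
  Ex q s (fun w' => F (has w' ts)) w =
  (1 - \prod_(t <- ts) (1 - q t)) * F true + (\prod_(t <- ts) (1 - q t)) * F false.
Proof.
move=> us uts ss; rewrite -(Ex_has_self q F w uts); apply: Ex_widen => // w1 w2 H.
by congr F; apply: eq_in_has => t /H.
Qed.

Lemma Ex_all_self q ts (F : bool -> R) w : uniq ts ->
  Ex q ts (fun w' => F (all w' ts)) w =
  (\prod_(t <- ts) q t) * F true + (1 - \prod_(t <- ts) q t) * F false.
Proof.
elim: ts F w => [|t ts IH] F w; first by move=> _; rewrite big_nil /=; ring.
move=> /= /andP[tts uts]; rewrite big_cons.
have E b : Ex q ts (fun w' => F (w' t && all w' ts)) (upd w t b) =
    Ex q ts (fun w' => F (b && all w' ts)) (upd w t b).
  apply: Ex_eq_allc; apply: allc_impl (allc_agree _ _) => w' /(_ t tts) ->.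
  by rewrite updxx.
rewrite !E (IH (fun b => F (true && b))) // (IH (fun b => F (false && b))) //=.
ring.
Qed.

Lemma Ex_all q s ts (F : bool -> R) w : uniq s -> uniq ts -> {subset ts <= s} ->
  Ex q s (fun w' => F (all w' ts)) w =
  (\prod_(t <- ts) q t) * F true + (1 - \prod_(t <- ts) q t) * F false.
Proof.
move=> us uts ss; rewrite -(Ex_all_self q F w uts); apply: Ex_widen => // w1 w2 H.
by congr F; apply: eq_in_all => t /H.
Qed.

End Expectation.

Lemma Ex_map (R : realFieldType) (T T' : eqType) (phi : T -> T') (q : T' -> R) s
    (f : (T -> bool) -> R) w : injective phi ->
  Ex q (map phi s) (fun w => f (w \o phi)) w = Ex (q \o phi) s f (w \o phi).
Proof.
move=> iphi; elim: s w => //= t s IH w; rewrite !IH.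
have E b : upd w (phi t) b \o phi = upd (w \o phi) t b.
  by apply/funext => u; rewrite /upd /= (inj_eq iphi).
by rewrite !E.
Qed.

Section Layers.
Context {R : realFieldType} {V : eqType}.

Definition layers (C : nat) (v : V) : seq (V * nat) := [seq (v, l) | l <- iota 0 C].

Definition collapse (C : nat) (w : V * nat -> bool) : V -> bool :=
  fun v => has w (layers C v).

Lemma flatten_layers_uniq C (s : seq V) : uniq s -> uniq (flatten (map (layers C) s)).
Proof.
elim: s => //= v s IH /andP[vs us].
rewrite cat_uniq IH // andbT map_inj_uniq ?iota_uniq //; last by move=> a b [].
apply/hasPn => _ /flatten_mapP[u us' /mapP[j _ ->]]; apply/mapP => -[j' _ [uv _]].
by rewrite -uv us' in vs.
Qed.

Lemma mem_flatten_layers C (s : seq V) v j : v \in s -> (j < C)%N ->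
  (v, j) \in flatten (map (layers C) s).
Proof.
by move=> vs jC; apply/flatten_mapP; exists v => //; apply: map_f; rewrite mem_iota.
Qed.

(** A vertex stays closed only if all its layers are closed, so the collapsed bits are again
    independent and the probabilities of being closed multiply. *)
Lemma Ex_collapse (q : V * nat -> R) C (s : seq V) (f : (V -> bool) -> R) w : uniq s ->
  Ex q (flatten (map (layers C) s)) (fun w => f (collapse C w)) w =
  Ex (fun v => 1 - \prod_(t <- layers C v) (1 - q t)) s f (collapse C w).
Proof.
elim: s w => //= v s IH w /andP[vs us]; rewrite Ex_cat.
have uL : uniq (layers C v) by rewrite map_inj_uniq ?iota_uniq // => a b [].
set Q := fun v => 1 - _.
transitivity (Ex q (layers C v) (fun w' => Ex Q s f (collapse C w')) w).
  by apply: Ex_eq => w'; exact: IH.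
transitivity (Ex q (layers C v)
  (fun w' => (fun b => Ex Q s f (upd (collapse C w) v b)) (has w' (layers C v))) w).
  apply: Ex_eq_allc; apply: allc_impl (allc_agree _ _) => w' H; congr (Ex _ _ _ _).
  apply/funext => u; rewrite /upd; have [->//|uv] := eqVneq u v.
  apply: eq_in_has => _ /mapP[l _ ->]; apply: H; apply/mapP => -[l' _ [E _]].
  by rewrite E eqxx in uv.
by rewrite (Ex_has_self q (fun b => Ex Q s f (upd (collapse C w) v b))) // /Q; ring.
Qed.

End Layers.

(** * Connections and one sprinkled step *)

Section Reach.
Context {V : Type}.
Implicit Types (adj : rel V) (O X : V -> Prop).

(* The starting set X need not be contained in O. *)
Inductive reach adj O X : V -> Prop :=
| reach_in v : X v -> reach adj O X v
| reach_step u v : reach adj O X u -> adj u v -> O v -> reach adj O X v.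

Lemma reach_sub adj O O' X X' v : (forall u, O u -> O' u) -> (forall u, X u -> X' u) ->
  reach adj O X v -> reach adj O' X' v.
Proof.
move=> OO XX; elim=> [u /XX|u u' _ H uu' /OO]; first exact: reach_in.
exact: reach_step H uu'.
Qed.

Lemma reach_trans adj O X v : reach adj O (reach adj O X) v -> reach adj O X v.
Proof. by elim=> // u u' _ H uu' Ou'; exact: reach_step H _ _. Qed.

Lemma reach_region adj O X v : reach adj O X v -> X v \/ O v.
Proof. by case=> [u|u u' _ _]; [left|right]. Qed.

End Reach.

Section Step.
Context {R : realFieldType} {V : eqType}.
Variables (adj : rel V) (q : V * nat -> R) (p del : R) (Reg : seq V) (l : nat).
Variables (A Z S : V -> Prop) (Tg : seq (seq V)).
Hypotheses (hq : prob q) (q0 : forall v, q (v, 0%N) = p) (ql : forall v, q (v, l) = del).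
Hypotheses (l0 : l != 0%N) (p1 : p < 1) (uReg : uniq Reg).
Hypotheses (AZ : forall v, A v -> Z v)
  (ZA : forall v, Z v -> ~ A v -> exists2 u, A u & adj u v)
  (SA : forall v, S v -> A v).
Hypotheses (TgReg : forall b, b \in Tg -> {subset b <= Reg})
  (TgZ : forall b v, b \in Tg -> v \in b -> ~ Z v)
  (Tgc : forall b u v, b \in Tg -> u \in b -> v \in b ->
    reach adj (fun x => x \in b) (eq u) v).

(** The base bit of a vertex in [Z] may already be known to be closed; such a vertex is judged by
    its bit in layer [l] instead. *)
Definition step_open (w : V * nat -> bool) v :=
  v \in Reg /\ ((~ Z v /\ w (v, 0%N)) \/ (Z v /\ w (v, l))).

Definition step_set w : V -> Prop := reach adj (step_open w) A.

Definition step_revealed (A' : V -> Prop) v :=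
  Z v \/ A' v \/ (v \in Reg /\ exists2 u, A' u & adj u v).

(** All bits of layer [l] on [Z] inside the region count as read, consulted or not: in this part of
    the lattice the layer belongs to the present step. *)
Definition step_bits (A' : V -> Prop) (t : V * nat) :=
  t.1 \in Reg /\ ((t.2 = 0%N /\ ~ Z t.1 /\ step_revealed A' t.1) \/ (t.2 = l /\ Z t.1)).

Definition step_succ (A' : V -> Prop) := exists2 b, b \in Tg & forall y, y \in b -> A' y.

Definition crosses (w : V -> bool) := exists2 b, b \in Tg &
  (forall y, y \in b -> w y) /\ exists2 x, x \in b & reach adj (fun v => v \in Reg /\ w v) S x.

(** The exploration inspects every neighbour of what it reaches, so the inspected bits certify where
    it stops. This is the condition that [Ex_cond_le] imposes on a conditioning variable. *)
Lemma step_set_bits w w' : (forall t, step_bits (step_set w) t -> w t = w' t) ->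
  step_set w' = step_set w.
Proof.
move=> ww; apply/funext => v; apply/propext.
have agree u : step_set w u -> step_open w u -> step_open w' u.
  move=> Su [uR H]; split=> //; case: H => -[Zu wu]; [left|right]; split=> //.
    by rewrite -ww //; split=> //; left; split=> //; split=> //; right; left.
  by rewrite -ww //; split=> //; right.
split.
  elim=> [u Au|u u' _ H uu' [u'R O]]; first exact: reach_in.
  apply: (reach_step H uu'); split=> //; case: O => -[Zu wu]; [left|right]; split=> //.
    rewrite ww //; split=> //; left; split=> //; split=> //; right; right.
    by split=> //; exists u.
  by rewrite ww //; split=> //; right.
elim=> [u Au|u u' ru H uu' O]; first exact: reach_in.
by apply: (reach_step H uu'); apply: agree => //; exact: reach_step ru uu' O.
Qed.

Lemma step_set_sub w v : A v -> step_set w v.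
Proof. exact: reach_in. Qed.

Lemma step_revealed_boundary w v : step_revealed (step_set w) v -> ~ step_set w v ->
  exists2 u, step_set w u & adj u v.
Proof.
move=> [Zv|[//|[_ //]]] nS.
have [|u Au uv] := ZA Zv; first by move=> Av; apply: nS; exact: step_set_sub.
by exists u => //; exact: step_set_sub.
Qed.

Let hits (w : V * nat -> bool) u := exists2 b, b \in Tg & (forall y, y \in b -> w (y, 0%N)) /\
  exists2 x, x \in b & reach adj (fun v => [/\ v \in Reg, ~ Z v & w (v, 0%N)]) (eq u) x.

(** [None] means that a vertex of [A] already leads to a target through fresh open vertices. The
    step then cannot fail, and this case contributes 0 to both bounds below. *)
Let pivots (w : V * nat -> bool) : option (seq V) :=
  if `[< exists2 u, A u & hits w u >] then None
  else Some [seq u <- Reg | `[< [/\ Z u, ~ A u & hits w u] >]].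

Let hits_dep u : dep (fun t => t.2 = 0%N /\ ~ Z t.1) (hits^~ u).
Proof.
move=> w w' H; apply/propext.
have aux w1 w2 : (forall t : V * nat, t.2 = 0%N /\ ~ Z t.1 -> w1 t = w2 t) ->
    hits w1 u -> hits w2 u.
  move=> H12 [b bT [bw [x xb rx]]]; exists b => //; split.
    by move=> y yb; rewrite -H12; [exact: bw|split=> //; exact: TgZ bT yb].
  exists x => //; apply: reach_sub rx => // v [vR nZ wv]; split=> //.
  by rewrite -H12.
by split; apply: aux => // t /H.
Qed.

Let pivots_dep : dep (fun t => t.2 = 0%N /\ ~ Z t.1) pivots.
Proof.
move=> w w' H; rewrite /pivots.
have E u : hits w u = hits w' u by exact: hits_dep.
have -> : (exists2 u, A u & hits w u) = (exists2 u, A u & hits w' u).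
  by apply/propext; split=> -[u Au Hu]; exists u; rewrite ?E // -E.
case: asboolP => // _; congr Some; apply: eq_filter => u /=.
by rewrite E.
Qed.

Let hits_step (w : V * nat -> bool) u : step_set w u -> hits w u -> step_succ (step_set w).
Proof.
move=> Su [b bT [bw [x xb rx]]]; exists b => // y yb.
have Sx : step_set w x.
  apply: reach_trans; apply: reach_sub rx => [v [vR nZ wv]|v <- //].
  by split=> //; left.
apply: reach_trans; apply: reach_sub (Tgc bT xb yb) => [v vb|v <- //].
split; first exact: TgReg bT _ vb.
by left; split; [exact: TgZ bT vb|exact: bw].
Qed.

Let fail_pivots w : ~ step_succ (step_set w) ->
  exists2 us, pivots w = Some us & ~~ has w [seq (u, l) | u <- us].
Proof.
move=> nS; rewrite /pivots asboolF; last first.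
  by move=> [u Au Hu]; apply: nS; apply: hits_step Hu; exact: step_set_sub.
eexists; first by [].
apply/hasPn => _ /mapP[u + ->]; rewrite mem_filter => /andP[/asboolP[Zu nA Hu] uR].
apply/negP => wu; apply: nS; apply: hits_step Hu.
have [a Aa au] := ZA Zu nA.
by apply: (reach_step (reach_in _ _ Aa) au); split=> //; right.
Qed.

Let pivots_cross w us : pivots w = Some us -> ~~ has w [seq (u, 0%N) | u <- us] ->
  ~ crosses (fun v => w (v, 0%N)).
Proof.
rewrite /pivots; case: asboolP => // nd [<-] /hasPn nh [b bT [bw [x xb rx]]].
pose O v := [/\ v \in Reg, ~ Z v & w (v, 0%N)].
(* Follow the crossing and remember its last vertex in [Z]: it lies in [A] or is open at level 0,
   and the path after it is fresh. At the target it is therefore either excluded by [nd] or an open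
   pivot. *)
suff H : (Z x /\ (A x \/ w (x, 0%N))) \/ (~ Z x /\
   ((exists2 u, A u & reach adj O (eq u) x) \/
    exists u, [/\ u \in Reg, Z u, ~ A u, w (u, 0%N) & reach adj O (eq u) x])).
  case: H => [[Zx _]|[_ [[u Au ux]|[u [uR Zu nA wu ux]]]]]; first exact: TgZ bT xb Zx.
    by apply: nd; exists u => //; exists b => //; split=> //; exists x.
  have /nh : (u, 0%N) \in [seq (u, 0%N) | u <- [seq u <- Reg | `[< [/\ Z u, ~ A u & hits w u] >]]].
    apply: map_f; rewrite mem_filter uR andbT; apply/asboolP; split=> //.
    by exists b => //; split=> //; exists x.
  by rewrite wu.
have P v : reach adj (fun v => v \in Reg /\ w (v, 0%N)) S v -> v \in Reg \/ S v.
  by case=> [u Su|u u' _ _ []]; [right|left].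
elim: rx {xb} => [u /SA Au|u v ru IH uv [vR wv]]; first by left; split; [exact: AZ|left].
have [Zv|nZ] := pselect (Z v); first by left; split=> //; right.
right; split=> //; have Ov : O v by [].
have one : reach adj O (eq u) v by exact: (reach_step (reach_in _ _ (erefl u)) uv Ov).
case: IH => [[Zu H]|[nZu [[a Aa au]|[a [aR Za nAa wa au]]]]].
- have [Au|nA] := pselect (A u); first by left; exists u.
  case: H => // wu; right; exists u; split=> //.
  by case: (P _ ru) => // /SA.
- by left; exists a => //; exact: reach_step au uv Ov.
- by right; exists a; split=> //; exact: reach_step au uv Ov.
Qed.

(* The pivots are the boundary vertices from which fresh open bits lead to a
   target. Given the pivots, the step fails only if their bits at level l all
   vanish, and there is no crossing at all if their bits at level 0 vanish; so
   few pivots are unlikely when a crossing is likely. *)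
Lemma step_fail_le (t : nat) s w0 : uniq s -> 0 <= p -> 0 <= del <= 1 ->
  (forall v, v \in Reg -> ((v, 0%N) \in s) && ((v, l) \in s)) ->
  Pr q s (fun w => ~ step_succ (step_set w)) w0 <=
    (1 - del) ^+ t + (1 - p) ^- t * Pr (fun=> p) Reg (fun w => ~ crosses w) (fun=> false).
Proof.
move=> us p0 /andP[d0 d1] sReg.
have np : 0 < 1 - p by rewrite subr_gt0.
pose h (x : R) (o : option (seq V)) := if o is Some us then x ^+ size us else 0.
pose g (j : nat) (o : option (seq V)) (w : V * nat -> bool) : R :=
  if o is Some us then (~~ has w [seq (u, j) | u <- us])%:R else 0.
have gE j x o w : (j = 0%N \/ j = l) -> (forall v, q (v, j) = 1 - x) -> (exists w', o = pivots w') ->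
    Ex q s (g j o) w = h x o.
  move=> jl qx [w' ->]; rewrite /pivots; case: asboolP => _ /=; first exact: Ex_cst.
  set U := [seq u <- _ | _].
  rewrite (Ex_has q (fun b => (~~ b)%:R)) //=; last 2 first.
  - by rewrite map_inj_uniq ?filter_uniq // => a b [].
  - move=> _ /mapP[u + ->]; rewrite mem_filter => /andP[_ /sReg /andP[s0 sl]].
    by case: jl => ->.
  rewrite mulr0 add0r mulr1 big_map -[RHS]mulr1.
  elim: U => [|u U IH] /=; first by rewrite big_nil mul1r.
  by rewrite big_cons IH qx exprS opprB addrCA subrr addr0; ring.
have gd j w : (j = 0%N \/ j = l) ->
    dep (fun t => ~ (t.2 = 0%N /\ ~ Z t.1)) (g j (pivots w)).
  move=> jl w1 w2 H; rewrite /g /pivots; case: asboolP => // _.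
  congr (_%:R); congr (nat_of_bool (~~ _)); apply: eq_in_has => _ /mapP[u + ->].
  by rewrite mem_filter => /andP[/asboolP[Zu _ _] _]; apply: H => /= -[_].
have Xd w w' : (forall t, (t.2 = 0%N /\ ~ Z t.1) -> w t = w' t) -> pivots w' = pivots w.
  by move=> /pivots_dep.
apply: (@le_trans _ _ (Ex q s (fun w => g l (pivots w) w) w0)).
  apply: le_Ex => // w; rewrite /g; case: asboolP => [/fail_pivots[us' -> ->]//|_].
  by case: pivots.
apply: (@le_trans _ _ (Ex q s (fun w => h (1 - del) (pivots w)) w0)).
  apply: (@Ex_cond_le _ _ q s _ pivots (fun _ t => t.2 = 0%N /\ ~ Z t.1)) => //.
  - by move=> w; apply: gd; right.
  - move=> w; rewrite (gE l (1 - del)) //; first by right.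
      by move=> v; rewrite ql opprB addrCA subrr addr0.
    by exists w.
(* With at least [t] pivots the first term dominates; with fewer, the factor [(1 - p) ^- t] makes
   the second term at least 1. *)
apply: (@le_trans _ _ ((1 - del) ^+ t + (1 - p) ^- t * Ex q s (fun w => h (1 - p) (pivots w)) w0)).
  rewrite -ExZ -[in leRHS](Ex_cst q s ((1 - del) ^+ t) w0) -ExD; apply: le_Ex => // w.
  have D0 : 0 <= 1 - del by rewrite subr_ge0.
  have D1 : 1 - del <= 1 by lra.
  rewrite /h; case: pivots => [us'|]; last by rewrite mulr0 addr0 exprn_ge0.
  have [ts|st] := leqP t (size us').
    by apply: (@le_trans _ _ ((1 - del) ^+ t)); [exact: ler_wiXn2l|
      rewrite lerDl mulr_ge0 ?invr_ge0 ?exprn_ge0 // ltW].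
  apply: (@le_trans _ _ 1); first exact: exprn_ile1.
  apply: (@le_trans _ _ ((1 - p) ^- t * (1 - p) ^+ size us')); last first.
    by rewrite lerDr exprn_ge0.
  rewrite mulrC ler_pdivlMr ?exprn_gt0 // mul1r; apply: ler_wiXn2l; [exact: ltW| |exact: ltnW].
  by lra.
rewrite lerD2l; apply: ler_wpM2l; first by rewrite invr_ge0 exprn_ge0 // ltW.
(* Closing the base bits of all pivots destroys every crossing. These bits lie on [Z], and the
   choice of the pivots does not read them. *)
apply: (@le_trans _ _ (Ex q s (fun w => g 0%N (pivots w) w) w0)).
  apply: (@Ex_cond_ge _ _ q s _ pivots (fun _ t => t.2 = 0%N /\ ~ Z t.1)) => //.
  - by move=> w; apply: gd; left.
  - move=> w; rewrite (gE 0%N (1 - p)) //; first by left.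
      by move=> v; rewrite q0 opprB addrCA subrr addr0.
    by exists w.
pose phi (v : V) := (v, 0%N).
have iphi : injective phi by move=> a b [].
rewrite [leRHS](_ : _ = Pr q s (fun w => ~ crosses (w \o phi)) w0).
  apply: le_Ex => // w; rewrite /g; case E : pivots => [us'|]; last exact: ind_ge0.
  case: (boolP (has _ _)) => [_|nh]; first exact: ind_ge0.
  by rewrite asboolT //; exact: pivots_cross E nh.
rewrite /Pr [LHS](_ : _ = Ex (q \o phi) Reg (fun w => ind (~ crosses w)) (w0 \o phi)); last first.
  have -> : q \o phi = fun=> p by apply/funext => v /=; rewrite q0.
  apply: Ex_base => // w w' H; congr (_%:R); congr (nat_of_bool _); apply: asbool_equiv_eq.
  have aux (w1 w2 : V -> bool) : {in Reg, w1 =1 w2} -> crosses w1 -> crosses w2.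
    move=> E [b bT [bw [x xb rx]]]; exists b => //; split.
      by move=> y yb; rewrite -E ?bw //; exact: TgReg bT _ yb.
    by exists x => //; apply: reach_sub rx => // v [vR wv]; split=> //; rewrite -E.
  by split=> nc /aux c; apply: nc; apply: c => v vR; rewrite H.
rewrite -(Ex_map q Reg (fun w => ind (~ crosses w)) w0 iphi).
apply/esym; apply: Ex_widen => //.
- move=> w w' H; congr (_%:R); congr (nat_of_bool _); apply: asbool_equiv_eq.
  have aux (w1 w2 : V -> bool) : {in Reg, w1 =1 w2} -> crosses w1 -> crosses w2.
    move=> E [b bT [bw [x xb rx]]]; exists b => //; split.
      by move=> y yb; rewrite -E ?bw //; exact: TgReg bT _ yb.
    by exists x => //; apply: reach_sub rx => // v [vR wv]; split=> //; rewrite -E.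
  by split=> nc /aux c; apply: nc; apply: c => v vR /=; rewrite H // map_f.
- by rewrite map_inj_uniq.
- by move=> _ /mapP[v /sReg/andP[+ _] ->].
Qed.

End Step.

Lemma reach_map (U V : Type) (adj : rel U) (adj' : rel V) (phi : U -> V) (O S : U -> Prop)
    (O' S' : V -> Prop) v : (forall u u', adj u u' -> adj' (phi u) (phi u')) ->
  (forall u, O u -> O' (phi u)) -> (forall u, S u -> S' (phi u)) ->
  reach adj O S v -> reach adj' O' S' (phi v).
Proof.
move=> ha hO hS; elim=> [u /hS|u u' _ H /ha uu' /hO Ou']; first exact: reach_in.
exact: reach_step H uu' Ou'.
Qed.

Lemma reach_exit (V : eqType) (adj : rel V) (B : seq V) (O S : V -> Prop) v :
  (forall u, S u -> u \in B) -> reach adj O S v ->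
  reach adj (fun u => u \in B /\ O u) S v \/
  exists x u, [/\ reach adj (fun u => u \in B /\ O u) S x, adj x u, u \notin B & O u].
Proof.
move=> SB; elim=> [u Su|u u' _ [H|H] uu' Ou']; [by left; exact: reach_in| |by right].
have [uB|nB] := boolP (u' \in B); first by left; apply: reach_step H uu' _.
by right; exists u, u'.
Qed.

Definition reaches_many (V : eqType) (adj : rel V) (N : nat) (O S : V -> Prop) :=
  exists l : seq V, [/\ uniq l, size l = N & forall v, v \in l -> reach adj O S v].

Lemma reaches_many_sub (V : eqType) (adj : rel V) N (O O' S S' : V -> Prop) :
  (forall v, O v -> O' v) -> (forall v, S v -> S' v) ->
  reaches_many adj N O S -> reaches_many adj N O' S'.
Proof.
move=> OO SS [l [ul sl H]]; exists l; split=> // v /H.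
exact: reach_sub.
Qed.

Lemma Pr_iso (R : realFieldType) (T T' : eqType) (p : R) (phi : T -> T') s s'
    (A : (T -> bool) -> Prop) w w' : injective phi ->
  (forall w1 w2, {in s, w1 =1 w2} -> A w1 -> A w2) ->
  uniq s -> uniq s' -> {subset map phi s <= s'} ->
  Pr (fun=> p) s' (fun w => A (w \o phi)) w' = Pr (fun=> p) s A w.
Proof.
move=> iphi dA us us' ss.
have dA' (w1 w2 : T -> bool) : {in s, w1 =1 w2} -> ind (A w1) = ind (A w2) :> R.
  move=> H; congr (_%:R); congr (nat_of_bool _); apply: asbool_equiv_eq.
  by split; apply: dA => // t /H.
rewrite /Pr (Ex_widen _ (s := map phi s) w' w') //.
- by rewrite (Ex_map (fun=> p) s (fun w => ind (A w)) w' iphi); apply: Ex_base.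
- by move=> w1 w2 H; apply: dA' => t ts /=; apply: H; rewrite map_f.
- by rewrite map_inj_uniq.
Qed.

Lemma Pr_diff (R : realFieldType) (T : eqType) (q : T -> R) s (A B : (T -> bool) -> Prop) w :
  (forall w, B w -> A w) -> Pr q s (fun w => A w /\ ~ B w) w = Pr q s A w - Pr q s B w.
Proof.
move=> BA; rewrite /Pr -ExB; apply: Ex_eq => w'; have := BA w'.
case: (asboolP (A w')) => Aw; case: (asboolP (B w')) => Bw.
- by rewrite asboolF ?subrr // => -[].
- by rewrite asboolT ?subr0.
- by move=> /(_ Bw)/Aw.
- by rewrite asboolF ?subr0 // => -[].
Qed.

Lemma Pr_and_indep (R : realFieldType) (T : eqType) (q : T -> R) s (A B : (T -> bool) -> Prop)
    (I J : T -> Prop) w :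
  (forall w1 w2, (forall t, I t -> w1 t = w2 t) -> A w1 -> A w2) ->
  (forall w1 w2, (forall t, J t -> w1 t = w2 t) -> B w1 -> B w2) ->
  (forall t, I t -> J t -> False) ->
  Pr q s (fun w => A w /\ B w) w = Pr q s A w * Pr q s B w.
Proof.
move=> dA dB IJ; rewrite /Pr -(@Ex_indep _ _ q s (fun w => ind (A w)) (fun w => ind (B w)) I J) //.
- apply: Ex_eq => w'; rewrite -natrM asbool_and.
  by case: asbool; case: asbool.
- move=> w1 w2 H; congr (_%:R); congr (nat_of_bool _); apply: asbool_equiv_eq.
  by split; apply: dA => t It; rewrite H.
- move=> w1 w2 H; congr (_%:R); congr (nat_of_bool _); apply: asbool_equiv_eq.
  by split; apply: dB => t It; rewrite H.
Qed.

(** * Boxes, balls and cubes of the cubic lattice *)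

Section Lattice.
Context {D : nat}.
Local Notation V := 'rV[int]_D.
Implicit Types (u v x y c lo hi : V) (i j : 'I_D).

Definition unitv i : V := delta_mx 0 i.

Lemma unitvE i j : unitv i 0 j = (j == i)%:R.
Proof. by rewrite mxE eqxx. Qed.

Lemma Zd_adj_sym : symmetric (@Zd_adj D).
Proof. by move=> u v; rewrite /Zd_adj; under eq_bigr do rewrite distrC. Qed.

Lemma Zd_adjD u i : Zd_adj u (u + unitv i).
Proof.
rewrite /Zd_adj (bigD1 i) //= mxE unitvE eqxx big1 => [|j ji]; last first.
  by rewrite mxE unitvE (negbTE ji) addr0 subrr normr0.
by rewrite addrAC subrr add0r normr1 addr0.
Qed.

Lemma Zd_adjB u i : Zd_adj u (u - unitv i).
Proof. by rewrite Zd_adj_sym -{2}(subrK (unitv i) u) Zd_adjD. Qed.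

Lemma Zd_adjP u v : Zd_adj u v ->
  exists i, v = u + unitv i \/ v = u - unitv i.
Proof.
rewrite /Zd_adj => /eqP S1.
have [i vi] : exists i, v 0 i - u 0 i != 0.
  apply: contrapT => /forallNP H; move: S1; rewrite big1 // => j _.
  by have /negP := H j; rewrite negbK => /eqP ->; rewrite normr0.
have := S1; rewrite (bigD1 i) //=.
have S0 : 0 <= \sum_(j < D | j != i) `|v 0 j - u 0 j| by apply: sumr_ge0.
move=> S2; have Se : \sum_(j < D | j != i) `|v 0 j - u 0 j| = 0.
  have aux (a S : int) : a != 0 -> 0 <= S -> `|a| + S = 1 -> S = 0 by lia.
  exact: aux vi S0 S2.
have Z j : j != i -> v 0 j = u 0 j.
  move=> ji; have /eqP := Se; rewrite psumr_eq0 // => /allP /(_ j).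
  by rewrite mem_index_enum ji /= normr_eq0 subr_eq0 => /(_ isT)/eqP.
exists i; have [H|H] : v 0 i = u 0 i + 1 \/ v 0 i = u 0 i - 1 by move: S2; rewrite Se; lia.
  left; apply/rowP => j; rewrite mxE unitvE.
  by have [->|ji] := eqVneq j i; [rewrite H|rewrite Z // addr0].
right; apply/rowP => j; rewrite !mxE eqxx /=.
by have [->|ji] := eqVneq j i; [rewrite H|rewrite Z // subr0].
Qed.

Lemma Zd_adj_dist u v i : Zd_adj u v -> `|v 0 i - u 0 i| <= 1.
Proof.
move=> /Zd_adjP[j [->|->]]; rewrite !mxE ?eqxx /=; case: (i == j); lia.
Qed.

Definition box lo hi v := [forall i, lo 0 i <= v 0 i <= hi 0 i].

Lemma boxP lo hi v : reflect (forall i, lo 0 i <= v 0 i <= hi 0 i) (box lo hi v).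
Proof. exact: forallP. Qed.

Lemma box_reach lo hi u v : box lo hi u -> box lo hi v ->
  reach (@Zd_adj D) (fun x => box lo hi x) (eq u) v.
Proof.
move=> bu.
have [k Hk] := ubnP (\sum_i `|(v 0 i - u 0 i)%R|)%N.
elim: k v Hk => // k IH v Hk bv.
have [<-|uv] := eqVneq u v; first exact: reach_in.
have [i ui] : exists i, u 0 i != v 0 i.
  apply: contrapT => /forallNP H; case/eqP: uv; apply/rowP => j.
  by have /negP := H j; rewrite negbK => /eqP.
have step w : box lo hi w -> Zd_adj w v -> (forall j, j != i -> w 0 j = v 0 j) ->
    (`|(w 0 i - u 0 i)%R| < `|(v 0 i - u 0 i)%R|)%N -> reach (@Zd_adj D) (fun x => box lo hi x) (eq u) v.
  move=> bw wv wj wi; apply: (reach_step (u := w)) => //; apply: IH => //.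
  apply: leq_trans _ (_ : \sum_i `|(v 0 i - u 0 i)%R| <= k)%N; last by rewrite -ltnS.
  rewrite (bigD1 i) //= [X in (_ < X)%N](bigD1 i) //= -addSn leq_add //.
  by apply: leq_sum => j ji; rewrite wj.
have /boxP bu' := bu; have /boxP bv' := bv.
have [lt|ge] := ltP (u 0 i) (v 0 i).
  apply: (step (v - unitv i)).
  - apply/boxP => j; rewrite !mxE eqxx /=.
    by have [->|ji] := eqVneq j i; rewrite /= ?subr0 ?bv' //; move: (bu' i) (bv' i); lia.
  - by rewrite Zd_adj_sym Zd_adjB.
  - by move=> j ji; rewrite !mxE eqxx /= (negbTE ji) subr0.
  - by rewrite !mxE !eqxx /=; lia.
apply: (step (v + unitv i)).
- apply/boxP => j; rewrite !mxE eqxx /=.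
  by have [->|ji] := eqVneq j i; rewrite /= ?addr0 ?bv' //; move: (bu' i) (bv' i); lia.
- by rewrite Zd_adj_sym Zd_adjD.
- by move=> j ji; rewrite !mxE eqxx /= (negbTE ji) addr0.
- by rewrite !mxE !eqxx /=; lia.
Qed.

Definition ball (r : nat) : seq V :=
  [seq \row_i ((f i : nat)%:Z - r%:Z) | f : {ffun 'I_D -> 'I_(r.*2.+1)}].

Lemma ball_uniq r : uniq (ball r).
Proof.
rewrite map_inj_uniq ?enum_uniq // => f g /rowP fg.
apply/ffunP => i; apply: val_inj; have := fg i; rewrite !mxE.
by move=> /addIr [].
Qed.

Lemma mem_ball r v : (v \in ball r) = [forall i, `|v 0 i| <= r%:Z].
Proof.
apply/mapP/forallP => [[f _ ->] i|H].
  by rewrite mxE; have := ltn_ord (f i); move: (nat_of_ord (f i)) => a; lia.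
exists [ffun i => inord `|(v 0 i + r%:Z)%R|%N]; first by rewrite mem_enum.
apply/rowP => i; rewrite mxE ffunE; have Hi : `|v 0 i| <= r%:Z := H i.
by move: (v 0 i) Hi => a Hi; rewrite inordK; lia.
Qed.

Lemma in_ball r v : (forall i, `|v 0 i| <= r%:Z) -> v \in ball r.
Proof. by move=> H; rewrite mem_ball; apply/forallP. Qed.

Lemma ballP r v : reflect (forall i, `|v 0 i| <= r%:Z) (v \in ball r).
Proof. by rewrite mem_ball; exact: forallP. Qed.

Lemma ball_sub r r' : (r <= r')%N -> {subset ball r <= ball r'}.
Proof. by move=> rr v /ballP H; apply: in_ball => i; have := H i; lia. Qed.

Definition boxseq lo hi : seq V :=
  [seq v <- ball (\max_i (maxn `|(lo 0 i)%R|%N `|(hi 0 i)%R|%N)) | box lo hi v].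

Lemma boxseq_uniq lo hi : uniq (boxseq lo hi).
Proof. exact/filter_uniq/ball_uniq. Qed.

Lemma mem_boxseq lo hi v : (v \in boxseq lo hi) = box lo hi v.
Proof.
rewrite mem_filter; case: boxP => //= H; apply: in_ball => i.
have := @leq_bigmax_cond _ xpredT (fun i : 'I_D => maxn `|(lo 0 i)%R|%N `|(hi 0 i)%R|%N) i isT.
by move: (\max__ _)%N => M /=; have := H i; lia.
Qed.

Definition cube (r : nat) c : seq V :=
  boxseq (\row_i (c 0 i - r%:Z)) (\row_i (c 0 i + r%:Z)).

Lemma mem_cube r c v : (v \in cube r c) = [forall i, `|v 0 i - c 0 i| <= r%:Z].
Proof.
rewrite mem_boxseq; apply/boxP/forallP => H i; have := H i; rewrite !mxE; lia.
Qed.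

Lemma cubeP r c v : reflect (forall i, `|v 0 i - c 0 i| <= r%:Z) (v \in cube r c).
Proof. by rewrite mem_cube; exact: forallP. Qed.

Lemma cube_uniq r c : uniq (cube r c).
Proof. exact: boxseq_uniq. Qed.

Lemma boxseq_reach lo hi u v : u \in boxseq lo hi -> v \in boxseq lo hi ->
  reach (@Zd_adj D) (fun x => x \in boxseq lo hi) (eq u) v.
Proof.
rewrite !mem_boxseq => bu bv; apply: reach_sub (box_reach bu bv) => // x.
by rewrite mem_boxseq.
Qed.

End Lattice.

(** * Dynamic renormalisation in a slab *)

Definition sg (b : bool) : int := if b then 1 else -1.

Lemma sgK b (x : int) : sg b * (sg b * x) = x.
Proof. by rewrite /sg; case: b; lia. Qed.

Definition site := (int * int)%type.
Definition dir := (bool * bool)%type.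
Definition dirs : seq dir := [:: (true, true); (true, false); (false, true); (false, false)].
Definition opp (d : dir) : dir := (d.1, ~~ d.2).
Definition nb (y : site) (d : dir) : site :=
  if d.1 then (y.1 + sg d.2, y.2) else (y.1, y.2 + sg d.2).

Lemma nbK y d : nb (nb y d) (opp d) = y.
Proof. by case: y d => [a b] [[] []]; rewrite /nb /opp /sg /=; congr (_, _); lia. Qed.

Lemma nbKV y d : nb (nb y (opp d)) d = y.
Proof. by case: y d => [a b] [[] []]; rewrite /nb /opp /sg /=; congr (_, _); lia. Qed.

Lemma mem_dirs d : d \in dirs.
Proof. by case: d => [[] []]. Qed.

Section Planar.
Variable L : int.
Hypothesis L0 : 0 < L.

(** Coordinates are relative to the centre of a coarse site, and centres are [16 * L] apart. The
    cross contains the boxes explored while four arms of four strides grow from a seed within [L] of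
    the centre. *)
Definition arm_zone (u1 u2 : int) :=
  (- 6 * L <= u1 <= 6 * L /\ - 2 * L <= u2 <= 2 * L) \/
  (- 2 * L <= u1 <= 2 * L /\ - 6 * L <= u2 <= 6 * L).

Definition run_zone (k : int) (d : dir) (u1 u2 : int) :=
  - k * L <= sg d.2 * (if d.1 then u1 else u2) <= 2 * L /\
  - 2 * L <= (if d.1 then u2 else u1) <= 2 * L.

Definition ranges (l1 h1 l2 h2 u1 u2 : int) :=
  (- (l1 * L) <= u1 <= h1 * L) /\ (- (l2 * L) <= u2 <= h2 * L).

(** Dividing by [L] turns the overlap of two zones into linear constraints on coarse coordinates, so
    that disjointness becomes a finite case analysis over the integers. *)
Let sep (a b v l h l' h' : int) : - (l * L) <= v - 16 * (L * a) <= h * L ->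
  - (l' * L) <= v - 16 * (L * b) <= h' * L -> - (l + h') <= 16 * (b - a) <= h + l'.
Proof.
move=> H1 H2; have E : 16 * (L * b) = 16 * (L * a) + L * (16 * (b - a)) by ring.
move: H2; rewrite E; move: (16 * (b - a)) (16 * (L * a)) H1 => e Y H1 H2.
have h1 : L * e <= L * (h + l') by rewrite mulrDr !(mulrC L); move: (h * L) (l' * L) (l * L) (h' * L) H1 H2; lia.
have h2 : L * (- (l + h')) <= L * e by rewrite mulrN mulrDr !(mulrC L); move: (h * L) (l' * L) (l * L) (h' * L) H1 H2; lia.
by move: h1 h2; rewrite !ler_pM2l // => -> ->.
Qed.

Let run_ranges k d u1 u2 : run_zone k d u1 u2 ->
  ranges (if d.1 then (if d.2 then k else 2) else 2) (if d.1 then (if d.2 then 2 else k) else 2)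
    (if d.1 then 2 else (if d.2 then k else 2)) (if d.1 then 2 else (if d.2 then 2 else k)) u1 u2.
Proof.
rewrite /run_zone /ranges mulNr; move: (k * L) => kL.
by case: d => [[] []]; rewrite /sg /= => -[H1 H2]; split; move: H1 H2; lia.
Qed.

Let arm_ranges u1 u2 : arm_zone u1 u2 -> ranges 6 6 2 2 u1 u2 \/ ranges 2 2 6 6 u1 u2.
Proof. by rewrite /arm_zone /ranges !mulNr. Qed.

Let site_facts (y z : site) (dz : dir) : z <> y -> y <> nb z (opp dz) ->
  ~ (z.1 - y.1 = 0 /\ z.2 - y.2 = 0) /\
  ~ (z.1 - y.1 = (if dz.1 then sg dz.2 else 0) /\ z.2 - y.2 = (if dz.1 then 0 else sg dz.2)).
Proof.
case: y z => [y1 y2] [z1 z2] zy yz; split.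
  by move=> /= [h1 h2]; apply: zy; congr (_, _); lia.
move=> [h1 h2]; apply: yz; move: h1 h2; rewrite /nb /opp /sg /=.
by case: dz => [[] []] /= h1 h2; congr (_, _); lia.
Qed.

(** The only foreign zone that can enter the cross of [y] is the corridor of a site whose parent is
    [y]. *)
Lemma arm_zone_disjoint (y z : site) (dz : dir) (v1 v2 : int) : z <> y -> y <> nb z (opp dz) ->
  arm_zone (v1 - 16 * (L * y.1)) (v2 - 16 * (L * y.2)) ->
  run_zone 14 dz (v1 - 16 * (L * z.1)) (v2 - 16 * (L * z.2)) \/
  arm_zone (v1 - 16 * (L * z.1)) (v2 - 16 * (L * z.2)) -> False.
Proof.
move=> zy yz /arm_ranges Hy Hz.
have [] := site_facts zy yz; move: (z.1 - y.1) (z.2 - y.2) (@sep y.1 z.1 v1) (@sep y.2 z.2 v2).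
move=> e1 e2 s1 s2 n1 n2.
case: Hz => [/run_ranges|/arm_ranges[|]] [/s1 Z1 /s2 Z2]; case: Hy => -[/Z1 {}Z1 /Z2 {}Z2].
1,2: case: dz {yz} Z1 Z2 n2 => [[] []]; rewrite /sg /= => Z1 Z2 n2; lia.
all: lia.
Qed.

(** The corridor of [y] starts near its parent, which is therefore excluded here and dealt with by a
    front condition. Extent 13 is for the new seeds, extent 14 for the whole explored boxes. *)
Lemma run_zone_disjoint (y z : site) (d dz : dir) (v1 v2 : int) :
  z <> y -> y <> nb z (opp dz) -> z <> nb y (opp d) ->
  run_zone 13 d (v1 - 16 * (L * y.1)) (v2 - 16 * (L * y.2)) ->
  run_zone 14 dz (v1 - 16 * (L * z.1)) (v2 - 16 * (L * z.2)) \/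
  arm_zone (v1 - 16 * (L * z.1)) (v2 - 16 * (L * z.2)) -> False.
Proof.
move=> zy yz zx /run_ranges Hy Hz.
have [_ n3] := site_facts (nesym zy) zx.
have [] := site_facts zy yz; have {}n3 : ~ (z.1 - y.1 = - (if d.1 then sg d.2 else 0) /\
    z.2 - y.2 = - (if d.1 then 0 else sg d.2)).
  by move=> [h1 h2]; apply: n3; split; lia.
move: (z.1 - y.1) (z.2 - y.2) (@sep y.1 z.1 v1) (@sep y.2 z.2 v2) n3.
move=> e1 e2 s1 s2 n3 n1 n2.
case: Hz => [/run_ranges|/arm_ranges[|]] [/s1 Z1 /s2 Z2]; case: Hy => -[/Z1 {}Z1 /Z2 {}Z2].
- case: dz {yz} Z1 Z2 n2 => [[] []]; case: d {zx s1 s2} n3 => [[] []]; rewrite /sg /= => n3 Z1 Z2 n2; lia.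
all: case: d {zx s1 s2} Z1 Z2 n3 => [[] []]; rewrite /sg /= => Z1 Z2 n3; lia.
Qed.

Definition near (u1 u2 : int) := ranges 15 15 15 15 u1 u2.

(** Two sites within [15 * L] of one point have coordinates that differ by at most 30 / 16, which is
    less than 2; equal parity leaves only 0. Four parity classes thus separate the sites near any
    vertex. *)
Lemma near_eq (y z : site) (v1 v2 : int) :
  odd `|y.1| = odd `|z.1| -> odd `|y.2| = odd `|z.2| ->
  near (v1 - 16 * (L * y.1)) (v2 - 16 * (L * y.2)) ->
  near (v1 - 16 * (L * z.1)) (v2 - 16 * (L * z.2)) -> y = z.
Proof.
have aux (a b : int) : odd `|a| = odd `|b| -> - (15 + 15) <= 16 * (b - a) <= 15 + 15 -> a = b.
  move=> oab ab; have {}ab : b = a \/ (b = a + 1 \/ a = b + 1) by lia.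
  have odd1 (c : int) : odd `|c + 1| = ~~ odd `|c|.
    case: c => [c|[|c]]; first by rewrite -PoszD addn1.
      by [].
    by rewrite (_ : Negz c.+1 + 1 = Negz c) ?absz_nat /= ?negbK //; lia.
  by case: ab => [->//|[E|E]]; move: oab; rewrite E odd1; case: odd.
case: y z => [y1 y2] [z1 z2] /= o1 o2 [h1 h2] [h3 h4].
by congr (_, _); [exact: aux o1 (sep h1 h3)|exact: aux o2 (sep h2 h4)].
Qed.

Lemma ranges_eq (y z : site) (v1 v2 : int) :
  ranges 7 7 7 7 (v1 - 16 * (L * y.1)) (v2 - 16 * (L * y.2)) ->
  ranges 7 7 7 7 (v1 - 16 * (L * z.1)) (v2 - 16 * (L * z.2)) -> y = z.
Proof.
case: y z => [y1 y2] [z1 z2] /= [h1 h2] [h3 h4].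
have := sep h1 h3; have := sep h2 h4 => k1 k2.
by congr (_, _); lia.
Qed.

End Planar.

(** A 3 x 3 grid minus one cell is connected: without its centre the ring remains, and otherwise
    every corner keeps one of its two neighbours, which touch the centre. *)
Lemma grid3 (g T : nat -> nat -> Prop) :
  (forall a c a' c', (a < 3)%N -> (c < 3)%N -> (a' < 3)%N -> (c' < 3)%N ->
    ~ g a c -> ~ g a' c' -> a = a' /\ c = c') ->
  (forall a c, (a < 2)%N -> (c < 3)%N -> g a c -> g a.+1 c -> (T a c <-> T a.+1 c)) ->
  (forall a c, (a < 3)%N -> (c < 2)%N -> g a c -> g a c.+1 -> (T a c <-> T a c.+1)) ->
  forall a c a' c', (a < 3)%N -> (c < 3)%N -> (a' < 3)%N -> (c' < 3)%N ->
    g a c -> g a' c' -> T a c -> T a' c'.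
Proof.
move=> one hx hy.
have all_eq (P : Prop) : (forall a c, (a < 3)%N -> (c < 3)%N -> g a c -> (T a c <-> P)) ->
    forall a c a' c', (a < 3)%N -> (c < 3)%N -> (a' < 3)%N -> (c' < 3)%N ->
    g a c -> g a' c' -> T a c -> T a' c'.
  move=> H a c a' c' a3 c3 a3' c3' gg gg' t.
  by apply/(H a' c' a3' c3' gg')/(H a c a3 c3 gg).
have [g11|n11] := pselect (g 1%N 1%N); last first.
  have G a c : (a < 3)%N -> (c < 3)%N -> (a, c) != (1, 1)%N -> g a c.
    move=> a3 c3 ne; apply: contrapT => ng.
    have [ea ec] := one a c 1%N 1%N a3 c3 isT isT ng n11.
    by rewrite ea ec eqxx in ne.
  have [[g00 g01 g02 g10 g12] [g20 g21 g22]] : [/\ g 0 0, g 0 1, g 0 2, g 1 0 & g 1 2]%N /\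
     [/\ g 2 0, g 2 1 & g 2 2]%N by split; split; exact: G.
  have e1 := hx 0%N 0%N isT isT g00 g10.
  have e2 := hx 1%N 0%N isT isT g10 g20.
  have e3 := hy 2%N 0%N isT isT g20 g21.
  have e4 := hy 2%N 1%N isT isT g21 g22.
  have e5 := hx 0%N 2%N isT isT g02 g12.
  have e6 := hx 1%N 2%N isT isT g12 g22.
  have e7 := hy 0%N 0%N isT isT g00 g01.
  apply: (all_eq (T 0%N 0%N)) => -[|[|[|//]]] [|[|[|//]]] _ _ // _; tauto.
have edge a c : g a c -> (a, c) \in [:: (0, 1); (1, 0); (1, 2); (2, 1)]%N -> (T a c <-> T 1%N 1%N).
  rewrite !inE => gac /or4P[] /eqP[ea ec]; rewrite {}ea {}ec in gac *.
  - exact: hx.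
  - exact: hy.
  - by apply: iff_sym; exact: hy.
  - by apply: iff_sym; exact: hx.
have two a c a' c' : (a < 3)%N -> (c < 3)%N -> (a' < 3)%N -> (c' < 3)%N ->
    (a, c) != (a', c') -> g a c \/ g a' c'.
  move=> a3 c3 a3' c3' ne; have [?|ng] := pselect (g a c); first by left.
  right; apply: contrapT => ng'; have [ea ec] := one _ _ _ _ a3 c3 a3' c3' ng ng'.
  by rewrite ea ec eqxx in ne.
apply: (all_eq (T 1%N 1%N)) => -[|[|[|//]]] [|[|[|//]]] _ _ // gac.
all: try by apply: edge.
- have [h|h] := two 0%N 1%N 1%N 0%N isT isT isT isT isT; apply: iff_trans (edge _ _ h isT).
    exact: hy.
  exact: hx.
- have [h|h] := two 0%N 1%N 1%N 2%N isT isT isT isT isT; apply: iff_trans (edge _ _ h isT).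
    by apply: iff_sym; exact: hy.
  exact: hx.
- have [h|h] := two 2%N 1%N 1%N 0%N isT isT isT isT isT; apply: iff_trans (edge _ _ h isT).
    exact: hy.
  by apply: iff_sym; exact: hx.
- have [h|h] := two 2%N 1%N 1%N 2%N isT isT isT isT isT; apply: iff_trans (edge _ _ h isT).
    by apply: iff_sym; exact: hy.
  by apply: iff_sym; exact: hx.
Qed.

(** * Hierarchical blocks: how success spreads and how failures are counted *)

Section Hierarchy.
Variable F : nat -> nat -> Prop.

(* A block of level k+1 consists of 3 x 3 blocks of level k and is bad when at
   least two of these are. *)
Fixpoint bad (k I J : nat) : Prop :=
  if k is k'.+1 then exists a c a' c', [/\ (a < 3) && (c < 3), (a' < 3) && (c' < 3),
    (a, c) != (a', c'), bad k' (3 * I + a) (3 * J + c) & bad k' (3 * I + a') (3 * J + c')]%N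
  else F I J.

Fixpoint core (k I J : nat) (x : nat * nat) : Prop :=
  if k is k'.+1 then exists a c, [/\ (a < 3) && (c < 3), ~ bad k' (3 * I + a) (3 * J + c) &
    core k' (3 * I + a) (3 * J + c) x]%N
  else x = (I, J).

Lemma core_div k I J x : core k I J x -> (x.1 %/ 3 ^ k = I)%N /\ (x.2 %/ 3 ^ k = J)%N.
Proof.
elim: k I J => [|k IH] I J /=; first by move=> ->; rewrite expn0 !divn1.
move=> [a [c [/andP[a3 c3] _ /IH[E1 E2]]]]; rewrite expnSr !divnMA E1 E2.
by rewrite ![(3 * _)%N]mulnC !divnMDl // !divn_small // !addn0.
Qed.

Lemma good_sub k I J a c a' c' : ~ bad k.+1 I J -> (a < 3)%N -> (c < 3)%N -> (a' < 3)%N ->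
  (c' < 3)%N -> ~ ~ bad k (3 * I + a) (3 * J + c) -> ~ ~ bad k (3 * I + a') (3 * J + c') ->
  a = a' /\ c = c'.
Proof.
move=> nb a3 c3 a3' c3' /contrapT b1 /contrapT b2.
have [[-> ->]//|ne] := eqVneq (a, c) (a', c').
by case: nb => /=; exists a, c, a', c'; rewrite a3 c3 a3' c3'; split.
Qed.

(** A block that is not bad has at most one bad cell, hence at least two good ones among the three
    cells of its first column, and the count doubles at each level. *)
Lemma core_large k I J : ~ bad k I J ->
  exists l : seq (nat * nat), [/\ uniq l, size l = (2 ^ k)%N & forall x, x \in l -> core k I J x].
Proof.
elim: k I J => [|k IH] I J nb.
  by exists [:: (I, J)]; split=> // x; rewrite inE => /eqP ->.
have [c [c' [c3 c3' cc gc gc']]] : exists c c', [/\ (c < 3)%N, (c' < 3)%N, c != c',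
    ~ bad k (3 * I + 0) (3 * J + c) & ~ bad k (3 * I + 0) (3 * J + c')].
  have g c c' : (c < 3)%N -> (c' < 3)%N -> c != c' ->
      ~ bad k (3 * I + 0) (3 * J + c) \/ ~ bad k (3 * I + 0) (3 * J + c').
    move=> c3 c3' ne; have [b1|] := pselect (bad k (3 * I + 0) (3 * J + c)); last by left.
    right=> b2; have [_ E] := good_sub nb (isT : (0 < 3)%N) c3 (isT : (0 < 3)%N) c3' (fun n => n b1) (fun n => n b2).
    by rewrite E eqxx in ne.
  have [h0|h1] := g 0%N 1%N isT isT isT.
    have [h1|h2] := g 1%N 2%N isT isT isT; first by exists 0%N, 1%N.
    by exists 0%N, 2%N.
  have [h0|h2] := g 0%N 2%N isT isT isT; first by exists 0%N, 1%N.
  by exists 1%N, 2%N.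
have [l [ul sl lc]] := IH _ _ gc; have [l' [ul' sl' lc']] := IH _ _ gc'.
exists (l ++ l'); split.
- rewrite cat_uniq ul ul' andbT; apply/hasPn => x xl'; apply/negP => xl.
  have [_ E1] := core_div (lc x xl); have [_ E2] := core_div (lc' x xl').
  by rewrite E1 in E2; move: E2 => /addnI E2; rewrite E2 eqxx in cc.
- by rewrite size_cat sl sl' addnn -mul2n expnS.
move=> x; rewrite mem_cat => /orP[/lc|/lc'] xc; [exists 0%N, c|exists 0%N, c'].
  by rewrite c3.
by rewrite c3'.
Qed.

Variables (B : nat) (G : nat * nat -> Prop).
Hypothesis Gx : forall i j, (i.+1 < B)%N -> (j < B)%N ->
  (G (i, j) -> G (i.+1, j) \/ F i.+1 j) /\ (G (i.+1, j) -> G (i, j) \/ F i j).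
Hypothesis Gy : forall i j, (i < B)%N -> (j.+1 < B)%N ->
  (G (i, j) -> G (i, j.+1) \/ F i j.+1) /\ (G (i, j.+1) -> G (i, j) \/ F i j).

Let all_in k I J := forall x, core k I J x -> G x.

Let some_all k I J := forall x, core k I J x -> G x -> all_in k I J.

(** Inside a block, cells communicate by [grid3]. Across a common side three pairs of cells face
    each other and each block spoils at most one pair, so a good pair remains to transmit success.
    The induction needs both facts at once. *)
Lemma core_spread k : (forall I J, (3 ^ k * I.+1 <= B)%N -> (3 ^ k * J.+1 <= B)%N ->
    ~ bad k I J -> some_all k I J) /\
  (forall I J, (3 ^ k * I.+2 <= B)%N -> (3 ^ k * J.+1 <= B)%N ->
    ~ bad k I J -> ~ bad k I.+1 J -> (all_in k I J <-> all_in k I.+1 J)) /\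
  (forall I J, (3 ^ k * I.+1 <= B)%N -> (3 ^ k * J.+2 <= B)%N ->
    ~ bad k I J -> ~ bad k I J.+1 -> (all_in k I J <-> all_in k I J.+1)).
Proof.
elim: k => [|k [IH1 [IH2 IH3]]].
  have E I J : all_in 0 I J <-> G (I, J) by split=> [H|H x /= ->//]; exact: H.
  split; first by move=> I J _ _ _ x /= -> H y /= ->.
  split=> I J; rewrite !expn0 !mul1n => h1 h2 n1 n2; split=> /E H; apply/E.
  - by have [/(_ H)[]] := Gx h1 h2.
  - by have [_ /(_ H)[]] := Gx h1 h2.
  - by have [/(_ H)[]] := Gy h1 h2.
  - by have [_ /(_ H)[]] := Gy h1 h2.
have ne k' I J : ~ bad k' I J -> exists x, core k' I J x.
  move=> /core_large[[|x l] [_ sl lc]]; last by exists x; apply: lc; rewrite inE eqxx.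
  by move: sl => /= sl; have := expn_gt0 2 k'; rewrite -sl.
have le3 (I a : nat) : (a < 3)%N -> (3 ^ k.+1 * I.+1 <= B)%N -> (3 ^ k * (3 * I + a).+1 <= B)%N.
  by move=> a3; rewrite expnSr -mulnA; apply: leq_trans; rewrite leq_mul2l; lia.
have inside I J : (3 ^ k.+1 * I.+1 <= B)%N -> (3 ^ k.+1 * J.+1 <= B)%N -> ~ bad k.+1 I J ->
    forall a c a' c', (a < 3)%N -> (c < 3)%N -> (a' < 3)%N -> (c' < 3)%N ->
    ~ bad k (3 * I + a) (3 * J + c) -> ~ bad k (3 * I + a') (3 * J + c') ->
    all_in k (3 * I + a) (3 * J + c) -> all_in k (3 * I + a') (3 * J + c').
  move=> hI hJ nb; apply: (@grid3 (fun a c => ~ bad k (3 * I + a) (3 * J + c))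
     (fun a c => all_in k (3 * I + a) (3 * J + c))).
  - by move=> a c a' c'; exact: good_sub.
  - move=> a c a2 c3 g1 g2; rewrite addnS in g2 *; apply: IH2 => //.
    + by have := @le3 I a.+1 a2 hI; rewrite addnS.
    + by apply: le3.
  - move=> a c a3 c2 g1 g2; rewrite addnS in g2 *; apply: IH3 => //.
    + by apply: le3.
    + by have := @le3 J c.+1 c2 hJ; rewrite addnS.
have st1 I J : (3 ^ k.+1 * I.+1 <= B)%N -> (3 ^ k.+1 * J.+1 <= B)%N -> ~ bad k.+1 I J ->
    some_all k.+1 I J.
  move=> hI hJ nb x /= [a [c [/andP[a3 c3] g1 xc]]] Gxx y /= [a' [c' [/andP[a3' c3'] g2 yc]]].
  apply: (inside I J hI hJ nb a c a' c') => //.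
  by apply: (IH1 _ _ _ _ g1 x xc Gxx); exact: le3.
have sub_all I J a c : (a < 3)%N -> (c < 3)%N -> ~ bad k (3 * I + a) (3 * J + c) ->
    all_in k.+1 I J -> all_in k (3 * I + a) (3 * J + c).
  by move=> a3 c3 g H x xc; apply: H; exists a, c; rewrite a3 c3.
have all_sub I J a c : (3 ^ k.+1 * I.+1 <= B)%N -> (3 ^ k.+1 * J.+1 <= B)%N -> ~ bad k.+1 I J ->
    (a < 3)%N -> (c < 3)%N -> ~ bad k (3 * I + a) (3 * J + c) ->
    all_in k (3 * I + a) (3 * J + c) -> all_in k.+1 I J.
  move=> hI hJ nb a3 c3 g H; have [x xc] := ne _ _ _ g.
  by apply: (st1 I J hI hJ nb x) => //; [exists a, c; rewrite a3 c3|exact: H].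
have lem (I : nat) : (3 ^ k.+1 * I.+2 <= B)%N -> (3 ^ k.+1 * I.+1 <= B)%N.
  by apply: leq_trans; rewrite leq_mul2l leqnSn orbT.
have pick (P Q : nat -> Prop) : (forall c c', (c < 3)%N -> (c' < 3)%N -> ~ P c -> ~ P c' -> c = c') ->
    (forall c c', (c < 3)%N -> (c' < 3)%N -> ~ Q c -> ~ Q c' -> c = c') ->
    exists c, [/\ (c < 3)%N, P c & Q c].
  move=> hP hQ; have [h0|h0] := pselect (P 0%N /\ Q 0%N); first by exists 0%N; case: h0.
  have [h1|h1] := pselect (P 1%N /\ Q 1%N); first by exists 1%N; case: h1.
  exists 2%N; split=> //; apply: contrapT => n2.
    have p0 : P 0%N by apply: contrapT => n0; have := hP 0%N 2%N isT isT n0 n2.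
    have p1 : P 1%N by apply: contrapT => n0; have := hP 1%N 2%N isT isT n0 n2.
    have := hQ 0%N 1%N isT isT; have nq0 : ~ Q 0%N by tauto.
    have nq1 : ~ Q 1%N by tauto.
    by move=> /(_ nq0 nq1).
  have p0 : Q 0%N by apply: contrapT => n0; have := hQ 0%N 2%N isT isT n0 n2.
  have p1 : Q 1%N by apply: contrapT => n0; have := hQ 1%N 2%N isT isT n0 n2.
  have := hP 0%N 1%N isT isT; have nq0 : ~ P 0%N by tauto.
  have nq1 : ~ P 1%N by tauto.
  by move=> /(_ nq0 nq1).
split; first exact: st1.
split=> I J hI hJ n1 n2.
- have [c [c3 g1 g2]] : exists c, [/\ (c < 3)%N, ~ bad k (3 * I + 2) (3 * J + c) &
      ~ bad k (3 * I.+1 + 0) (3 * J + c)].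
    apply: pick => c c' c3 c3' b1 b2.
      by have [] := good_sub n1 (isT : (2 < 3)%N) c3 (isT : (2 < 3)%N) c3' b1 b2.
    by have [] := good_sub n2 (isT : (0 < 3)%N) c3 (isT : (0 < 3)%N) c3' b1 b2.
  have E : (3 * I.+1 + 0 = (3 * I + 2).+1)%N by lia.
  have H := IH2 (3 * I + 2)%N (3 * J + c)%N; rewrite -E in H.
  have {}H : all_in k (3 * I + 2) (3 * J + c) <-> all_in k (3 * I.+1 + 0) (3 * J + c).
    apply: H => //; last exact: le3.
    by have := @le3 I.+1 0%N isT hI; rewrite E.
  split=> A.
    apply: (all_sub _ _ 0%N c) => //; apply/H; exact: sub_all A.
  apply: (all_sub _ _ 2%N c) => //; first exact: lem.
  apply/H; exact: sub_all A.
- have [c [c3 g1 g2]] : exists c, [/\ (c < 3)%N, ~ bad k (3 * I + c) (3 * J + 2) &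
      ~ bad k (3 * I + c) (3 * J.+1 + 0)].
    apply: pick => c c' c3 c3' b1 b2.
      by have [] := good_sub n1 c3 (isT : (2 < 3)%N) c3' (isT : (2 < 3)%N) b1 b2.
    by have [] := good_sub n2 c3 (isT : (0 < 3)%N) c3' (isT : (0 < 3)%N) b1 b2.
  have E : (3 * J.+1 + 0 = (3 * J + 2).+1)%N by lia.
  have H := IH3 (3 * I + c)%N (3 * J + 2)%N; rewrite -E in H.
  have {}H : all_in k (3 * I + c) (3 * J + 2) <-> all_in k (3 * I + c) (3 * J.+1 + 0).
    apply: H => //; first exact: le3.
    by have := @le3 J.+1 0%N isT hJ; rewrite E.
  split=> A.
    apply: (all_sub _ _ c 0%N) => //; apply/H; exact: sub_all A.
  apply: (all_sub _ _ c 2%N) => //; first exact: lem.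
  apply/H; exact: sub_all A.
Qed.

Lemma core_origin k : (forall j, (j <= k)%N -> ~ bad j 0 0) -> core k 0 0 (0, 0)%N.
Proof.
elim: k => //= k IH H; exists 0%N, 0%N; rewrite muln0 addn0; split=> //.
  by apply: H.
by apply: IH => j jk; apply: H; exact: leqW.
Qed.

End Hierarchy.

Section Witnesses.
Local Open Scope nat_scope.
Local Notation label := ((int * int) * nat)%type.

Definition cells := [seq (a, c) | a <- iota 0 3, c <- iota 0 3].
Definition cell_pairs := [seq uv <- [seq (u, v) | u <- cells, v <- cells] | uv.1 != uv.2].

(* A bad block of level k contains 2 ^ k sites with a failed step; these are the
   possible lists of labels of such steps. *)
Fixpoint witnesses (k I J : nat) : seq (seq label) :=
  if k is k'.+1 then flatten [seq [seq Y ++ Y' | Y <- witnesses k' (3 * I + uv.1.1) (3 * J + uv.1.2),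
      Y' <- witnesses k' (3 * I + uv.2.1) (3 * J + uv.2.2)] | uv <- cell_pairs]
  else [seq [:: ((I%:Z, J%:Z)%R, i)] | i <- iota 0 32].

Lemma mem_cells u : (u \in cells) = (u.1 < 3) && (u.2 < 3).
Proof.
case: u => a c; rewrite /cells.
apply/allpairsP/idP => [[[a' c'] [+ + [-> ->]]]|/andP[/= a3 c3]].
  by rewrite !inE => /or3P[] /eqP -> /or3P[] /eqP ->.
by exists (a, c); rewrite /= !inE; split=> //; lia.
Qed.

Lemma mem_cell_pairs u v : ((u, v) \in cell_pairs) = [&& u != v, u \in cells & v \in cells].
Proof.
rewrite mem_filter; congr andb.
by apply/allpairsP/andP => [[[u' v'] [+ + [-> ->]]]|[uc vc]] //; exists (u, v).
Qed.

(** The counts satisfy [W (k + 1) = 72 * W k ^ 2], with 72 = 9 * 8 ordered pairs of distinct cells.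
    Multiplying by 72 turns this into pure squaring, starting from 72 * 32 = 2304. *)
Lemma size_witnesses k I J : 72 * size (witnesses k I J) = 2304 ^ (2 ^ k).
Proof.
elim: k I J => [|k IH] I J; first by rewrite /= expn0 expn1.
pose W uv := [seq Y ++ Y' | Y <- witnesses k (3 * I + uv.1.1) (3 * J + uv.1.2),
   Y' <- witnesses k (3 * I + uv.2.1) (3 * J + uv.2.2)].
have sz uv : size (W uv) * (72 * 72) = 2304 ^ (2 ^ k.+1).
  rewrite size_allpairs mulnACA ![_ * 72]mulnC !IH -expnD addnn -mul2n.
  by rewrite expnS.
rewrite (_ : witnesses k.+1 I J = flatten [seq W uv | uv <- cell_pairs]) //.
apply/eqP; rewrite -(eqn_pmul2r (m := 72)) //; apply/eqP.
rewrite -mulnA mulnCA size_flatten /shape -map_comp sumnE big_map.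
rewrite big_distrl (eq_bigr (fun=> 2304 ^ (2 ^ k.+1))); last by move=> uv _; exact: sz.
rewrite big_const_seq count_predT iter_addn_0; congr (_ * _).
Qed.

(** The two halves of a witness lie in different cells and so share no label. Distinctness is what
    yields one factor [eps] for each of the [2 ^ k] labels. *)
Lemma witnessesP k I J Y : Y \in witnesses k I J -> [/\ uniq Y, size Y = 2 ^ k &
  forall l, l \in Y -> exists2 x : nat * nat, l.1 = (x.1%:Z, x.2%:Z)%R &
    x.1 %/ 3 ^ k = I /\ x.2 %/ 3 ^ k = J].
Proof.
elim: k I J Y => [|k IH] I J Y.
  move=> /mapP[i _ ->]; split=> // l; rewrite inE => /eqP ->.
  by exists (I, J) => //=; rewrite expn0 !divn1.
move=> /flatten_mapP[[[a c] [a' c']]]; rewrite mem_cell_pairs !mem_cells /= => /and3P[ne].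
move=> /andP[a3 c3] /andP[a3' c3'] /allpairsP[[Y1 Y2] /= [/IH[u1 s1 d1] /IH[u2 s2 d2] ->]].
split.
- rewrite cat_uniq u1 u2 andbT; apply/hasPn => l l2; apply/negP => l1.
  have [x xE [e1 e2]] := d1 l l1; have [y yE [e3 e4]] := d2 l l2.
  have xy : x = y.
    move: yE; rewrite xE; case: (x) (y) => [x1 x2] [y1 y2] /= [] E1 E2; congr (_, _); lia.
  rewrite xy e3 in e1; rewrite xy e4 in e2.
  by case/eqP: ne; congr (_, _); [exact/esym/(addnI e1)|exact/esym/(addnI e2)].
- by rewrite size_cat s1 s2 addnn -mul2n expnS.
move=> l; rewrite mem_cat => /orP[/d1|/d2] [x xE [e1 e2]]; exists x => //;
  by rewrite expnSr !divnMA e1 e2 ![3 * _]mulnC !divnMDl // !divn_small // !addn0.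
Qed.

Lemma bad_witness (Fl : seq label) (F : nat -> nat -> Prop) k I J :
  (forall i j, F i j -> exists2 idx, idx < 32 & ((i%:Z, j%:Z)%R, idx) \in Fl) ->
  bad F k I J -> exists2 Y, Y \in witnesses k I J & forall l, l \in Y -> l \in Fl.
Proof.
move=> FF; elim: k I J => [|k IH] I J.
  move=> /FF[idx i32 iF]; exists [:: ((I%:Z, J%:Z)%R, idx)].
    by apply/mapP; exists idx; rewrite ?mem_iota.
  by move=> l; rewrite inE => /eqP ->.
move=> [a [c [a' [c' [h1 h2 ne /IH[Y YW YF] /IH[Y' YW' YF']]]]]]; exists (Y ++ Y').
  apply/flatten_mapP; exists ((a, c), (a', c')).
    by rewrite mem_cell_pairs !mem_cells ne /= h1.
  by apply/allpairsP; exists (Y, Y').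
by move=> l; rewrite mem_cat => /orP[/YF|/YF'].
Qed.

End Witnesses.

(** * Geometry of seeds, corridors and arms *)

Section Geometry.
Context {D : nat}.
Variables (i1 i2 : 'I_D) (m n : nat).
Local Notation V := 'rV[int]_D.
Implicit Types (v c s : V) (j l : 'I_D) (d f g : dir) (y z : site).

(** Seeds have radius [m] and boxes radius [n]. The next seed lies just outside the box: its centre
    is [n + m + 1] away and its last layer [n + 2 m + 1]. *)
Definition stride : int := n%:Z + m%:Z + 1.
Definition reach_len : int := n%:Z + 2 * m%:Z + 1.
(** [2 m + 1] is the least lateral shift for which a cube of radius [m] clears everything up to [m]
    beyond the previous centre. [lat_max] leaves the same margin at the outer edge of the face. *)
Definition lat_min : int := 2 * m%:Z + 1.
Definition lat_max : int := n%:Z - lat_min.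
Local Notation L := stride.
Local Notation NN := reach_len.
Local Notation aa := lat_min.
Local Notation ww := lat_max.

Definition reg c (i : 'I_D) (b : 'I_D -> bool) : seq V :=
  boxseq (\row_j (c 0 j - (if (j == i) && ~~ b i then NN else n%:Z)))
         (\row_j (c 0 j + (if (j == i) && b i then NN else n%:Z))).

Definition tcen c (i : 'I_D) (b : 'I_D -> bool) : seq V :=
  boxseq (\row_j (c 0 j + (if j == i then sg (b i) * L else if b j then aa else - ww)))
         (\row_j (c 0 j + (if j == i then sg (b i) * L else if b j then ww else - aa))).

Definition targets c i b : seq (seq V) := [seq cube m c' | c' <- tcen c i b].

Lemma regP c i b v : v \in reg c i b <->
  - n%:Z <= sg (b i) * (v 0 i - c 0 i) <= NN /\ forall j, j != i -> `|v 0 j - c 0 j| <= n%:Z.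
Proof.
have nN : n%:Z <= NN by rewrite /reach_len; lia.
rewrite mem_boxseq; split.
  move=> /boxP H; split.
    by have := H i; rewrite !mxE eqxx /sg /=; case: (b i) => /=; lia.
  by move=> j ji; have := H j; rewrite !mxE (negbTE ji) /=; lia.
move=> [Hi Hj]; apply/boxP => j; rewrite !mxE.
have [->|ji] /= := eqVneq j i; first by move: Hi; rewrite /sg; case: (b i) => /=; lia.
by have := Hj j ji; lia.
Qed.

Lemma tcenP c i b v : v \in tcen c i b <->
  sg (b i) * (v 0 i - c 0 i) = L /\ forall j, j != i -> aa <= sg (b j) * (v 0 j - c 0 j) <= ww.
Proof.
rewrite mem_boxseq; split.
  move=> /boxP H; split.
    by have := H i; rewrite !mxE eqxx /sg /=; case: (b i) => /=; lia.
  by move=> j ji; have := H j; rewrite !mxE (negbTE ji) /= /sg; case: (b j) => /=; lia.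
move=> [Hi Hj]; apply/boxP => j; rewrite !mxE.
have [->|ji] /= := eqVneq j i; first by move: Hi; rewrite /sg; case: (b i) => /=; lia.
by have := Hj j ji; rewrite /sg; case: (b j) => /=; lia.
Qed.

Definition ax d := if d.1 then i1 else i2.
Definition oax d := if d.1 then i2 else i1.

(* The site y of the coarse lattice is centred at ctr y; the shift puts the
   seed through which the site (0, 0) is entered at the origin. *)
Definition ctr y j : int :=
  if j == i1 then 16 * (L * y.1) + 12 * L else if j == i2 then 16 * (L * y.2) else 0.
Definition offset y v j := v 0 j - ctr y j.
Definition along y d v := sg d.2 * offset y v (ax d).

(* Lateral moves always go towards the axis of the corridor. *)
Definition steer y f c j := if j == ax f then f.2 else c 0 j < ctr y j.

Definition zone y d v := (forall j, j != i1 -> j != i2 -> `|v 0 j| <= 2 * L) /\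
  (run_zone L 14 d (offset y v i1) (offset y v i2) \/ arm_zone L (offset y v i1) (offset y v i2)).

(** Slice [j] contains the box explored from the seed [j] strides behind [s]; since then the seed
    has drifted sideways by at most [ww] per step. *)
Definition cone y d s v := exists2 j : int, 1 <= j &
  along y d v <= along y d s - j * L + NN /\
  forall l, l != ax d -> `|v 0 l - s 0 l| <= j * ww + n%:Z /\ `|offset y v l| <= 2 * L.

(** The arms grow in rotation, so the arm extended next never has a larger count than another one;
    otherwise the lateral spread of a long arm could spoil the targets of a short one. *)
Definition cnt (t : nat) f : nat := (t %/ 4 + (index f dirs < t %% 4))%N.

Record head_ok (A zx : V -> Prop) x d c : Prop := HeadOK {
  head_in : forall v, v \in cube m c -> A v;
  head_along : 3 * L <= along x d c <= 5 * L;
  head_lat : forall j, j != ax d -> `|offset x c j| <= L;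
  head_front : forall v, zx v -> along x d v <= along x d c + m%:Z }.

(** The bound -13 L comes from the head of the parent, 3 L to 5 L past a centre that is 16 L behind.
    The seed must stop strictly before the centre of [y]: steering then pushes the first step of
    every perpendicular arm forwards, away from the corridor. *)
Record run_ok (A zy zx : V -> Prop) y d (idx : nat) c : Prop := RunOK {
  run_in : forall v, v \in cube m c -> A v;
  run_lat : forall j, j != ax d -> `|offset y c j| <= L;
  run_along : - 13 * L <= along y d c <= -1;
  run_prog : - L <= along y d c \/ - 13 * L + idx%:Z * L <= along y d c;
  run_cone : forall v, zy v -> cone y d c v;
  run_front : forall v, zx v -> along y d v <= along y d c + m%:Z }.

(** [arm_fwd] compares a perpendicular arm with the corridor behind it: the arm gains [aa] in its
    first step and loses at most [ww] in each later one, whereas successive slices of the cone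
    recede by a full stride. [arm_old] says that nothing revealed obstructs the next target of any
    arm. *)
Record arm_ok (A zy : V -> Prop) y d (t : nat) s (h : dir -> V) : Prop := ArmOK {
  arm_s : - L <= along y d s <= -1;
  arm_slat : forall j, j != ax d -> `|offset y s j| <= L;
  arm_in : forall f v, f != opp d -> v \in cube m (h f) -> A v;
  arm_along : forall f, f != opp d -> along y f (h f) = along y f s + (cnt t f)%:Z * L;
  arm_lat : forall f l, f != opp d -> l != ax f ->
    `|offset y (h f) l| <= L /\ `|h f 0 l - s 0 l| <= (cnt t f)%:Z * ww;
  arm_fwd : forall f, f != opp d -> ax f != ax d -> (0 < cnt t f)%N ->
    aa - ((cnt t f)%:Z - 1) * ww <= along y d (h f) - along y d s;
  arm_old : forall v, zy v -> cone y d s v \/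
    forall f, f != opp d -> along y f v - along y f s < ((cnt t f)%:Z + 1) * L - m%:Z /\
      along y f v - along y f s <= 4 * L + m%:Z }.

Hypotheses (i12 : i1 != i2) (mn : (4 * m + 6 <= n)%N).

Lemma geo : [/\ L = n%:Z + m%:Z + 1, NN = L + m%:Z, ww + aa = n%:Z, aa = 2 * m%:Z + 1
  & 4 * m%:Z + 6 <= n%:Z].
Proof. by rewrite /stride /reach_len /lat_max /lat_min; split; lia. Qed.

Lemma L_gt0 : 0 < L. Proof. by rewrite /stride; lia. Qed.

Lemma oax_neq d : oax d != ax d.
Proof. by rewrite /oax /ax; case: d.1 => //; rewrite eq_sym. Qed.

Lemma ax_oax d f : ax f != ax d -> ax f = oax d /\ ax d = oax f.
Proof. by rewrite /ax /oax; case: f.1; case: d.1; rewrite ?eqxx. Qed.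

Lemma ax_eq d f : ax f = ax d -> f = d \/ f = opp d.
Proof.
case: d f => [[] b] [[] b'] //=; rewrite /ax /opp /=.
- by case: b; case: b'; [left|right|right|left].
- by move=> E; move: i12; rewrite E eqxx.
- by move=> E; move: i12; rewrite E eqxx.
- by case: b; case: b'; [left|right|right|left].
Qed.

Lemma along_opp y d v : along y (opp d) v = - along y d v.
Proof. by rewrite /along /opp /ax /sg /=; case: d.2 => /=; lia. Qed.

Lemma ctr_other y j : j != i1 -> j != i2 -> ctr y j = 0.
Proof. by move=> /negbTE h1 /negbTE h2; rewrite /ctr h1 h2. Qed.

Lemma ctr_nb y d j : j != ax d -> ctr (nb y d) j = ctr y j.
Proof.
rewrite /ctr /nb /ax; case: d => [[] b] /=.
  by move=> /negbTE ->.
by have [//|_] := eqVneq j i1; move=> /negbTE ->.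
Qed.

Lemma along_nb y d v : along (nb y d) d v = along y d v - 16 * L.
Proof.
have E (e : int) b : L * (e + sg b) = L * e + sg b * L by ring.
rewrite /along /offset /ctr /nb /ax; case: d => [[] b] /=.
  by rewrite eqxx E; move: (L * y.1) => Y; case: b; rewrite /sg; lia.
rewrite eq_sym (negbTE i12) eqxx E; move: (L * y.2) => Y; case: b; rewrite /sg; lia.
Qed.

Lemma run_zoneE k y d v : run_zone L k d (offset y v i1) (offset y v i2) <->
  - k * L <= along y d v <= 2 * L /\ `|offset y v (oax d)| <= 2 * L.
Proof. by rewrite /run_zone /along /ax /oax; case: d.1; split; lia. Qed.

Lemma arm_zoneE y d v : `|along y d v| <= 6 * L -> `|offset y v (oax d)| <= 2 * L ->
  arm_zone L (offset y v i1) (offset y v i2).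
Proof. by rewrite /arm_zone /along /ax /oax /sg; case: d => [[] []] /=; lia. Qed.

Lemma cntS t f : (t < 16)%N -> cnt t.+1 f = (cnt t f + (f == nth (true, true) dirs (t %% 4)))%N.
Proof.
by move: t => [|[|[|[|[|[|[|[|[|[|[|[|[|[|[|[|t]]]]]]]]]]]]]]]] // _; case: f => [[] []].
Qed.

Lemma cnt_le t f : (t < 16)%N -> (cnt t (nth (true, true) dirs (t %% 4)) <= cnt t f)%N /\
  (cnt t (nth (true, true) dirs (t %% 4)) <= 3)%N.
Proof.
by move: t => [|[|[|[|[|[|[|[|[|[|[|[|[|[|[|[|t]]]]]]]]]]]]]]]] // _; case: f => [[] []].
Qed.

Lemma cnt0 f : cnt 0 f = 0%N. Proof. by []. Qed.
Lemma cnt16 f : cnt 16 f = 4. Proof. by case: f => [[] []]. Qed.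

Lemma tcen_facts y f c c' : c' \in tcen c (ax f) (steer y f c) ->
  along y f c' = along y f c + L /\ forall l, l != ax f ->
  [/\ `|c' 0 l - c 0 l| <= ww, `|offset y c l| <= L -> `|offset y c' l| <= L &
    if c 0 l < ctr y l then aa <= c' 0 l - c 0 l else c' 0 l - c 0 l <= - aa].
Proof.
have [h1 h2 h3 h4 h5] := geo.
move=> /tcenP[]; rewrite {1}/steer eqxx => Ha Hl; split.
  rewrite -Ha /along /offset /sg; move: (ctr y _) => C; case: f.2 => /=; lia.
move=> l lf; have := Hl l lf; rewrite /steer (negbTE lf) /offset /sg.
by move: (ctr y l) => C; case: ltP => cC /= H; split; lia.
Qed.

Lemma cube_facts y f c v : v \in cube m c ->
  along y f c - m%:Z <= along y f v <= along y f c + m%:Z /\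
  forall l, `|v 0 l - c 0 l| <= m%:Z.
Proof.
move=> /cubeP H; split=> //; have := H (ax f); rewrite /along /offset /sg.
by move: (ctr y _) => C; case: f.2; lia.
Qed.

Lemma reg_facts y f c v : v \in reg c (ax f) (steer y f c) ->
  along y f c - n%:Z <= along y f v <= along y f c + NN /\
  forall l, l != ax f -> `|v 0 l - c 0 l| <= n%:Z.
Proof.
move=> /regP[]; rewrite /steer eqxx => H1 H2; split=> //.
by move: H1; rewrite /along /offset /sg; move: (ctr y _) => C; case: f.2; lia.
Qed.

Section Run.
Variables (A zy zx : V -> Prop) (y : site) (d : dir) (idx : nat) (c : V).
Hypotheses (ok : run_ok A zy zx y d idx c) (far : along y d c < - L).

Lemma run_fresh c' v : c' \in tcen c (ax d) (steer y d c) -> v \in cube m c' ->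
  [/\ ~ zy v, ~ zx v & run_zone L 13 d (offset y v i1) (offset y v i2)].
Proof.
have [h1 h2 h3 h4 h5] := geo.
move=> /tcen_facts[Ha Hl] /(cube_facts y d)[Va Vl]; have [H1 H2 H3 H4 H5 H6] := ok; split.
- move=> /H5[j j1 [Hj _]].
  have jL : L <= j * L by rewrite -[leLHS]mul1r; apply: ler_wpM2r => //; exact/ltW/L_gt0.
  by move: (j * L) jL Hj => jL jL1; lia.
- by move=> /H6; lia.
- apply/run_zoneE; split; first by lia.
  have [_ /(_ (H2 _ (oax_neq d))) K _] := Hl _ (oax_neq d).
  by have := Vl (oax d); move: K; rewrite /offset; move: (ctr y _) => C; lia.
Qed.

Lemma run_reg_zone v : v \in reg c (ax d) (steer y d c) -> zone y d v.
Proof.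
have [h1 h2 h3 h4 h5] := geo.
move=> /reg_facts[Ha Hl]; have [H1 H2 H3 H4 H5 H6] := ok; split.
  move=> j j1 j2; have jd : j != ax d by rewrite /ax; case: d.1.
  have := Hl j jd; have := H2 j jd; rewrite /offset ctr_other // subr0; lia.
left; apply/run_zoneE; split; first by lia.
have := Hl _ (oax_neq d); have := H2 _ (oax_neq d); rewrite /offset; move: (ctr y _) => C; lia.
Qed.

Lemma run_step c' (A' zy' : V -> Prop) : c' \in tcen c (ax d) (steer y d c) ->
  (forall v, v \in cube m c' -> A' v) ->
  (forall v, zy' v -> zy v \/ v \in reg c (ax d) (steer y d c)) ->
  run_ok A' zy' zx y d idx.+1 c'.
Proof.
have [h1 h2 h3 h4 h5] := geo.
move=> /tcen_facts[Ha Hl] cA zz; have [H1 H2 H3 H4 H5 H6] := ok; split=> //.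
- by move=> j jd; have [_ + _] := Hl j jd; apply; exact: H2.
- by lia.
- have -> : (idx.+1)%:Z = idx%:Z + 1 by lia.
  by right; rewrite mulrDl mul1r Ha; move: (idx%:Z * L) H4 => X; lia.
- move=> v /zz[/H5[j j1 [Hj Kj]]|/reg_facts[Va Vl]].
    exists (j + 1); first by lia.
    split; first by rewrite mulrDl mul1r; lia.
    move=> l ld; have [K1 K2] := Kj l ld; split=> //.
    by have [K3 _ _] := Hl l ld; rewrite mulrDl mul1r; lia.
  exists 1 => //; split; first by lia.
  move=> l ld; have [K3 _ _] := Hl l ld; have K1 := Vl l ld; split; first by lia.
  by have := H2 l ld; rewrite /offset; move: (ctr y l) => C; lia.
- by move=> v /H6; lia.
Qed.

End Run.

Lemma run_null A zy zx y d idx c : run_ok A zy zx y d idx c -> - L <= along y d c ->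
  run_ok A zy zx y d idx.+1 c.
Proof. by case=> *; split=> //; left. Qed.

(** Sixteen strides from [- 13 * L] would lead past the centre, so the seed must have come to rest
    at [- L] or beyond. *)
Lemma run_arm A zy zx y d c : run_ok A zy zx y d 16 c -> arm_ok A zy y d 0 c (fun=> c).
Proof.
have [h1 h2 h3 h4 h5] := geo.
case=> H1 H2 H3 H4 H5 H6; split=> //.
- by lia.
- by move=> f v _; exact: H1.
- by move=> f _; rewrite cnt0 mul0r addr0.
- move=> f l _ lf; rewrite cnt0 mul0r subrr normr0 lexx; split=> //.
  have [->|ld] := eqVneq l (ax d); last exact: H2.
  by move: H3 H4; rewrite /along /sg; case: d.2; lia.
- by move=> v /H5; left.
Qed.

Section Arm.
Variables (A zy : V -> Prop) (y : site) (d : dir) (t : nat) (s : V) (h : dir -> V).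
Hypotheses (ok : arm_ok A zy y d t s h) (t16 : (t < 16)%N).
Let f := nth (true, true) dirs (t %% 4).
Let c := h f.
Hypothesis fd : f != opp d.

Let i3 : (cnt t f <= 3)%N. Proof. by have [] := cnt_le f t16. Qed.

Let perp : f != d -> ax f != ax d.
Proof. by move=> nfd; apply/eqP => /ax_eq[E|E]; [move: nfd|move: fd]; rewrite E eqxx. Qed.

Let sbound g : `|along y g s| <= L.
Proof.
have [h1 h2 h3 h4 h5] := geo; have [H1 H2 _ _ _ _ _] := ok.
have [E|ne] := eqVneq (ax g) (ax d).
  by case: (ax_eq E) => ->; rewrite ?along_opp; lia.
by have := H2 _ ne; rewrite /along /sg; case: g.2; lia.
Qed.

Lemma arm_zone_target c' v : c' \in tcen c (ax f) (steer y f c) -> v \in cube m c' ->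
  arm_zone L (offset y v i1) (offset y v i2).
Proof.
have [h1 h2 h3 h4 h5] := geo.
move=> /tcen_facts[Ha Hl] /(cube_facts y f)[Va Vl]; have [H1 H2 H3 H4 H5 H6 H7] := ok.
apply: (@arm_zoneE _ f).
  have := H4 f fd; rewrite -/c; have := sbound f.
  by move: (cnt t f) i3 => [|[|[|[|]]]] // _; lia.
have [_ /(_ (proj1 (H5 _ _ fd (oax_neq f)))) K _] := Hl _ (oax_neq f).
by have := Vl (oax f); move: K; rewrite /offset; move: (ctr y _) => C; lia.
Qed.

Lemma arm_fresh c' v : c' \in tcen c (ax f) (steer y f c) -> v \in cube m c' -> ~ zy v.
Proof.
have [h1 h2 h3 h4 h5] := geo.
move=> /tcen_facts[Ha Hl] /(cube_facts y f)[Va Vl]; have [H1 H2 H3 H4 H5 H6 H7] := ok.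
have E := H4 f fd; rewrite -/c in E.
move=> /H7[[j j1 [Hj Kj]]|/(_ f fd)[K _]]; last first.
  by move: K; rewrite mulrDl mul1r; move: ((cnt t f)%:Z * L) E => X E; lia.
have jL : L <= j * L by rewrite -[leLHS]mul1r; apply: ler_wpM2r => //; exact/ltW/L_gt0.
have [fE|nfd] := eqVneq f d.
  have cL : 0 <= (cnt t f)%:Z * L by rewrite mulr_ge0 //; exact/ltW/L_gt0.
  rewrite -fE in Hj; move: (j * L) jL Hj ((cnt t f)%:Z * L) cL E => X X1 Hj Y Y0 E; lia.
have pf := perp nfd; have [fo od] := ax_oax pf.
have pd : ax d != ax f by rewrite eq_sym.
(* A slice with [j <= cnt t f] is too narrow to reach the new seed; one with larger [j] ends too far
   back along [d]. *)
have [ji|ij] := leP j (cnt t f)%:Z.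
  have [K _] := Kj _ pf.
  have Kf : along y f v - along y f s <= j * ww + n%:Z.
    by move: K; rewrite /along /offset /sg; move: (ctr y _) => C; case: f.2; lia.
  have jw : j * ww <= (cnt t f)%:Z * ww by apply: ler_wpM2r => //; lia.
  move: (j * ww) jw Kf => X; move: E; move: (cnt t f) i3 => [|[|[|[|]]]] // _; lia.
have jL2 : ((cnt t f)%:Z + 1) * L <= j * L by apply: ler_wpM2r; [exact/ltW/L_gt0|lia].
have cd : along y d c - along y d s >= (if cnt t f is O then 0 else aa - ((cnt t f)%:Z - 1) * ww).
  case ct: (cnt t f) => [|k]; last by rewrite -ct; apply: H6 => //; rewrite ct.
  have [_] := H5 f (ax d) fd pd; rewrite -/c ct mul0r /along /offset.
  by move: (ctr y _) => C; rewrite /sg; case: d.2; lia.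
(* For [cnt t f = 0] the seed has the coordinate of [s] along [d], strictly before the centre, so
   steering shifts it forwards by at least [aa]. Later steps lose at most [ww]. *)
have vd : along y d v - along y d c >= (if cnt t f is O then aa else - ww) - m%:Z.
  have := Vl (ax d); have [K1 _] := Hl _ pd.
  case ct: (cnt t f) => [|k].
    have [_] := H5 f (ax d) fd pd; rewrite -/c ct mul0r => cs.
    have {cs}cs : c 0 (ax d) = s 0 (ax d) by lia.
    move: H1; rewrite /along /offset /sg cs.
    by move: (ctr y _) => C; case: d.2; case: ltP; lia.
  by move: K1; rewrite /along /offset /sg; move: (ctr y _) => C; case: d.2; lia.
move: (j * L) jL jL2 Hj => X X1; move: cd vd.
by move: (cnt t f) i3 => [|[|[|[|]]]] // _; lia.
Qed.

Lemma arm_reg_zone v : v \in reg c (ax f) (steer y f c) -> zone y d v.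
Proof.
have [h1 h2 h3 h4 h5] := geo.
move=> /reg_facts[Ha Hl]; have [H1 H2 H3 H4 H5 H6 H7] := ok; split.
  move=> j j1 j2; have jd : j != ax f by rewrite /ax; case: f.1.
  have := Hl j jd; have [] := H5 f j fd jd; rewrite -/c /offset ctr_other // subr0; lia.
right; apply: (@arm_zoneE _ f).
  have := H4 f fd; rewrite -/c; have := sbound f.
  by move: (cnt t f) i3 => [|[|[|[|]]]] // _; lia.
have := Hl _ (oax_neq f); have [] := H5 f _ fd (oax_neq f); rewrite -/c /offset.
by move: (ctr y _) => C; lia.
Qed.

Let newh c' g := if g == f then c' else h g.

Lemma arm_step c' (A' zy' : V -> Prop) : c' \in tcen c (ax f) (steer y f c) ->
  (forall v, A v -> A' v) -> (forall v, v \in cube m c' -> A' v) ->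
  (forall v, zy' v -> zy v \/ v \in reg c (ax f) (steer y f c)) ->
  arm_ok A' zy' y d t.+1 s (newh c').
Proof.
have [h1 h2 h3 h4 h5] := geo.
move=> /tcen_facts[Ha Hl] AA cA zz; have [H1 H2 H3 H4 H5 H6 H7] := ok.
have cf : cnt t.+1 f = (cnt t f).+1 by rewrite cntS // eqxx addn1.
have cg g : g != f -> cnt t.+1 g = cnt t g by move=> gf; rewrite cntS // (negbTE gf) addn0.
have S1 (k : nat) : (k.+1)%:Z = k%:Z + 1 by lia.
split=> //.
- by move=> g v gd; rewrite /newh; case: eqP => _; [exact: cA|move=> /(H3 g v gd)/AA].
- move=> g gd; rewrite /newh; case: (eqVneq g f) => [->|gf]; last by rewrite cg // H4.
  have E := H4 f fd; rewrite -/c in E; rewrite cf S1 Ha E mulrDl mul1r; move: (_ * L) => X; lia.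
- move=> g l gd lg; rewrite /newh; case: (eqVneq g f) => [gE|gf]; last by rewrite cg //; exact: H5.
  rewrite gE in lg *; have [K1 K2] := H5 f l fd lg; have [K3 K4 _] := Hl l lg.
  split; first exact: K4.
  by rewrite cf S1 mulrDl mul1r; move: K2; rewrite -/c; move: (_ * ww) => X; lia.
- move=> g gd gax; rewrite /newh; case: (eqVneq g f) => [gE|gf]; last by rewrite cg //; exact: H6.
  rewrite gE in gax *; rewrite cf S1 addrK => _.
  have pd : ax d != ax f by rewrite eq_sym.
  have [K1 _ K3] := Hl _ pd.
  case ct: (cnt t f) => [|k].
    have [_] := H5 f (ax d) fd pd; rewrite -/c ct mul0r => cs.
    have {cs}cs : c 0 (ax d) = s 0 (ax d) by lia.
    move: H1 K3; rewrite /along /offset /sg cs.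
    by move: (ctr y _) => C; case: d.2; case: ltP; lia.
  have := H6 f fd gax; rewrite ct => /(_ isT); rewrite -/c.
  have : - ww <= along y d c' - along y d c.
    by move: K1; rewrite /along /offset /sg; move: (ctr y _) => C; case: d.2; lia.
  by rewrite S1 addrK mulrDl mul1r; move: (k%:Z * ww) => X; lia.
- move=> v /zz[/H7[H|H]|/reg_facts[Va Vl]]; first by left.
    right=> g gd; have [K1 K2] := H g gd; split=> //.
    apply: lt_le_trans K1 _; rewrite lerD2r; apply: ler_wpM2r; first exact/ltW/L_gt0.
    by rewrite lerD2r lez_nat cntS // leq_addr.
  right=> g gd; have E := H4 f fd; rewrite -/c in E.
  have [cl _] := cnt_le g t16; rewrite -/f in cl.
  have cl' : (cnt t f <= cnt t.+1 g)%N by apply: leq_trans cl _; rewrite cntS // leq_addr.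
  have mono : ((cnt t f)%:Z + 1) * L <= ((cnt t.+1 g)%:Z + 1) * L.
    by apply: ler_wpM2r; [exact/ltW/L_gt0|rewrite lerD2r lez_nat].
  have [gE|gf] := eqVneq g f.
    rewrite gE cf S1; move: Va; rewrite E.
    by move: (cnt t f) i3 => [|[|[|[|]]]] // _; lia.
  (* In a direction [g] other than [f], the new box extends by the lateral drift of the arm plus [n]
     at most. As [f] has the smallest count, this stays short of the next target of [g]. *)
  suff : along y g v - along y g s <= (cnt t f)%:Z * ww + n%:Z.
    move: mono; move: (((cnt t.+1 g)%:Z + 1) * L) => X.
    by move: (cnt t f) i3 => [|[|[|[|]]]] // _; lia.
  have [ge|gn] := eqVneq (ax g) (ax f).
    case: (ax_eq ge) => gE; first by rewrite gE eqxx in gf.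
    have w0 : 0 <= (cnt t f)%:Z * ww by rewrite mulr_ge0 //; lia.
    have l0 : 0 <= (cnt t f)%:Z * L by rewrite mulr_ge0 //; lia.
    rewrite gE !along_opp; move: (_%:Z * ww) w0 => X X0.
    by move: (_%:Z * L) l0 E => Y Y0 E; lia.
  have K1 := Vl _ gn; have [_] := H5 f _ fd gn; rewrite -/c.
  move: (_ * ww) => X; move: K1; rewrite /along /offset /sg; move: (ctr y _) => C.
  by case: g.2; lia.
Qed.

End Arm.

Lemma arm_null A zy y d t s h : arm_ok A zy y d t s h -> (t < 16)%N ->
  nth (true, true) dirs (t %% 4) = opp d -> arm_ok A zy y d t.+1 s h.
Proof.
move=> ok t16 fE.
have cg g : g != opp d -> cnt t.+1 g = cnt t g.
  by move=> gd; rewrite cntS // fE (negbTE gd) addn0.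
case: ok => H1 H2 H3 H4 H5 H6 H7; split=> //.
- by move=> f fd; rewrite cg // H4.
- by move=> f l fd lf; rewrite cg //; exact: H5.
- by move=> f fd; rewrite cg //; exact: H6.
- by move=> v /H7[H|H]; [left|right=> f fd; rewrite cg //; exact: H].
Qed.

Lemma arm_head A zy y d s h f : arm_ok A zy y d 16 s h ->
  f != opp d -> head_ok A zy y f (h f).
Proof.
have [h1 h2 h3 h4 h5] := geo.
case=> H1 H2 H3 H4 H5 H6 H7 fd.
have fb : `|along y f s| <= L.
  have [E|ne] := eqVneq (ax f) (ax d).
    by case: (ax_eq E) => ->; rewrite ?along_opp; lia.
  by have := H2 _ ne; rewrite /along /sg; case: f.2; lia.
have E := H4 f fd; rewrite cnt16 in E; split=> //.
- by move=> v; exact: H3.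
- by lia.
- by move=> j jf; have [] := H5 f j fd jf.
- move=> v /H7[[j j1 [Hj Kj]]|/(_ f fd)[_]]; last by lia.
  have jL : L <= j * L by rewrite -[leLHS]mul1r; apply: ler_wpM2r => //; exact/ltW/L_gt0.
  have [fE|ne] := eqVneq (ax f) (ax d).
    case: (ax_eq fE) => gE; last by rewrite gE eqxx in fd.
    by rewrite gE in E *; move: (j * L) jL Hj => X X1; lia.
  have [_ K] := Kj _ ne; have : along y f v <= 2 * L.
    by move: K; rewrite /along /sg; case: f.2; lia.
  by lia.
Qed.

Lemma run_begin A zy zx x d c : head_ok A zx x d c -> (forall v, ~ zy v) ->
  run_ok A zy zx (nb x d) d 0 c.
Proof.
have [h1 h2 h3 h4 h5] := geo.
case=> H1 H2 H3 H4 nz; split=> //.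
- by move=> j jd; rewrite /offset ctr_nb //; exact: H3.
- by rewrite along_nb; lia.
- by right; rewrite along_nb mul0r; lia.
- by move=> v /nz.
- by move=> v /H4; rewrite !along_nb; lia.
Qed.

Lemma zone_near y d v : zone y d v -> near L (offset y v i1) (offset y v i2).
Proof.
have [h1 h2 h3 h4 h5] := geo; have L0 := L_gt0.
move=> [_ [|]]; rewrite /run_zone /arm_zone /near /ranges /sg.
  by case: d => [[] []] /=; lia.
by lia.
Qed.

End Geometry.

Definition in_window (B : nat) (z : site) := (0 <= z.1 < B%:Z) && (0 <= z.2 < B%:Z).
Definition window (B : nat) : seq site := [seq (i%:Z, j%:Z) | i <- iota 0 B, j <- iota 0 B].
(** A fictitious finished site outside the window: it plays the parent of (0, 0) and makes the
    initial seed an ordinary head. *)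
Definition origin : site := (-1, 0).

Lemma mem_window B z : (z \in window B) = in_window B z.
Proof.
apply/allpairsP/idP => [[[i j] /= [+ + ->]]|].
  by rewrite !mem_iota /in_window /=; lia.
move=> /andP[h1 h2]; exists (`|z.1|%N, `|z.2|%N); rewrite !mem_iota /=.
by split; [lia|lia|case: z h1 h2 => a b /= h1 h2; congr (_, _); lia].
Qed.

(** * The exploration and its invariant *)

Section Exploration.
Context {D : nat}.
Variables (i1 i2 : 'I_D) (m n B : nat).
Hypotheses (i12 : i1 != i2) (mn : (4 * m + 6 <= n)%N).
Local Notation V := 'rV[int]_D.
Local Notation L := (stride m n).
Local Notation reg := (@reg D m n).
Local Notation tcen := (@tcen D m n).
Local Notation targets := (@targets D m n).
Local Notation steer := (@steer D i1 i2 m n).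
Local Notation along := (@along D i1 i2 m n).
Local Notation ax := (@ax D i1 i2).
Local Notation zone := (@zone D i1 i2 m n).
Local Notation offset := (@offset D i1 i2 m n).
Local Notation adj := (@Zd_adj D).
Local Notation label := (site * nat)%type.

Let rel1 y v : offset y v i1 = (v 0 i1 - 12 * L) - 16 * (L * y.1).
Proof. by rewrite /offset /ctr eqxx; lia. Qed.

Let rel2 y v : offset y v i2 = v 0 i2 - 16 * (L * y.2).
Proof. by rewrite /offset /ctr eq_sym (negbTE i12) eqxx. Qed.

Local Notation in_window := (in_window B).
Local Notation window := (window B).

Record state := State {
  stA : V -> Prop;
  stZ : site -> V -> Prop;
  stPd : site -> dir;
  stHd : site -> option (dir -> V);
  stStarted : seq site;
  stUsed : seq label;
  stFail : seq label;
  stCur : option (site * nat * (dir -> V)) }.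

Implicit Types (sigma : state) (y z : site) (d f : dir) (h : dir -> V) (v c : V).

Definition revealed sigma v := exists z, stZ sigma z v.

(** Level 0 is reserved for the base bits; 32 step indices and four parity classes fill the levels 1
    to 128. *)
Definition layer (l : label) : nat :=
  (1 + l.2 + 32 * (odd `|l.1.1| + 2 * odd `|l.1.2|))%N.

(** [None] is an idle step: the corridor is already crossed, or the arm would lead back to the
    parent. Idling keeps the same schedule of 32 indices for every site. *)
Definition slot y d (idx : nat) h : option dir :=
  if (idx < 16)%N then (if along y d (h d) < - L then Some d else None)
  else let f := nth (true, true) dirs ((idx - 16) %% 4) in
    if f == opp d then None else Some f.

Definition new_heads (idx : nat) f h c' : dir -> V :=
  if (idx < 16)%N then (fun=> c') else (fun g => if g == f then c' else h g).

Definition set_at (T : Type) (F : site -> T) y (a : T) : site -> T :=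
  fun z => if z == y then a else F z.

Definition set_cur sigma cur := State (stA sigma) (stZ sigma) (stPd sigma) (stHd sigma)
  (stStarted sigma) (stUsed sigma) (stFail sigma) cur.

Definition advance sigma y (idx : nat) h :=
  if idx.+1 == 32 then
    State (stA sigma) (stZ sigma) (stPd sigma) (set_at (stHd sigma) y (Some h))
      (stStarted sigma) (stUsed sigma) (stFail sigma) None
  else set_cur sigma (Some (y, idx.+1, h)).

Definition abort sigma y (idx : nat) :=
  State (stA sigma) (stZ sigma) (stPd sigma) (stHd sigma)
    (stStarted sigma) (stUsed sigma) ((y, idx) :: stFail sigma) None.

Definition sreg y f c := reg c (ax f) (steer y f c).
Definition stgt y f c := targets c (ax f) (steer y f c).

Definition add_revealed sigma y f c (A' : V -> Prop) z v :=
  stZ sigma z v \/ [/\ z = y, v \in sreg y f c &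
    step_revealed adj (sreg y f c) (revealed sigma) A' v].

Definition reveal sigma y (idx : nat) f c (A' : V -> Prop) :=
  State A' (add_revealed sigma y f c A') (stPd sigma) (stHd sigma)
    (stStarted sigma) ((y, idx) :: stUsed sigma) (stFail sigma) (stCur sigma).

Definition hit_targets y f c (A' : V -> Prop) :=
  [seq c' <- tcen c (ax f) (steer y f c) | `[< forall v, v \in cube m c' -> A' v >]].

Definition exec sigma y (idx : nat) h f (A' : V -> Prop) :=
  let sigma' := reveal sigma y idx f (h f) A' in
  if hit_targets y f (h f) A' is c' :: _ then advance sigma' y idx (new_heads idx f h c')
  else abort sigma' y idx.

Definition explored sigma y (idx : nat) f c (w : V * nat -> bool) :=
  step_set adj (sreg y f c) (layer (y, idx)) (stA sigma) (revealed sigma) w.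

Definition candidates := [seq (y, d) | y <- window, d <- dirs].

Lemma mem_candidates y d : ((y, d) \in candidates) = in_window y.
Proof.
rewrite -mem_window; apply/allpairsP/idP => [[[y' d'] [/= + _ [->]]]//|yW].
by exists (y, d); split=> //; exact: mem_dirs.
Qed.

Definition next sigma : option (site * dir) :=
  ohead [seq yd <- candidates |
    (yd.1 \notin stStarted sigma) && isSome (stHd sigma (nb yd.1 (opp yd.2)))].

Definition begin sigma y d h :=
  State (stA sigma) (stZ sigma) (set_at (stPd sigma) y d) (stHd sigma)
    (y :: stStarted sigma) (stUsed sigma) (stFail sigma) (Some (y, 0%N, fun=> h d)).

Definition step sigma w : state :=
  match stCur sigma with
  | Some (y, idx, h) =>
    if slot y (stPd sigma y) idx h is Some f then exec sigma y idx h f (explored sigma y idx f (h f) w)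
    else advance sigma y idx h
  | None => if next sigma is Some (y, d) then
      (if stHd sigma (nb y (opp d)) is Some h then begin sigma y d h else sigma)
    else sigma
  end.

Fixpoint run (k : nat) sigma w : state :=
  if k is k'.+1 then run k' (step sigma w) w else sigma.

Definition start : state := State (fun v => v \in cube m 0)
  (fun z v => z = origin /\ v \in cube m 0) (fun=> (true, true))
  (fun z => if z == origin then Some (fun=> 0) else None) [::] [::] [::] None.

Definition cur_ok (A : V -> Prop) (Z : site -> V -> Prop) y d (idx : nat) h :=
  if (idx < 16)%N then
    exists2 c, h = (fun=> c) & run_ok i1 i2 m n A (Z y) (Z (nb y (opp d))) y d idx c
  else exists s, arm_ok i1 i2 m n A (Z y) y d (idx - 16) s h.

Record inv_global sigma : Prop := InvGlobal {
  iAZ : forall v, stA sigma v -> revealed sigma v;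
  iZA : forall v, revealed sigma v -> ~ stA sigma v -> exists2 u, stA sigma u & adj u v;
  iStW : forall z, z \in stStarted sigma -> in_window z;
  iUst : forall l, l \in stUsed sigma -> l.1 \in stStarted sigma;
  iFail : {subset stFail sigma <= stUsed sigma};
  iHst : forall z, stHd sigma z -> (z \in stStarted sigma) \/ z = origin;
  iHo : stHd sigma origin;
  iPo : stPd sigma origin = (true, true);
  iZst : forall z v, stZ sigma z v -> (z \in stStarted sigma) \/ z = origin;
  iZone : forall z v, stZ sigma z v -> zone z (stPd sigma z) v;
  iPar : forall z, z \in stStarted sigma -> stHd sigma (nb z (opp (stPd sigma z)));
  iComp : forall x h, stHd sigma x = Some h -> forall d, (x = origin -> d = (true, true)) ->
    d != opp (stPd sigma x) -> head_ok i1 i2 m n (stA sigma) (stZ sigma x) x d (h d) }.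

Record inv sigma : Prop := Inv {
  iG : inv_global sigma;
  iCur : forall y idx h, stCur sigma = Some (y, idx, h) ->
    [/\ y \in stStarted sigma, stHd sigma y = None, (idx < 32)%N,
      (forall j, (y, j) \in stUsed sigma -> (j < idx)%N) &
      cur_ok (stA sigma) (stZ sigma) y (stPd sigma y) idx h];
  iDone : forall z, z \in stStarted sigma -> [\/ stHd sigma z,
    exists2 idx, (idx < 32)%N & (z, idx) \in stFail sigma |
    exists idx h, stCur sigma = Some (z, idx, h)] }.

Lemma origin_out : in_window origin = false.
Proof. by rewrite /in_window. Qed.

Lemma nb_neq y d : nb y d != y.
Proof.
by apply/eqP; case: y d => [a b] [[] []]; rewrite /nb /sg /= => -[]; lia.
Qed.

Lemma cur_ok_run A Z y d idx c : (idx <= 16)%N ->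
  run_ok i1 i2 m n A (Z y) (Z (nb y (opp d))) y d idx c -> cur_ok A Z y d idx (fun=> c).
Proof.
move=> le16 ok; rewrite /cur_ok; case: ltnP => lt; first by exists c.
have E : idx = 16%N by lia.
by rewrite E subnn in ok *; exists c; apply: (run_arm i12 mn ok).
Qed.

Record exec_ready sigma y (idx : nat) h f : Prop := ExecReady {
  rIn : forall v, v \in cube m (h f) -> stA sigma v;
  rFresh : forall c' v, c' \in tcen (h f) (ax f) (steer y f (h f)) -> v \in cube m c' ->
    ~ revealed sigma v;
  rZone : forall v, v \in sreg y f (h f) -> zone y (stPd sigma y) v;
  rNext : forall c' (A' : V -> Prop) (Z' : site -> V -> Prop),
    c' \in tcen (h f) (ax f) (steer y f (h f)) ->
    (forall v, stA sigma v -> A' v) -> (forall v, v \in cube m c' -> A' v) ->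
    (forall v, Z' y v -> stZ sigma y v \/ v \in sreg y f (h f)) ->
    (forall z, z != y -> Z' z = stZ sigma z) ->
    cur_ok A' Z' y (stPd sigma y) idx.+1 (new_heads idx f h c') }.

(** Targets are fresh for three reasons: the cone and arm invariants exclude what [y] itself has
    revealed, the front condition excludes the parent during the run, and planar disjointness
    excludes all other sites. *)
Lemma ready sigma y idx h f : inv sigma -> stCur sigma = Some (y, idx, h) ->
  slot y (stPd sigma y) idx h = Some f -> exec_ready sigma y idx h f.
Proof.
move=> [G C _] /C[ySt yH idx32 _ ok]; set d := stPd sigma y in ok *.
have L0 : 0 < L by exact: L_gt0 i12 mn.
have yo z : z = y \/ z <> y by case: (eqVneq z y) => [|/eqP]; [left|right].
(* The parent of a started site is finished and has heads, while [y] is still in progress and has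
   none. *)
have npar z : z \in stStarted sigma \/ z = origin -> y <> nb z (opp (stPd sigma z)).
  move=> zs yE; case: zs => [/(iPar G)|zo]; first by rewrite -yE yH.
  have := iStW G ySt; rewrite yE zo (iPo G) /in_window /nb /=.
  by rewrite /sg /=; lia.
rewrite /slot; move: ok; rewrite /cur_ok; case: ltnP => [lt [c hE ok]|ge [s ok]].
  case: ifP => // far [fE]; rewrite -fE hE in far *.
  split.
  - exact: run_in ok.
  - move=> c' v c't vc [z Zv].
    have [nzy nzx rz] := run_fresh i12 mn ok far c't vc.
    have [E|zy] := yo z; first by rewrite E in Zv.
    have [E|zx] := eqVneq z (nb y (opp d)); first by rewrite E in Zv.
    have zs := iZst G Zv.
    have [_] := iZone G Zv; rewrite !rel1 !rel2 in rz * => zz.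
    by apply: (run_zone_disjoint L0 zy (npar z zs) _ rz zz); exact/eqP.
  - exact: (run_reg_zone i12 mn ok far).
  - move=> c' A' Z' c't _ cA Zy Zz; rewrite /new_heads lt.
    by apply: cur_ok_run => //; rewrite (Zz (nb y (opp d))) ?nb_neq //; apply: (run_step i12 mn ok far c't cA Zy).
case: ifP => // /negbT fd [fE]; set t := (idx - 16)%N in ok fd fE *.
have t16 : (t < 16)%N by rewrite /t; lia.
rewrite -fE; split.
- by move=> v; exact: (arm_in ok fd).
- move=> c' v c't vc [z Zv].
  have az := arm_zone_target i12 mn ok t16 fd c't vc.
  have [E|zy] := yo z.
    by rewrite E in Zv; exact: (arm_fresh i12 mn ok t16 fd c't vc).
  have zs := iZst G Zv.
  have [_] := iZone G Zv; rewrite !rel1 !rel2 in az * => zz.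
  exact: (arm_zone_disjoint L0 zy (npar z zs) az zz).
- by move=> v; exact: (arm_reg_zone i12 mn ok t16 fd).
- move=> c' A' Z' c't AA cA Zy Zz; rewrite /new_heads /cur_ok.
  have -> : (idx.+1 < 16)%N = false by lia.
  have -> : (idx < 16)%N = false by lia.
  have -> : (idx.+1 - 16)%N = t.+1 by rewrite /t; lia.
  by exists s; apply: (arm_step i12 mn ok t16 fd c't AA cA Zy).
Qed.

Lemma revealE sigma y idx f c w : inv_global sigma ->
  let A' := explored sigma y idx f c w in
  forall v, revealed (reveal sigma y idx f c A') v <->
    step_revealed adj (sreg y f c) (revealed sigma) A' v.
Proof.
move=> G A' v; split.
  by move=> [z /=]; rewrite /add_revealed => -[Zv|[_ _ //]]; left; exists z.
move=> sr; case: (sr) => [[z Zv]|[A'v|[vR _]]].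
- by exists z; left.
- case: (reach_region A'v) => [/(iAZ G)[z Zv]|[vR _]]; first by exists z; left.
  by exists y; right.
- by exists y; right.
Qed.

Lemma inv_reveal sigma y idx f c w : inv_global sigma -> y \in stStarted sigma ->
  stHd sigma y = None -> (forall v, v \in sreg y f c -> zone y (stPd sigma y) v) ->
  inv_global (reveal sigma y idx f c (explored sigma y idx f c w)).
Proof.
move=> G ySt yH rz; have rE := @revealE sigma y idx f c w G; move: rE => /=.
set A' := explored _ _ _ _ _ _ => rE.
have AA v : stA sigma v -> A' v by exact: step_set_sub.
case: (G) => H1 H2 H3 H4 H5 H6 H7 H8 H9 H10 H11 H12; split => //=.
- by move=> v A'v; apply/rE; right; left.
- move=> v /rE sr nA; exact: (step_revealed_boundary H2 sr nA).
- by move=> l; rewrite inE => /orP[/eqP ->//|/H4].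
- by move=> l /H5 lu; rewrite inE lu orbT.
- by move=> z v [/H9//|[-> _ _]]; left.
- by move=> z v [/H10//|[-> vR _]]; exact: rz.
- move=> x h xh d dW dn; have [K1 K2 K3 K4] := H12 x h xh d dW dn; split=> //.
    by move=> v /K1/AA.
  move=> v [/K4//|[xy _ _]]; by rewrite xy yH in xh.
Qed.

Lemma inv_advance sigma y idx h : inv_global sigma -> y \in stStarted sigma ->
  stHd sigma y = None -> (idx < 32)%N -> (forall j, (y, j) \in stUsed sigma -> (j <= idx)%N) ->
  (forall z, z \in stStarted sigma -> z <> y -> stHd sigma z \/
     exists2 idx, (idx < 32)%N & (z, idx) \in stFail sigma) ->
  cur_ok (stA sigma) (stZ sigma) y (stPd sigma y) idx.+1 h -> inv (advance sigma y idx h).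
Proof.
move=> G ySt yH idx32 used done ok; rewrite /advance; case: eqP => idxE; last first.
  case: (G) => H1 H2 H3 H4 H5 H6 H7 H8 H9 H10 H11 H12; split=> //=.
    by move=> _ _ _ [<- <- <-]; split=> //; lia.
  move=> z zs; have [->|/eqP zy] := eqVneq z y; first by apply: Or33; exists idx.+1, h.
  by case: (done z zs zy) => H; [apply: Or31|apply: Or32].
have idxE' : idx = 31%N by lia.
move: ok; rewrite idxE' /cur_ok /= => -[s ok].
have mono z : stHd sigma z -> set_at (stHd sigma) y (Some h) z.
  by rewrite /set_at; case: eqP.
case: (G) => H1 H2 H3 H4 H5 H6 H7 H8 H9 H10 H11 H12; split=> //=.
  split=> //=.
  - by move=> z; rewrite /set_at; case: eqP => [->|_ /H6//]; left.
  - exact: mono.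
  - by move=> z /H11/mono.
  - move=> x h'; rewrite /set_at; case: eqP => [-> [<-] d dW dn|_]; last exact: H12.
    exact: (arm_head i12 mn ok dn).
move=> z zs; have [->|/eqP zy] := eqVneq z y; first by apply: Or31; rewrite /set_at eqxx.
by case: (done z zs zy) => H; [apply: Or31; exact: mono|apply: Or32].
Qed.

Lemma inv_done sigma y idx h : inv sigma -> stCur sigma = Some (y, idx, h) ->
  forall z, z \in stStarted sigma -> z <> y -> stHd sigma z \/
     exists2 idx, (idx < 32)%N & (z, idx) \in stFail sigma.
Proof.
move=> [_ _ Dn] E z zs zy; case: (Dn z zs) => [H|H|[idx' [h' H]]]; [by left|by right|].
by move: H; rewrite E => -[/esym].
Qed.

Lemma inv_exec sigma y idx h f w : inv sigma -> stCur sigma = Some (y, idx, h) ->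
  slot y (stPd sigma y) idx h = Some f ->
  inv (exec sigma y idx h f (explored sigma y idx f (h f) w)).
Proof.
move=> I E sl; have [R1 R2 R3 R4] := ready I E sl.
have [G C _] := I; have [ySt yH idx32 used ok] := C _ _ _ E.
have dn := inv_done I E.
have G' := inv_reveal idx w G ySt yH R3.
have used' j : (y, j) \in (y, idx) :: stUsed sigma -> (j <= idx)%N.
  by rewrite inE => /orP[/eqP[->]//|/used/ltnW].
rewrite /exec; case hE : (hit_targets _ _ _ _) => [|c' cs].
  case: G' => H1 H2 H3 H4 H5 H6 H7 H8 H9 H10 H11 H12; split=> //=.
    split=> //=; first by move=> l; rewrite !inE => /orP[->//|/H5]; rewrite inE.
  move=> z zs.
  have [->|/eqP zy] := eqVneq z y; first by apply: Or32; exists idx => //; rewrite inE eqxx.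
  case: (dn z zs zy) => [H|[j j32 jf]]; first exact: Or31.
  by apply: Or32; exists j => //; rewrite inE jf orbT.
apply: inv_advance => //.
have : c' \in hit_targets y f (h f) (explored sigma y idx f (h f) w) by rewrite hE inE eqxx.
rewrite mem_filter => /andP[/asboolP cA c't].
apply: R4 => //.
- by move=> v; exact: step_set_sub.
- by move=> v [|[]]; [left|right].
- move=> z zy; apply/funext => v; apply/propext; split; last by left.
  by case=> // -[zE]; rewrite zE eqxx in zy.
Qed.

Lemma inv_null sigma y idx h : inv sigma -> stCur sigma = Some (y, idx, h) ->
  slot y (stPd sigma y) idx h = None -> inv (advance sigma y idx h).
Proof.
move=> I E; have [G C _] := I; have [ySt yH idx32 used ok] := C _ _ _ E.
move=> sl; apply: inv_advance => //.
- by move=> j /used/ltnW.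
- exact: inv_done I E.
move: sl ok; rewrite /slot {1}/cur_ok; case: ltnP => [lt|ge].
  case: ifPn => //; rewrite -leNgt => near _ [c hE ok].
  rewrite hE in near *; apply: cur_ok_run => //; exact: (run_null ok near).
case: eqP => // fE _ [s ok]; rewrite /cur_ok.
have -> : (idx.+1 < 16)%N = false by lia.
exists s; have -> : (idx.+1 - 16 = (idx - 16).+1)%N by lia.
by apply: arm_null ok _ fE; lia.
Qed.

Lemma nextP sigma y d : next sigma = Some (y, d) ->
  [/\ in_window y, y \notin stStarted sigma & stHd sigma (nb y (opp d))].
Proof.
rewrite /next; case E : [seq _ <- _ | _] => [//|yd r] [ydE].
have : yd \in yd :: r by rewrite inE eqxx.
by rewrite -E mem_filter ydE mem_candidates => /andP[/andP[/= h1 h2] yW].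
Qed.

Lemma inv_begin sigma y d h : inv sigma -> stCur sigma = None ->
  in_window y -> y \notin stStarted sigma -> stHd sigma (nb y (opp d)) = Some h ->
  inv (begin sigma y d h).
Proof.
move=> [G _ Dn] E yW yS xh; case: (G) => H1 H2 H3 H4 H5 H6 H7 H8 H9 H10 H11 H12.
have yo : y <> origin by move=> yo; rewrite yo origin_out in yW.
have nZ v : ~ stZ sigma y v by move=> /H9[ys|//]; rewrite ys in yS.
have yH : stHd sigma y = None.
  by case yh : (stHd sigma y) (H6 y) => // /(_ isT)[ys|//]; rewrite ys in yS.
have pdE z : z != y -> set_at (stPd sigma) y d z = stPd sigma z.
  by rewrite /set_at => /negbTE ->.
have ny z : z \in stStarted sigma -> z != y by apply: contraTneq => ->.
(* Otherwise [y] would be the parent of its own parent and hence already have heads; behind [origin]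
   it would lie outside the window. *)
have dn : d != opp (stPd sigma (nb y (opp d))).
  apply/eqP => dE; set x := nb y (opp d) in dE xh.
  have yE : y = nb x d by rewrite /x nbKV.
  have [xs|xo] : x \in stStarted sigma \/ x = origin by apply: H6; rewrite xh.
    have := H11 x xs; rewrite -dE -yE; by rewrite yH.
  move: yW; rewrite yE dE xo H8 /in_window /nb /opp /sg /=; lia.
split => /=.
- split=> //=.
  + by move=> z; rewrite inE => /orP[/eqP ->//|/H3].
  + by move=> l /H4 ls; rewrite inE ls orbT.
  + by move=> z /H6[zs|->]; [left; rewrite inE zs orbT|right].
  + by rewrite pdE //; apply/eqP => /esym.
  + by move=> z v /H9[zs|->]; [left; rewrite inE zs orbT|right].
  + move=> z v Zv; rewrite pdE; first exact: H10.
    by apply/eqP => zE; rewrite zE in Zv; exact: nZ Zv.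
  + move=> z; rewrite inE => /orP[/eqP ->|zs]; first by rewrite /set_at eqxx xh.
    by rewrite pdE ?ny //; exact: H11.
  + move=> x' h' xh' d' dW; rewrite pdE; first exact: H12.
    by apply/eqP => xE; rewrite xE yH in xh'.
- move=> _ _ _ [<- <- <-]; split=> //.
  + by rewrite inE eqxx.
  + by move=> j /H4 /= ys; rewrite ys in yS.
  + rewrite {1}/set_at eqxx; apply: cur_ok_run => //.
    have yE : y = nb (nb y (opp d)) d by rewrite nbKV.
    have xo : nb y (opp d) = origin -> d = (true, true).
      move=> xo; move: yW; rewrite yE xo; case: (d) => [[] []] //; rewrite /in_window /nb /sg /=; lia.
    have ok := H12 _ _ xh d xo dn.
    have := run_begin i12 mn (zy := stZ sigma y) ok nZ; by rewrite -yE.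
- move=> z; rewrite inE => /orP[/eqP ->|zs]; first by apply: Or33; do 2!eexists.
  case: (Dn z zs) => [H|H|[j [h' H]]]; [exact: Or31|exact: Or32|].
  by rewrite E in H.
Qed.

Lemma inv_step sigma w : inv sigma -> inv (step sigma w).
Proof.
move=> I; rewrite /step; case E : (stCur sigma) => [[[y idx] h]|].
  by case sl : slot => [f|]; [exact: inv_exec I E sl|exact: inv_null I E sl].
case nE : (next sigma) => [[y d]|//].
have [yW yS] := nextP nE; case xh : (stHd _ _) => [h|//] _.
exact: inv_begin.
Qed.

Lemma inv_run k sigma w : inv sigma -> inv (run k sigma w).
Proof. by elim: k sigma => //= k IH sigma I; apply: IH; exact: inv_step. Qed.

Lemma inv_start : inv start.
Proof.
have [h1 h2 h3 h4 h5] := geo i12 mn; have L0 := L_gt0 i12 mn.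
have inz v : v \in cube m 0 -> forall j, `|v 0 j| <= m%:Z.
  by move=> /cubeP H j; have := H j; rewrite mxE subr0.
(* The initial seed is thus [4 * L] past the centre of [origin], midway between the bounds 3 L and 5
   L for a head. *)
have ctr0 j : ctr i1 i2 m n origin j = (if j == i1 then - 4 * L else 0).
  by rewrite /ctr /=; case: eqP => _; [lia|case: eqP => _; lia].
split=> //=; split=> //=.
- by move=> v vc; exists origin.
- by move=> v [z [_]].
- by move=> z; case: eqP => [->|//]; right.
- by move=> z v [-> _]; right.
- move=> z v [-> vc]; split.
    by move=> j _ _; have := inz v vc j; lia.
  right; rewrite /arm_zone /offset !ctr0 eqxx eq_sym (negbTE i12).
  by have := inz v vc i1; have := inz v vc i2; lia.
- move=> x h; case: eqP => [->|//] [<-] d dW _.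
  rewrite (dW erefl); split=> //.
  + by rewrite /along /offset ctr0 /ax /= eqxx mxE /sg; lia.
  + move=> j; rewrite /ax /= => /negbTE ji; rewrite /offset ctr0 ji mxE subrr; lia.
  + move=> v [_ vc]; have := inz v vc i1.
    by rewrite /along /offset ctr0 /ax /= eqxx mxE /sg; lia.
Qed.

End Exploration.

Lemma count_lt (T : eqType) (a b : pred T) (s : seq T) x : (forall y, a y -> b y) ->
  x \in s -> b x -> ~~ a x -> (count a s < count b s)%N.
Proof.
move=> ab; elim: s => // y s IH; rewrite inE => /orP[/eqP <-|xs] bx ax /=.
  by rewrite bx (negbTE ax) add0n add1n ltnS; exact: sub_count.
rewrite -addnS leq_add //; last exact: IH.
by case ay : (a y) => //; rewrite (ab _ ay).
Qed.

(** * Fresh bits and the law of the exploration *)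

Section ExplorationLaw.
Context {R : realFieldType} {D : nat}.
Variables (i1 i2 : 'I_D) (m n B : nat).
Hypotheses (i12 : i1 != i2) (mn : (4 * m + 6 <= n)%N).
Local Notation V := 'rV[int]_D.
Local Notation L := (stride m n).
Local Notation state := (@state D).
Local Notation offset := (@offset D i1 i2 m n).
Local Notation zone := (@zone D i1 i2 m n).
Local Notation adj := (@Zd_adj D).
Local Notation label := (site * nat)%type.
Local Notation inv := (@inv D i1 i2 m n B).
Local Notation step := (@step D i1 i2 m n B).
Local Notation run := (@run D i1 i2 m n B).
Local Notation exec := (@exec D i1 i2 m n).
Local Notation advance := (@advance D).
Local Notation explored := (@explored D i1 i2 m n).
Local Notation slot := (@slot D i1 i2 m n).
Local Notation sreg := (@sreg D i1 i2 m n).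
Local Notation stgt := (@stgt D i1 i2 m n).
Local Notation next := (@next D B).
Implicit Types (sigma : state) (y z : site) (d f : dir) (h : dir -> V) (v c : V) (l : label).

Definition nearby y v := near L (offset y v i1) (offset y v i2).

(** Near a given vertex, step index and parities determine the label, so a sprinkled bit is read on
    behalf of one label only. *)
Lemma layer_inj l l' v : nearby l.1 v -> nearby l'.1 v -> (l.2 < 32)%N -> (l'.2 < 32)%N ->
  layer l = layer l' -> l = l'.
Proof.
case: l l' => [y i] [y' j] /= n1 n2 i32 j32; rewrite /layer /= => E.
have [-> [par1 par2]] : i = j /\ (odd `|y.1| = odd `|y'.1| /\ odd `|y.2| = odd `|y'.2|).
  move: E; case: (odd `|y.1|); case: (odd `|y.2|); case: (odd `|y'.1|); case: (odd `|y'.2|) => /=; lia.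
congr (_, _).
have rel1 z : offset z v i1 = (v 0 i1 - 12 * L) - 16 * (L * z.1).
  by rewrite /offset /ctr eqxx; lia.
have rel2 z : offset z v i2 = v 0 i2 - 16 * (L * z.2).
  by rewrite /offset /ctr eq_sym (negbTE i12) eqxx.
move: n1 n2; rewrite /nearby !rel1 !rel2.
move=> n1 n2; exact: (@near_eq L (L_gt0 i12 mn) y y' _ _ par1 par2 n1 n2).
Qed.

(** An upper bound for the bits that the rest of the run can read. It shrinks along the run and
    after each step avoids the bits which that step has read; this is the independence behind
    [Pr_fail_le]. *)
Definition future sigma (t : V * nat) := (t.2 = 0%N /\ ~ revealed sigma t.1) \/
  exists l, [/\ l \notin stUsed sigma, (l.2 < 32)%N, t.2 = layer l & nearby l.1 t.1].

Lemma execE sigma y idx h f A' : let sigma' := exec sigma y idx h f A' in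
  let sigma1 := reveal i1 i2 m n sigma y idx f (h f) A' in
  [/\ stZ sigma' = stZ sigma1, stUsed sigma' = (y, idx) :: stUsed sigma, stA sigma' = A' &
   stFail sigma' = if hit_targets i1 i2 m n y f (h f) A' is _ :: _ then stFail sigma
     else (y, idx) :: stFail sigma].
Proof.
rewrite /exec; case: hit_targets => [|c cs] //.
by rewrite /advance; case: ifP.
Qed.

Lemma advanceE sigma y idx h : [/\ stZ (advance sigma y idx h) = stZ sigma,
  stUsed (advance sigma y idx h) = stUsed sigma, stA (advance sigma y idx h) = stA sigma &
  stFail (advance sigma y idx h) = stFail sigma].
Proof. by rewrite /advance; case: ifP. Qed.

Lemma future_sub sigma sigma' t : stZ sigma' = stZ sigma -> stUsed sigma' = stUsed sigma ->
  future sigma' t -> future sigma t.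
Proof. by rewrite /future /revealed => -> ->. Qed.

Lemma step_bits_future sigma y idx h f A' t : inv sigma -> stCur sigma = Some (y, idx, h) ->
  slot y (stPd sigma y) idx h = Some f ->
  step_bits adj (sreg y f (h f)) (layer (y, idx)) (revealed sigma) A' t -> future sigma t.
Proof.
move=> I E sl [tR [[t0 [nZ _]]|[tl Zt]]]; first by left.
right; exists (y, idx); have [_ _ rz _] := ready i12 mn I E sl.
have [_ C _] := I; have [_ _ idx32 used _] := C _ _ _ E.
split=> //; first by apply/negP => /used; rewrite ltnn.
by apply: (zone_near i12 mn); exact: rz.
Qed.

Lemma future_exec sigma y idx h f w t : inv sigma -> stCur sigma = Some (y, idx, h) ->
  slot y (stPd sigma y) idx h = Some f -> let A' := explored sigma y idx f (h f) w in
  future (exec sigma y idx h f A') t ->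
  future sigma t /\ ~ step_bits adj (sreg y f (h f)) (layer (y, idx)) (revealed sigma) A' t.
Proof.
move=> I E sl A'; have [G C _] := I; have [_ _ idx32 used _] := C _ _ _ E.
have [e1 e2 _ _] := execE sigma y idx h f A'.
have rE v : revealed (exec sigma y idx h f A') v <->
    step_revealed adj (sreg y f (h f)) (revealed sigma) A' v.
  rewrite /revealed e1; apply: revealE; exact: G.
have [_ _ rz _] := ready i12 mn I E sl.
rewrite {1}/future e2 => -[[t0 nZ]|[l [lU l32 tl nl]]].
  split; first by left; split=> // Zt; apply: nZ; apply/rE; left.
  move=> [tR [[_ [_ sr]]|[tl Zt]]]; first by apply: nZ; exact/rE.
  by move: tl; rewrite t0 /layer; lia.
move: lU; rewrite inE negb_or => /andP[ly lU]; split; first by right; exists l.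
move=> [tR [[t0 _]|[tl' _]]]; first by move: tl; rewrite t0 /layer; lia.
case/eqP: ly; apply: (layer_inj nl) => //; last by rewrite -tl.
by apply: (zone_near i12 mn); exact: rz.
Qed.

Lemma explored_bits sigma y idx f c w w' :
  (forall t, step_bits adj (sreg y f c) (layer (y, idx)) (revealed sigma)
    (explored sigma y idx f c w) t -> w t = w' t) ->
  explored sigma y idx f c w' = explored sigma y idx f c w.
Proof. by move=> H; apply: step_set_bits => t /H. Qed.

Lemma future_step sigma w t : inv sigma -> future (step sigma w) t -> future sigma t.
Proof.
move=> I; rewrite /step; case E : (stCur sigma) => [[[y idx] h]|].
  case sl : (slot _ _ _ _) => [f|].
    by move=> /(future_exec I E sl)[].
  have [e1 e2 _ _] := advanceE sigma y idx h; exact: future_sub.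
case nE : (next _) => [[y d]|//].
by case: (stHd sigma _).
Qed.

Lemma step_dep sigma : inv sigma -> dep (future sigma) (step sigma).
Proof.
move=> I w w' H; rewrite /step; case E : (stCur sigma) => [[[y idx] h]|//].
case sl : (slot _ _ _ _) => [f|//].
congr (exec _ _ _ _ _); apply/esym/explored_bits => t /step_bits_future fut.
by apply: H; exact: fut.
Qed.

Lemma run_dep k sigma : inv sigma -> dep (future sigma) (run k sigma).
Proof.
elim: k sigma => // k IH sigma I w w' H /=.
rewrite -(step_dep I H); apply: IH; first exact: inv_step.
by move=> t /(future_step I)/H.
Qed.

Lemma used_not_failed k sigma w l : inv sigma -> l \in stUsed sigma ->
  l \notin stFail sigma -> l \notin stFail (run k sigma w).
Proof.
elim: k sigma => // k IH sigma I lU lF /=.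
suff [h1 h2] : l \in stUsed (step sigma w) /\ l \notin stFail (step sigma w).
  by apply: IH => //; exact: inv_step.
rewrite /step; case E : (stCur sigma) => [[[y idx] h]|].
  case sl : (slot _ _ _ _) => [f|]; last first.
    by have [_ -> _ ->] := advanceE sigma y idx h.
  have [_ -> _ ->] := execE sigma y idx h f (explored sigma y idx f (h f) w).
  split; first by rewrite inE lU orbT.
  case: hit_targets => // ; rewrite inE negb_or lF andbT.
  have [_ C _] := I; have [_ _ _ used _] := C _ _ _ E.
  by apply: contraTneq lU => ->; apply/negP => /used; rewrite ltnn.
case nE : (next _) => [[y d]|//].
by case: (stHd sigma _).
Qed.

Definition slab : seq V := boxseq
  (\row_j (if (j == i1) || (j == i2) then - (32 * L * (B%:Z + 3)) else - 2 * L))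
  (\row_j (if (j == i1) || (j == i2) then 32 * L * (B%:Z + 3) else 2 * L)).

Lemma zone_slab y d v : in_window B y \/ y = origin -> zone y d v -> v \in slab.
Proof.
move=> yW zv; have L0 := L_gt0 i12 mn; have := zone_near i12 mn zv.
have {}yW : -1 <= y.1 <= B%:Z /\ -1 <= y.2 <= B%:Z.
  by case: yW => [|->]; rewrite /in_window /=; lia.
have [[ya yb] [yc yd]] : (- L <= L * y.1 /\ L * y.1 <= L * B%:Z) /\ (- L <= L * y.2 /\ L * y.2 <= L * B%:Z).
  by split; split; nia.
rewrite /offset /ctr eqxx eq_sym (negbTE i12) eqxx => -[n1 n2].
have LB : 0 <= L * B%:Z by nia.
have E : 32 * L * (B%:Z + 3) = 32 * (L * B%:Z) + 96 * L by ring.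
rewrite mem_boxseq; apply/boxP => j; rewrite !mxE E.
move: (L * B%:Z) (L * y.1) (L * y.2) LB ya yb yc yd n1 n2 => X Y1 Y2 LB ya yb yc yd n1 n2.
have [->|j1] /= := eqVneq j i1; first by lia.
have [->|j2] /= := eqVneq j i2; first by lia.
by have [/(_ j j1 j2) + _] := zv; lia.
Qed.

Lemma sreg_slab sigma y idx h f v : inv sigma -> stCur sigma = Some (y, idx, h) ->
  slot y (stPd sigma y) idx h = Some f -> v \in sreg y f (h f) -> v \in slab.
Proof.
move=> I E sl vR; have [_ _ rz _] := ready i12 mn I E sl.
have [G C _] := I; have [yS _ _ _ _] := C _ _ _ E.
by apply: (zone_slab (y := y)); [left; exact: iStW G _ yS|exact: rz].
Qed.

Lemma layer_lt l : (l.2 < 32)%N -> (layer l < 129)%N.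
Proof. by rewrite /layer; case: odd; case: odd => /=; lia. Qed.

Definition stable sigma := stCur sigma = None /\ next sigma = None.

(** Beginning a site trades 34 for 33, and each of its steps, idle or not, lowers the second
    summand; a final or failed step drops it to 0. *)
Definition remaining sigma : nat :=
  (34 * count (fun z => z \notin stStarted sigma) (window B) +
   (if stCur sigma is Some (_, idx, _) then 33 - idx else 0))%N.

Lemma remaining_step sigma w : inv sigma -> stable sigma \/
  (remaining (step sigma w) < remaining sigma)%N.
Proof.
move=> I; rewrite /step /stable /remaining.
case E : (stCur sigma) => [[[y idx] h]|].
  right; have [_ C _] := I; have [_ _ idx32 _ _] := C _ _ _ E.
  have adv sg0 h' : stStarted sg0 = stStarted sigma ->
    (34 * count (fun z => z \notin stStarted (advance sg0 y idx h')) (window B) +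
      (if stCur (advance sg0 y idx h') is Some (_, i, _) then 33 - i else 0) <
     34 * count (fun z => z \notin stStarted sigma) (window B) + (33 - idx))%N.
    move=> sE; rewrite /advance; case: ifP => _ /=; rewrite sE; lia.
  case sl : (slot _ _ _ _) => [f|]; last exact: adv.
  rewrite /exec; case: hit_targets => [|c' cs]; last exact: adv.
  by rewrite /=; lia.
case nE : (next _) => [[y d]|]; last by left.
have [yW yS] := nextP nE; case: (stHd sigma _) => // h _; right => /=.
have H : (count (fun z => z \notin y :: stStarted sigma) (window B) <
  count (fun z => z \notin stStarted sigma) (window B))%N.
  apply: (@count_lt _ _ _ _ y) => [z| | |]; rewrite ?mem_window ?inE ?eqxx //.
  by rewrite negb_or => /andP[].
rewrite addn0; apply: (@leq_trans (34 * (count (fun z => z \notin y :: stStarted sigma) (window B)).+1)).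
  by rewrite mulnS addnC ltn_add2r.
by rewrite leq_mul2l.
Qed.

Lemma run_stable k sigma w : inv sigma -> (remaining sigma <= k)%N -> stable (run k sigma w).
Proof.
have fix_run k' sg0 : stable sg0 -> run k' sg0 w = sg0.
  move=> [s1 s2]; elim: k' => //= k' IH; suff -> : step sg0 w = sg0 by [].
  by rewrite /step s1 s2.
elim: k sigma => [|k IH] sigma I le.
  by have [//|] := remaining_step w I; lia.
have [st|lt] := remaining_step w I; first by rewrite fix_run.
by apply: IH; [exact: inv_step|lia].
Qed.

Lemma run_reach k sigma w v : inv sigma -> stA (run k sigma w) v ->
  reach adj (fun v => v \in slab /\ collapse 129 w v) (stA sigma) v.
Proof.
elim: k sigma => [|k IH] sigma I /=; first exact: reach_in.
move=> /(IH _ (inv_step i12 mn w I)) rv; apply: reach_trans.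
apply: reach_sub rv => // u; rewrite /step.
have same sg0 : stA sg0 = stA sigma -> stA sg0 u ->
    reach adj (fun v => v \in slab /\ collapse 129 w v) (stA sigma) u.
  by move=> ->; exact: reach_in.
case E : (stCur sigma) => [[[y idx] h]|]; last first.
  case: (next _) => [[y d]|]; last exact: same.
  by case: (stHd sigma _) => [h|]; exact: same.
case sl : (slot _ _ _ _) => [f|]; last first.
  by apply: same; have [_ _ ->] := advanceE sigma y idx h.
have [_ _ -> _] := execE sigma y idx h f (explored sigma y idx f (h f) w).
apply: reach_sub => // x [xR H]; split; first exact: sreg_slab I E sl xR.
have [_ C _] := I; have [_ _ idx32 _ _] := C _ _ _ E.
apply/hasP; case: H => -[_ wx].
  by exists (x, 0%N) => //; apply: map_f; rewrite mem_iota.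
by exists (x, layer (y, idx)) => //; apply: map_f; rewrite mem_iota /= add0n; exact: layer_lt.
Qed.

Definition failed_site (F : seq label) z := exists2 idx, (idx < 32)%N & (z, idx) \in F.

(** A stable exploration has no candidate left, so every window neighbour of a finished site was
    started, and a started site without heads owns a failed label. Heads lie within [7 * L] of their
    centre, hence are distinct for distinct sites. *)
Lemma run_outcome k w : (remaining (start m) <= k)%N ->
  let sigma := run k (start m) w in let got z := isSome (stHd sigma z) in
  [/\ in_window B (0, 0) -> got (0, 0) \/ failed_site (stFail sigma) (0, 0),
    forall z d, got z -> in_window B z -> in_window B (nb z d) ->
      got (nb z d) \/ failed_site (stFail sigma) (nb z d) &
    exists hd : site -> V, forall z, got z -> in_window B z ->
      reach adj (fun v => v \in slab /\ collapse 129 w v) (fun v => v \in cube m 0) (hd z) /\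
      forall z', hd z' = hd z -> got z' -> in_window B z' -> z' = z].
Proof.
move=> le sigma got.
have I0 : inv (start m) by exact: inv_start.
have I : inv sigma by exact: inv_run.
have [sc sn] : stable sigma by exact: run_stable.
have [G _ Dn] := I.
have L0 := L_gt0 i12 mn.
have started z d : got z -> in_window B (nb z d) -> got (nb z d) \/ failed_site (stFail sigma) (nb z d).
  move=> gz nW; suff /Dn[|H|[idx [h]]] : nb z d \in stStarted sigma; [by left|by right|by rewrite sc|].
  apply: contraT => nS; move: sn; rewrite /next.
  set cs := [seq _ <- _ | _] => cE.
  have : (nb z d, d) \in cs by rewrite mem_filter mem_candidates nW nS /= nbK andbT; exact: gz.
  by case: cs cE.
split.
- move=> W0; have := started origin (true, true); rewrite (_ : nb _ _ = (0, 0)) //.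
  by apply => //; exact: iHo G.
- by move=> z d gz _; exact: started.
exists (fun z => if stHd sigma z is Some h then h (stPd sigma z) else 0).
have hdP z : got z -> in_window B z -> exists2 h, stHd sigma z = Some h &
    head_ok i1 i2 m n (stA sigma) (stZ sigma z) z (stPd sigma z) (h (stPd sigma z)).
  rewrite /got; case E : (stHd sigma z) => [h|//] _ zW; exists h => //.
  apply: (iComp G E); first by move=> zo; rewrite zo origin_out in zW.
  by case: (stPd sigma z) => a []; rewrite /opp xpair_eqE eqxx.
move=> z gz zW; have [h E ok] := hdP z gz zW; rewrite E; split.
  apply: (run_reach I0 (k := k)); apply: (head_in ok).
  by apply/cubeP => i; rewrite subrr normr0.
move=> z' + gz' zW'; have [h' E' ok'] := hdP z' gz' zW'; rewrite E' => hE.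
have r7 x d c zx : head_ok i1 i2 m n (stA sigma) zx x d c ->
    ranges L 7 7 7 7 ((c 0 i1 - 12 * L) - 16 * (L * x.1)) (c 0 i2 - 16 * (L * x.2)).
  case=> _ ha hl _; have := hl _ (oax_neq i12 d); move: ha.
  have -> : (c 0 i1 - 12 * L) - 16 * (L * x.1) = offset x c i1.
    by rewrite /offset /ctr eqxx; lia.
  have -> : c 0 i2 - 16 * (L * x.2) = offset x c i2.
    by rewrite /offset /ctr eq_sym (negbTE i12) eqxx.
  by rewrite /along /ranges /ax /oax /sg; case: d {hl} => [[] []] /=; lia.
apply: (ranges_eq L0 (r7 _ _ _ _ ok')); rewrite hE; exact: r7 ok.
Qed.

Lemma targets_reg c i b bx : bx \in targets m n c i b -> {subset bx <= reg m n c i b}.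
Proof.
have [h1 h2 h3 h4 h5] := geo i12 mn.
move=> /mapP[c' /tcenP[Hi Hj] ->] v /cubeP vc; apply/regP; split.
  by have := vc i; move: Hi; rewrite /sg; case: (b i); lia.
by move=> j ji; have := vc j; have := Hj j ji; rewrite /sg; case: (b j); lia.
Qed.

Lemma hit_targetsE y f c A' :
  (hit_targets i1 i2 m n y f c A' = [::]) <-> ~ step_succ (stgt y f c) A'.
Proof.
split=> [hE [bx /mapP[c' c't ->] H]|nS].
  have : c' \in hit_targets i1 i2 m n y f c A'.
    by rewrite mem_filter c't andbT; apply/asboolP.
  by rewrite hE.
case hE : hit_targets => [//|c' cs]; case: nS.
have : c' \in hit_targets i1 i2 m n y f c A' by rewrite hE inE eqxx.
rewrite mem_filter => /andP[/asboolP H c't]; exists (cube m c') => //.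
by apply/mapP; exists c'.
Qed.

Variables (p del eps : R) (t0 : nat).
Hypotheses (p01 : 0 <= p < 1) (del01 : 0 <= del <= 1) (eps0 : 0 <= eps).

Definition bit_param (t : V * nat) : R := if t.2 == 0%N then p else del.
Local Notation q := bit_param.

Hypothesis good : forall c i (b : 'I_D -> bool),
  (1 - del) ^+ t0 + (1 - p) ^- t0 * Pr (fun=> p) (reg m n c i b)
    (fun w => ~ crosses adj (reg m n c i b) (fun v => v \in cube m c) (targets m n c i b) w)
    (fun=> false) <= eps.

Lemma prob_q : prob q.
Proof. by move=> t; rewrite /q; case: eqP => _ //; case/andP: p01 => -> /ltW ->. Qed.

Variables (s : seq (V * nat)).
Hypotheses (us : uniq s) (slab_s : forall v j, v \in slab -> (j < 129)%N -> (v, j) \in s).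

Lemma step_fail_eps sigma y idx h f w0 : inv sigma -> stCur sigma = Some (y, idx, h) ->
  slot y (stPd sigma y) idx h = Some f ->
  Pr q s (fun w => ~ step_succ (stgt y f (h f)) (explored sigma y idx f (h f) w)) w0 <= eps.
Proof.
move=> I E sl; have [rin rfresh rz _] := ready i12 mn I E sl.
have [G C _] := I; have [_ _ idx32 _ _] := C _ _ _ E.
apply: le_trans (good (h f) (ax i1 i2 f) (steer i1 i2 m n y f (h f))).
have /andP[p0 p1] := p01.
apply: (step_fail_le (S := fun v => v \in cube m (h f)) prob_q _ _ p1 _ (iAZ G) (iZA G) rin) => //.
- exact: boxseq_uniq.
- exact: targets_reg.
- by move=> bx v /mapP[c' c't ->] vc; exact: rfresh c't vc.
- by move=> bx u v /mapP[c' c't ->]; exact: boxseq_reach.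
- move=> v /(sreg_slab I E sl) vs; rewrite !slab_s //.
  exact: layer_lt.
Qed.

Lemma Pr_fail_le k sigma (Y : seq label) w0 : inv sigma -> uniq Y ->
  Pr q s (fun w => forall l, l \in Y -> l \in stFail (run k sigma w)) w0 <=
    eps ^+ count (fun l => l \notin stUsed sigma) Y.
Proof.
move=> I uY; elim: k sigma I => [|k IH] sigma I.
  have -> : Pr q s (fun w => forall l, l \in Y -> l \in stFail (run 0 sigma w)) w0 =
     ind (forall l, l \in Y -> l \in stFail sigma) by rewrite -[RHS](Ex_cst q s _ w0).
  case: asboolP => [H|_]; last by rewrite exprn_ge0.
  rewrite (@eq_in_count _ _ pred0) ?count_pred0 // => l /H lF.
  by have [G _ _] := I; rewrite (iFail G lF).
have stay sigma' : (forall w, step sigma w = sigma') -> stUsed sigma' = stUsed sigma ->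
  Pr q s (fun w => forall l, l \in Y -> l \in stFail (run k.+1 sigma w)) w0 <=
    eps ^+ count (fun l => l \notin stUsed sigma) Y.
  move=> sE <-; have I' : inv sigma' by rewrite -(sE (fun=> false)); exact: inv_step.
  apply: le_trans (IH _ I'); rewrite le_eqVlt; apply/orP; left; apply/eqP.
  by apply: eq_Pr => w /=; rewrite sE.
case E : (stCur sigma) => [[[y idx] h]|]; last first.
  case nE : (next sigma) => [[y d]|]; last first.
    by apply: (stay sigma) => // w; rewrite /step E nE.
  case hE : (stHd sigma (nb y (opp d))) => [h|]; last first.
    by apply: (stay sigma) => // w; rewrite /step E nE hE.
  by apply: (stay (begin sigma y d h)) => // w; rewrite /step E nE hE.
case sl : (slot y (stPd sigma y) idx h) => [f|]; last first.
  apply: (stay (advance sigma y idx h)); last by have [] := advanceE sigma y idx h.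
  by move=> w; rewrite /step E sl.
pose X w := explored sigma y idx f (h f) w.
pose g A' w : R := ind (forall l, l \in Y -> l \in stFail (run k (exec sigma y idx h f A') w)).
set c := count _ Y.
(* If the current label is in [Y], success rules the event out for good and failure leaves [c.-1]
   labels to pay for; a label outside [Y] costs nothing. *)
pose hh (A' : V -> Prop) : R := if (y, idx) \in Y then
  ind (~ step_succ (stgt y f (h f)) A') * eps ^+ c.-1 else eps ^+ c.
have [_ C _] := I; have [_ _ _ used _] := C _ _ _ E.
have nU : (y, idx) \notin stUsed sigma by apply/negP => /used; rewrite ltnn.
have -> : Pr q s (fun w => forall l, l \in Y -> l \in stFail (run k.+1 sigma w)) w0 =
    Ex q s (fun w => g (X w) w) w0.
  by apply: Ex_eq => w; rewrite /g /X /= /step E sl.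
apply: (@le_trans _ _ (Ex q s (fun w => hh (X w)) w0)); last first.
  rewrite /hh; case yY : ((y, idx) \in Y); last by rewrite (Ex_cst q s _ w0).
  have -> : Ex q s (fun w => ind (~ step_succ (stgt y f (h f)) (X w)) * eps ^+ c.-1) w0 =
     eps ^+ c.-1 * Pr q s (fun w => ~ step_succ (stgt y f (h f)) (X w)) w0.
    by rewrite -ExZ; apply: Ex_eq => w; rewrite mulrC.
  have c0 : (0 < c)%N by rewrite -has_count; apply/hasP; exists (y, idx).
  rewrite -[in leRHS](prednK c0) exprSr; apply: ler_wpM2l; first exact: exprn_ge0.
  exact: step_fail_eps.
apply: (@Ex_cond_le _ _ q s _ X (fun A' t => step_bits adj (sreg y f (h f)) (layer (y, idx))
   (revealed sigma) A' t)) => //.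
- exact: prob_q.
- by move=> w w' H; apply: explored_bits => t /H.
- move=> w w1 w2 H; rewrite /g; congr (_%:R); congr (nat_of_bool _).
  have -> : run k (exec sigma y idx h f (X w)) w1 = run k (exec sigma y idx h f (X w)) w2.
    apply: run_dep; first exact: inv_exec.
    by move=> t /(future_exec I E sl)[_]; exact: H.
  by [].
move=> w; have I' : inv (exec sigma y idx h f (X w)) by exact: inv_exec.
have [_ e2 _ e4] := execE sigma y idx h f (X w).
have IHw := IH _ I'; rewrite e2 in IHw; rewrite /hh.
have cE : count (fun l => l \notin (y, idx) :: stUsed sigma) Y = (c - ((y, idx) \in Y))%N.
  rewrite /c; elim: Y uY {stay hh g c IHw IH} => //= l Y IH /andP[lY uY]; rewrite IH //.
  rewrite !inE negb_or (eq_sym l); have [lE|/=] := eqVneq (y, idx) l.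
    by rewrite -lE in lY *; rewrite nU (negbTE lY) /= subn0 add0n add1n subn1.
  move=> yl; case: (boolP ((y, idx) \in Y)) => yY; last by rewrite !subn0.
  rewrite addnBA //; rewrite -has_count; apply/hasP; by exists (y, idx).
rewrite cE in IHw; case yY : ((y, idx) \in Y) IHw => IHw; last by rewrite subn0 in IHw; exact: IHw.
rewrite subn1 in IHw; case: (pselect (step_succ (stgt y f (h f)) (X w))) => sc.
  rewrite asboolF ?mul0r; last by move=> /(_ sc).
  rewrite -(Ex_cst q s 0 w0); apply: le_Ex; first exact: prob_q.
  move=> w'; rewrite /g asboolF // => /(_ _ yY) H.
  have : (y, idx) \notin stFail (run k (exec sigma y idx h f (X w)) w').
    apply: used_not_failed => //; first by rewrite e2 inE eqxx.
    rewrite e4; case hE : hit_targets => [|c' cs].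
      by have /hit_targetsE := hE.
    have [G _ _] := I; by apply: contra nU => /(iFail G).
  by rewrite H.
by rewrite asboolT // mul1r.
Qed.

End ExplorationLaw.

Lemma slab_bounds (n m : nat) (B : int) (b : bool) (x : int) : 0 <= B -> `|x| <= m%:Z ->
  (if b then - (32 * stride m n * (B + 3)) else - 2 * stride m n) <= x <=
  (if b then 32 * stride m n * (B + 3) else 2 * stride m n).
Proof.
move=> B0 xm; have L0 : 0 <= stride m n * B by rewrite mulr_ge0 // /stride; lia.
have -> : 32 * stride m n * (B + 3) = 32 * (stride m n * B) + 96 * stride m n by ring.
by move: (stride m n * B) L0 => X; rewrite /stride; case: b; lia.
Qed.

(** * Percolation in slabs *)

Section SlabPercolation.
Context {R : realFieldType} {D : nat}.
Variables (i1 i2 : 'I_D) (m n : nat).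
Hypotheses (i12 : i1 != i2) (mn : (4 * m + 6 <= n)%N).
Local Notation V := 'rV[int]_D.
Local Notation adj := (@Zd_adj D).
Variables (p del : R) (t0 : nat).
Hypotheses (p01 : 0 <= p < 1) (del01 : 0 <= del <= 1).
Hypothesis good : forall c i (b : 'I_D -> bool),
  (1 - del) ^+ t0 + (1 - p) ^- t0 * Pr (fun=> p) (reg m n c i b)
    (fun w => ~ crosses adj (reg m n c i b) (fun v => v \in cube m c) (targets m n c i b) w)
    (fun=> false) <= (2304 * 4)%:R^-1.
Variable K : nat.
Local Notation B := (3 ^ K)%N.
Local Notation slab := (slab i1 i2 m n B).
Local Notation q := (bit_param p del : V * nat -> R).

Let bits := flatten (map (@layers V 129) slab).

Let bits_uniq : uniq bits.
Proof. exact/flatten_layers_uniq/boxseq_uniq. Qed.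

Let slab_bits v j : v \in slab -> (j < 129)%N -> (v, j) \in bits.
Proof. exact: mem_flatten_layers. Qed.

Local Notation inv := (@inv D i1 i2 m n B).
Let k := remaining B (start m : @state D).
Let final w := run i1 i2 m n B k (start m) w.

Let st (x : nat * nat) : site := (x.1%:Z, x.2%:Z).

Let F w i j := failed_site (stFail (final w)) (st (i, j)).

Let large_cluster w : (forall j, (j <= K)%N -> ~ bad (F w) j 0 0) ->
  reaches_many adj (2 ^ K) (fun v => v \in slab /\ collapse 129 w v) (fun v => v \in cube m 0).
Proof.
move=> nbad; have := run_outcome i12 mn w (leqnn k); rewrite -/(final w) /=.
set sigma := final w; move=> [H0 Hn [hd Hh]].
have B0 : (0 < B)%N by rewrite expn_gt0.
pose G x := isSome (stHd sigma (st x)) : Prop.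
have winE i j : (i < B)%N -> (j < B)%N -> in_window B (st (i, j)).
  by move=> iB jB; rewrite /in_window /= !ltz_nat iB jB.
have G0 : G (0, 0)%N.
  have [//|f0] := H0 (winE 0%N 0%N B0 B0).
  by case: (nbad 0%N (leq0n _)).
have Gx i j : (i.+1 < B)%N -> (j < B)%N ->
  (G (i, j) -> G (i.+1, j) \/ F w i.+1 j) /\ (G (i.+1, j) -> G (i, j) \/ F w i j).
  move=> iB jB; have iB' : (i < B)%N by exact: ltnW.
  have E1 : nb (st (i, j)) (true, true) = st (i.+1, j) by rewrite /st /nb /sg /= intS addrC.
  have E2 : nb (st (i.+1, j)) (true, false) = st (i, j) by rewrite /st /nb /sg /= intS addrAC subrr add0r.
  split=> g.
    by have := Hn _ (true, true) g (winE _ _ iB' jB); rewrite E1; apply; exact: winE.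
  by have := Hn _ (true, false) g (winE _ _ iB jB); rewrite E2; apply; exact: winE.
have Gy i j : (i < B)%N -> (j.+1 < B)%N ->
  (G (i, j) -> G (i, j.+1) \/ F w i j.+1) /\ (G (i, j.+1) -> G (i, j) \/ F w i j).
  move=> iB jB; have jB' : (j < B)%N by exact: ltnW.
  have E1 : nb (st (i, j)) (false, true) = st (i, j.+1) by rewrite /st /nb /sg /= intS addrC.
  have E2 : nb (st (i, j.+1)) (false, false) = st (i, j) by rewrite /st /nb /sg /= intS addrAC subrr add0r.
  split=> g.
    by have := Hn _ (false, true) g (winE _ _ iB jB'); rewrite E1; apply; exact: winE.
  by have := Hn _ (false, false) g (winE _ _ iB jB); rewrite E2; apply; exact: winE.
have [spread _] := core_spread Gx Gy K.
have nbK : ~ bad (F w) K 0 0 by exact: nbad.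
have allG : forall x, core (F w) K 0 0 x -> G x.
  by apply: (spread 0%N 0%N _ _ nbK (0, 0)%N) => //; rewrite ?muln1 //; exact: core_origin.
have [l [ul sl lc]] := core_large nbK.
have win x : x \in l -> in_window B (st x).
  move=> /lc/core_div[/eqP e1 /eqP e2]; case: x e1 e2 => i j /= e1 e2.
  rewrite -!leqn0 leqNgt divn_gt0 // -ltnNge in e1 *.
  rewrite -!leqn0 leqNgt divn_gt0 // -ltnNge in e2 *.
  exact: winE.
have hdl x : x \in l -> _ := fun xl => Hh (st x) (allG x (lc x xl)) (win x xl).
exists [seq hd (st x) | x <- l]; split.
- rewrite map_inj_in_uniq // => x y xl yl E.
  have [_ /(_ (st x) E (allG x (lc x xl)) (win x xl))] := hdl y yl.
  by case: (x) (y) => [a b] [a' b'] [] -> ->.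
- by rewrite size_map.
- by move=> _ /mapP[x xl ->]; have [] := hdl x xl.
Qed.

Let eps : R := (2304 * 4)%:R^-1.

(** A union bound over at most [2304 ^ (2 ^ j)] witnesses with [2 ^ j] labels each. Since
    [2304 * eps] is 1/4, this gives [4 ^- (2 ^ j)], and [j < 2 ^ j]. *)
Let Pr_bad j : Pr q bits (fun w => bad (F w) j 0 0) (fun=> false) <= 4%:R^-1 ^+ j.+1.
Proof.
have pq : prob q by exact: prob_q p01 del01.
have eps0 : 0 <= eps by rewrite invr_ge0 ler0n.
apply: (@le_trans _ _ (Pr q bits (fun w => exists2 Y, Y \in witnesses j 0 0 &
    forall l, l \in Y -> l \in stFail (final w)) (fun=> false))).
  by apply: le_Pr => // w; apply: bad_witness => a b.
apply: (le_trans (Pr_exists _ _ _ _ pq)).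
apply: (@le_trans _ _ (\sum_(Y <- witnesses j 0 0) eps ^+ (2 ^ j))).
  rewrite big_seq [leRHS]big_seq; apply: ler_sum => Y /witnessesP[uY sY _].
  have := Pr_fail_le i12 mn p01 del01 eps0 good bits_uniq slab_bits k (fun=> false)
     (inv_start B i12 mn) uY.
  by rewrite (eq_count (a2 := xpredT)) // count_predT sY.
rewrite big_const_seq count_predT iter_addr_0 -[_ *+ size _]mulr_natl.
apply: (@le_trans _ _ ((2304 ^ (2 ^ j))%:R * eps ^+ (2 ^ j))).
  apply: ler_wpM2r; first exact: exprn_ge0.
  by rewrite ler_nat -(size_witnesses j 0 0) leq_pmull.
rewrite natrX -exprMn /eps.
have n0 : 2304%:R != 0 :> R by rewrite pnatr_eq0.
have -> : 2304%:R * (2304 * 4)%:R^-1 = 4%:R^-1 :> R.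
  by rewrite natrM invfM mulrA (mulfV n0) mul1r.
apply: ler_wiXn2l; rewrite ?invr_ge0 //; last exact: ltn_expl.
by rewrite invf_le1 // ler1n.
Qed.

Let half : 1 / 2%:R <= Pr q bits (fun w => reaches_many adj (2 ^ K)
   (fun v => v \in slab /\ collapse 129 w v) (fun v => v \in cube m 0)) (fun=> false).
Proof.
have pq : prob q by exact: prob_q p01 del01.
have sumE : \sum_(j <- iota 0 K.+1) 4%:R^-1 ^+ j.+1 <= 1 / 2%:R :> R.
  have h4 : 0 <= 4%:R^-1 :> R by rewrite invr_ge0.
  (* Subtracting a multiple of the last term lets the induction close; the infinite sum would be
     1/3. *)
  suff : \sum_(j <- iota 0 K.+1) 4%:R^-1 ^+ j.+1 <= 1 / 2%:R - 1 / 2%:R * 4%:R^-1 ^+ K.+1 :> R.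
    move=> /le_trans; apply; rewrite lerBlDr lerDl.
    by apply: mulr_ge0; [exact: divr_ge0|exact: exprn_ge0].
  elim: (K.+1) => [|j IH]; first by rewrite big_nil expr0 mulr1 subrr.
  rewrite -[in leLHS]addn1 iotaD big_cat /= big_seq1 add0n.
  have -> : (4%:R^-1 ^+ j.+1 : R) = 4%:R^-1 * 4%:R^-1 ^+ j by rewrite exprS.
  have := exprn_ge0 j h4; move: (4%:R^-1 ^+ j) IH => x IH x0.
  by move: (\sum_(_ <- _) _) IH => S IH; lra.
have bound : Pr q bits (fun w => exists2 j, j \in iota 0 K.+1 & bad (F w) j 0 0) (fun=> false)
    <= 1 / 2%:R.
  apply: le_trans sumE; apply: le_trans (Pr_exists _ _ _ _ pq) _.
  by apply: ler_sum => j _; exact: Pr_bad.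
have c2 : 1 / 2%:R <= Pr q bits (fun w => ~ exists2 j, j \in iota 0 K.+1 & bad (F w) j 0 0) (fun=> false).
  by rewrite PrC; lra.
apply: (le_trans c2); apply: le_Pr => // w H; apply: large_cluster => j jK bj.
by apply: H; exists j => //; rewrite mem_iota.
Qed.

(* After the exploration all layers are forgotten and only the union of the
   open bits of a site is kept. *)
Lemma slab_percolates (p' : R) : p' <= 1 -> 1 - (1 - p) * (1 - del) ^+ 128 <= p' ->
  p' ^+ size (@cube D m 0) / 2%:R <= Pr (fun=> p') slab (fun w => w 0 /\
    reaches_many adj (2 ^ K) (fun v => v \in slab /\ w v) (eq 0)) (fun=> false).
Proof.
move=> p'1 p'p.
have [p0 p1] := andP p01; have [d0 d1] := andP del01.
have D1 : 0 <= (1 - del) ^+ 128 <= 1.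
  by rewrite exprn_ge0 ?exprn_ile1 //; lra.
have q0 : 0 <= 1 - (1 - p) * (1 - del) ^+ 128.
  by move/andP: D1 => [D0 D1]; rewrite subr_ge0 mulr_ile1 //; lra.
have p'0 : 0 <= p' by exact: le_trans p'p.
have pr' : prob (fun _ : V => p') by move=> v; rewrite p'0 p'1.
pose E (w : V -> bool) := reaches_many adj (2 ^ K) (fun v => v \in slab /\ w v) (fun v => v \in cube m 0).
have mE : incr (fun w : V -> bool => ind (E w) : R).
  move=> w w' ww; apply: ind_le; apply: reaches_many_sub => // v [vs /ww wv].
  by split.
have us : uniq slab by exact: boxseq_uniq.
have H1 : 1 / 2%:R <= Pr (fun=> p') slab E (fun=> false).
  apply: (le_trans half).
  have := Ex_collapse q 129 (fun w => ind (E w) : R) (fun=> false) us.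
  rewrite /Pr /bits => ->.
  have -> : collapse 129 (fun _ : V * nat => false) = fun=> false.
    by apply/funext => v; rewrite /collapse; apply/hasP => -[].
  have qv (v : V) : 1 - \prod_(t <- layers 129 v) (1 - q t) = 1 - (1 - p) * (1 - del) ^+ 128.
    congr (1 - _); rewrite big_map /layers (_ : iota 0 129 = 0%N :: iota 1 128) // big_cons.
    congr (_ * _); rewrite big_seq (eq_bigr (fun=> 1 - del)).
      by rewrite -big_seq big_const_seq count_predT iter_mulr_1 size_iota.
    by move=> j; rewrite mem_iota /bit_param; case: j.
  apply: Ex_le_param => //.
  - by move=> v; rewrite qv q0 /= (le_trans p'p).
  - by move=> v; rewrite qv.
pose A (w : V -> bool) := all w (cube m 0).
have cs : {subset cube m 0 <= slab}.
  move=> v /cubeP vc; rewrite mem_boxseq; apply/boxP => j; rewrite !mxE.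
  have := vc j; rewrite mxE subr0; apply: slab_bounds => //; exact: leq0n.
have H2 : Pr (fun=> p') slab A (fun=> false) = p' ^+ size (@cube D m 0).
  have -> : Pr (fun=> p') slab A (fun=> false) =
     Ex (fun=> p') slab (fun w => (fun b : bool => b%:R) (all w (cube m 0))) (fun=> false).
    by apply: Ex_eq => w; rewrite /A asboolb.
  rewrite (Ex_all (fun=> p') (fun b : bool => b%:R)) //; last exact: cube_uniq.
  by rewrite mulr1 mulr0 addr0 big_const_seq count_predT iter_mulr_1.
have mA : incr (fun w : V -> bool => ind (A w) : R).
  by move=> w w' ww; apply: ind_le => /allP Aw; apply/allP => v /Aw/ww.
(* The exploration treats the initial seed as open for free. Opening it costs the factor
   [p' ^+ size (cube m 0)], since both events are increasing. *)
have := Harris slab (fun=> false) pr' mA mE.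
have -> : Ex (fun=> p') slab (fun w => ind (A w)) (fun=> false) = p' ^+ size (@cube D m 0).
  exact: H2.
move=> H3; apply: (@le_trans _ _ (p' ^+ size (@cube D m 0) * Pr (fun=> p') slab E (fun=> false))).
  by apply: ler_wpM2l; [exact: exprn_ge0|move: H1; rewrite div1r].
apply: (le_trans H3); apply: le_Ex => // w; rewrite -natrM ler_nat.
case: asboolP => // Aw; case: asboolP => // Ew; rewrite asboolT //.
move/allP: Aw => Aw.
have c0 : 0 \in @cube D m 0 by apply/cubeP => i; rewrite subrr normr0.
split; first exact: Aw.
case: Ew => l [ul sl H]; exists l; split=> // v /H rv.
apply: reach_trans; apply: reach_sub rv => // u uc.
apply: reach_sub (boxseq_reach c0 uc) => // x xc.
by split; [exact: cs|exact: Aw].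
Qed.

End SlabPercolation.

(** * Seeds are reached from large cubes *)

Section Rim.
Context {D : nat}.
Local Notation V := 'rV[int]_D.
Local Notation adj := (@Zd_adj D).
Implicit Types (w : V -> bool) (u v x : V).

Definition rim (M N : nat) w : seq V :=
  [seq v <- ball N.+1 | (v \notin ball N) &&
    `[< reach adj (fun u => u \in ball N.+1 /\ w u) (fun u => u \in ball M) v >]].

Definition hit M N w : Prop := exists v, v \in rim M N w.

Lemma rimP M N w v : v \in rim M N w <-> [/\ v \in ball N.+1, v \notin ball N &
  reach adj (fun u => u \in ball N.+1 /\ w u) (fun u => u \in ball M) v].
Proof.
rewrite mem_filter; split=> [/andP[/andP[vN /asboolP rv] v1]|[v1 vN rv]]; first by split.
by rewrite v1 vN andbT; apply/asboolP.
Qed.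

Lemma rim_dep M N w w' : {in ball N.+1, w =1 w'} -> rim M N w = rim M N w'.
Proof.
move=> H; apply: eq_filter => v; congr (_ && _); apply: asbool_equiv_eq.
by split; apply: reach_sub => // u [uN wu]; split=> //; move: wu; rewrite H.
Qed.

Lemma Zd_adj_shift x u v : adj (x + u) (x + v) = adj u v.
Proof.
congr (_ == _); apply: eq_bigr => i _.
by rewrite !mxE opprD addrACA subrr add0r.
Qed.

Lemma ball_adj N u v : u \in ball N -> adj u v -> v \in ball N.+1.
Proof.
move=> /ballP uN uv; apply: in_ball => i.
by have := uN i; have := Zd_adj_dist i uv; lia.
Qed.

Lemma exit_hit M N (O : V -> Prop) w v : (M <= N)%N -> (forall u, O u -> w u) ->
  reach adj O (fun u => u \in ball M) v -> v \notin ball N -> hit M N w.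
Proof.
move=> MN Ow rv vN; have BM := ball_sub (D := D) MN.
have [rv'|[x [u [rx xu uN Ou]]]] := reach_exit (B := ball N) BM rv.
  have : v \in ball N by case: (reach_region rv') => [/BM|[]].
  by rewrite (negbTE vN).
have NN : {subset @ball D N <= ball N.+1} by apply: ball_sub.
have xN : x \in ball N by case: (reach_region rx) => [/BM|[]].
have u1 : u \in ball N.+1 by exact: ball_adj xN xu.
exists u; apply/rimP; split=> //.
apply: reach_step xu _; last by split=> //; exact: Ow.
by apply: reach_sub rx => // y [yN /Ow]; split=> //; exact: NN.
Qed.

Lemma hit_le M N N' w : (M <= N)%N -> (N <= N')%N -> hit M N' w -> hit M N w.
Proof.
move=> MN NN [v /rimP[_ vN rv]]; apply: exit_hit rv _ => // [u []//|].
by apply: contra vN; exact: ball_sub.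
Qed.

Lemma hit_shift M N r x w : x \in ball r -> (M + r <= N)%N ->
  hit M (N + r) (fun v => w (x + v)) -> hit (M + r) N w.
Proof.
move=> /ballP xr MN [v /rimP[_ vN rv]].
apply: (exit_hit (O := w) (v := x + v)) => //.
  apply: reach_map rv => [u u'|u []//|u /ballP uM].
    by rewrite Zd_adj_shift.
  by apply: in_ball => i; rewrite mxE; have := uM i; have := xr i; move: (x 0 i) (u 0 i) => a b; lia.
apply: contra vN => /ballP xv; apply: in_ball => i.
by have := xv i; have := xr i; rewrite mxE; move: (x 0 i) (v 0 i) => a b; lia.
Qed.

End Rim.

(** * A zero-one law in finite volume *)

Section ZeroOne.
Context {R : realType} {D : nat}.
Variables (p : R) (i0 : 'I_D).
Hypothesis p01 : 0 <= p <= 1.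
Local Notation V := 'rV[int]_D.
Local Notation PP s A := (Pr (fun _ : V => p) s A (fun=> false)).

Let hp : prob (fun _ : V => p). Proof. by move=> v; exact: p01. Qed.

Definition hitp M N : R := PP (ball N.+1) (@hit D M N).

Lemma hit_dep M N (w1 w2 : V -> bool) : {in ball N.+1, w1 =1 w2} -> hit M N w1 -> hit M N w2.
Proof. by move=> H [v]; rewrite (rim_dep M H) => vr; exists v. Qed.

Lemma hitp_shift M N (x : V) (s : seq V) : uniq s -> {subset map (fun v : V => x + v) (ball N.+1) <= s} ->
  PP s (fun w => hit M N (w \o (fun v : V => x + v))) = hitp M N.
Proof.
move=> us ss; apply: Pr_iso => //; [exact: hit_dep|exact: ball_uniq].
Qed.

Lemma hitp_widen M N (s : seq V) : uniq s -> {subset ball N.+1 <= s} -> PP s (hit M N) = hitp M N.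
Proof.
move=> us ss; rewrite -(@hitp_shift M N 0 s) //.
  by apply: eq_Pr => w; split; apply: hit_dep => v _ /=; rewrite add0r.
by move=> v /mapP[u us' ->]; rewrite add0r ss.
Qed.

(* A large box contains two remote translates of the box of radius M, whose arms
   are independent up to distance N0; an arm that is that long is likely to
   continue up to distance N1. *)
Lemma two_chances M N0 N1 (a b : R) : (M <= N0)%N -> a <= hitp M N0 <= b ->
  (forall N, (M <= N)%N -> a <= hitp M N) -> (M + (2 * N0 + 4) <= N1)%N ->
  1 - (1 - a) ^+ 2 - (b - a) - (b - a) <= hitp (M + (2 * N0 + 4)) N1.
Proof.
set r := (2 * N0 + 4)%N => MN0 /andP[aN0 N0b] aN MN1.
pose x : V := (r%:Z) *: unitv i0.
have xE j : x 0 j = if j == i0 then r%:Z else 0.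
  by rewrite mxE unitvE; case: eqP; rewrite ?mulr1 ?mulr0.
have xr : x \in ball r by apply: in_ball => j; rewrite xE; case: eqP; lia.
have r0 : 0 \in @ball D r by apply: in_ball => j; rewrite mxE normr0.
pose N2 := (N1 + r)%N; pose s := @ball D (N2.+1 + r)%N.
have us : uniq s by exact: ball_uniq.
have sub y N : y \in ball r -> (N <= N2)%N -> {subset map (fun v : V => y + v) (ball N.+1) <= s}.
  move=> /ballP yr NN _ /mapP[v /ballP vN ->]; apply: in_ball => j; rewrite mxE.
  by have := vN j; have := yr j; move: (y 0 j) (v 0 j) => yj vj; lia.
pose A y (w : V -> bool) := hit M N0 (w \o (fun v : V => y + v)).
pose B y (w : V -> bool) := hit M N2 (w \o (fun v : V => y + v)).
have BA y w : B y w -> A y w by apply: hit_le => //; rewrite /N2; lia.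
have PA y : y \in ball r -> PP s (A y) = hitp M N0.
  by move=> yr; apply: hitp_shift => //; apply: sub => //; rewrite /N2; lia.
have PB y : y \in ball r -> PP s (B y) = hitp M N2.
  by move=> yr; apply: hitp_shift => //; apply: sub.
have BH y w : y \in ball r -> B y w -> hit (M + r) N1 w by move=> yr Bw; exact: (hit_shift yr MN1 Bw).
have diff y : y \in ball r -> PP s (fun w => A y w /\ ~ B y w) <= b - a.
  move=> yr; rewrite Pr_diff; last exact: BA.
  rewrite PA // PB //; have := aN N2; rewrite /N2; have -> : (M <= N1 + r)%N by lia.
  by move=> /(_ isT); lra.
(* The centres are [2 * N0 + 4] apart, whereas each event reads only a ball of radius [N0 + 1]. *)
have indep : PP s (fun w => ~ A 0 w /\ ~ A x w) = (1 - hitp M N0) ^+ 2.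
  pose I (y v : V) := v - y \in ball N0.+1.
  have dI y (w1 w2 : V -> bool) : (forall t, I y t -> w1 t = w2 t) -> A y w1 -> A y w2.
    by move=> H; apply: hit_dep => v vN /=; apply: H; rewrite /I addrAC subrr add0r.
  rewrite (@Pr_and_indep _ _ _ s (fun w => ~ A 0 w) (fun w => ~ A x w) (I 0) (I x)).
  - by rewrite (PrC _ s (A 0)) (PrC _ s (A x)) !PA.
  - by move=> w1 w2 H nA /(dI 0 w2 w1) A2; apply: nA; apply: A2 => t /H.
  - by move=> w1 w2 H nA /(dI x w2 w1) A2; apply: nA; apply: A2 => t /H.
  - move=> v /ballP/(_ i0) + /ballP/(_ i0); rewrite !mxE eqxx /= eqxx /r; lia.
have H1 : PP s (fun w => ~ hit (M + r) N1 w) <= (1 - hitp M N0) ^+ 2 + (b - a) + (b - a).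
  rewrite -indep; apply: le_trans (lerD (lerD (lexx _) (diff 0 r0)) (diff x xr)).
  apply: le_trans (lerD (Pr_or _ _ _ _ hp) (lexx _)).
  apply: le_trans (Pr_or _ _ _ _ hp); apply: le_Pr => // w nH.
  have n0 : ~ B 0 w by move=> /(BH 0 w r0).
  have nx : ~ B x w by move=> /(BH x w xr).
  have [A0|nA0] := pselect (A 0 w); first by left; right.
  by have [Ax|nAx] := pselect (A x w); [right|left; left].
move: H1; rewrite (PrC _ s (hit (M + r) N1)) (@hitp_widen (M + r)%N N1 s) //; last first.
  by apply: ball_sub; rewrite /N2; lia.
have : (1 - hitp M N0) ^+ 2 <= (1 - a) ^+ 2.
  rewrite ler_pXn2r // ?nnegrE; last 2 first.
  - by rewrite subr_ge0; exact: Pr_le1.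
  - by rewrite subr_ge0; apply: le_trans aN0 _; exact: Pr_le1.
  - by lra.
lra.
Qed.

(** Let [a0] be the supremum of the arm probabilities that some cube attains uniformly in the
    distance. If [a0 < 1], two independent chances beat it, because [1 - (1 - a0) ^+ 2] exceeds
    [a0]. *)
Lemma zero_one (th : R) : 0 < th -> (forall N, th <= hitp 0 N) ->
  forall eta : R, 0 < eta -> exists M, forall N, (M <= N)%N -> 1 - eta <= hitp M N.
Proof.
move=> th0 thN.
pose A : set R := [set a | exists M, forall N, (M <= N)%N -> a <= hitp M N]%classic.
have Ath : A th by exists 0%N.
have A1 a : A a -> a <= 1.
  by move=> [M H]; apply: le_trans (H M (leqnn M)) _; exact: Pr_le1.
have hsA : has_sup A by split; [exists th|exists 1 => a /A1].
set a0 := sup A.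
have ath : th <= a0 by apply: ub_le_sup => //; case: hsA.
have a01 : a0 <= 1 by apply: ge_sup; [exists th|move=> a /A1].
suff a0E : 1 <= a0.
  move=> eta eta0; have [a Aa ae] : exists2 a, A a & a0 - eta < a.
    exact: sup_adherent.
  have [M H] := Aa; exists M => N /H; lra.
rewrite leNgt; apply/negP => a1.
(* The gain [a0 * (1 - a0)] is at least [8 * dl]. The losses are at most [3 * dl] from squaring and
   [2 * dl] from each of the two interrupted arms, 7 in all. *)
pose dl := (1 - a0) * th / 8%:R.
have dl0 : 0 < dl by rewrite /dl divr_gt0 // mulr_gt0 // subr_gt0.
have dl1 : dl <= 1.
  rewrite /dl ler_pdivrMr // mul1r; apply: le_trans (_ : 1 * 1 <= _); last by lra.
  apply: ler_pM; lra.
have dlE : 8%:R * dl = (1 - a0) * th by rewrite /dl; field.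
have [a [M H] aa] : exists2 a, A a & a0 - dl < a by exact: sup_adherent.
have aA : a <= a0 by apply: ub_le_sup; [case: hsA|exists M].
have [N0 MN0 N0b] : exists2 N0, (M <= N0)%N & hitp M N0 <= a0 + dl.
  apply: contrapT => nE; have : a0 + dl <= a0.
    apply: ub_le_sup; [by case: hsA|exists M => N MN].
    rewrite leNgt; apply/negP => lt; apply: nE; exists N => //; exact: ltW.
  lra.
have Ab : A (1 - (1 - a) ^+ 2 - (a0 + dl - a) - (a0 + dl - a)).
  exists (M + (2 * N0 + 4))%N => N1 N1M; apply: two_chances => //.
  by rewrite H //=.
have le0 : 1 - (1 - a) ^+ 2 - (a0 + dl - a) - (a0 + dl - a) <= a0.
  by apply: ub_le_sup; [case: hsA|].
have s1 : (1 - a) ^+ 2 <= (1 - a0 + dl) ^+ 2 by rewrite ler_pXn2r // ?nnegrE; lra.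
have s2 : (1 - a0 + dl) ^+ 2 <= (1 - a0) ^+ 2 + 3 * dl.
  rewrite sqrrD -addrA lerD2l; nra.
have s3 : (1 - a0) ^+ 2 <= (1 - a0) - (1 - a0) * th.
  have : 0 <= (1 - a0) * (a0 - th) by rewrite mulr_ge0 ?subr_ge0.
  by rewrite expr2; lra.
rewrite -dlE in s3; lra.
Qed.

End ZeroOne.

Lemma prodr_const_seq (R : pzRingType) (T : Type) (s : seq T) (c : R) :
  \prod_(t <- s) c = c ^+ size s.
Proof. by rewrite big_const_seq count_predT iter_mulr_1. Qed.

(** Otherwise the sequence would lose [c] at every step and become negative. *)
Lemma small_drop (R : realType) (u : nat -> R) (c : R) : (forall n, 0 <= u n) -> 0 < c ->
  exists n, u n - c <= u n.+1.
Proof.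
move=> u0 c0; apply: contrapT => /forallNP nE.
have dec j : u j <= u 0%N - j%:R * c.
  elim: j => [|j IH]; first by rewrite mul0r subr0.
  have /negP := nE j; rewrite -ltNge -natr1 mulrDl mul1r; lra.
have hi : u 0%N / c < (Num.bound (u 0%N / c))%:R.
  by apply: archi_boundP; rewrite divr_ge0 // ltW.
move: hi (dec (Num.bound (u 0%N / c))) (u0 (Num.bound (u 0%N / c))).
rewrite ltr_pdivrMr //; lra.
Qed.

Lemma small_expr (R : realType) (x e : R) : 0 <= x < 1 -> 0 < e -> exists t, x ^+ t <= e.
Proof.
move=> /andP[x0 x1] e0; have x1' : 0 < 1 - x by rewrite subr_gt0.
have [|t] := @small_drop _ (fun t => x ^+ t) ((1 - x) * e) _ (mulr_gt0 x1' e0).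
  by move=> t; exact: exprn_ge0.
rewrite exprS => H; exists t; rewrite -(ler_pM2l x1'); lra.
Qed.

(** * Few contact points on a sphere are unlikely *)

Section FewHits.
Context {R : realType} {D : nat}.
Variables (p : R).
Hypothesis p01 : 0 <= p < 1.
Local Notation V := 'rV[int]_D.
Local Notation adj := (@Zd_adj D).
Local Notation PP s A := (Pr (fun _ : V => p) s A (fun=> false)).
Local Notation hitp := (@hitp R D p).

Let p0 : 0 <= p. Proof. by case/andP: p01. Qed.
Let p1 : p < 1. Proof. by case/andP: p01. Qed.
Let p01' : 0 <= p <= 1. Proof. by rewrite p0 ltW. Qed.
Let hp : prob (fun _ : V => p). Proof. by move=> v; exact: p01'. Qed.

Definition nbrs (x : V) : seq V :=
  [seq x + unitv i | i <- ord_enum D] ++ [seq x - unitv i | i <- ord_enum D].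

Lemma mem_nbrs x u : adj x u -> u \in nbrs x.
Proof.
move=> /Zd_adjP[i [->|->]]; rewrite mem_cat.
  by rewrite (map_f (fun i => x + unitv i)) ?mem_ord_enum.
by rewrite orbC (map_f (fun i => x - unitv i)) ?mem_ord_enum.
Qed.

Lemma nbrs_adj x u : u \in nbrs x -> adj x u.
Proof. by rewrite mem_cat => /orP[] /mapP[i _ ->]; [exact: Zd_adjD|exact: Zd_adjB]. Qed.

Lemma size_nbrs x : size (nbrs x) = (2 * D)%N.
Proof.
have E : size (ord_enum D) = D by rewrite -(size_map val) val_ord_enum size_iota.
by rewrite size_cat !size_map E mul2n addnn.
Qed.

Definition outer (n : nat) (xs : seq V) : seq V :=
  undup [seq u <- flatten (map nbrs xs) | u \notin ball n].

Lemma size_outer n xs : (size (outer n xs) <= 2 * D * size xs)%N.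
Proof.
apply: (leq_trans (size_undup _)); rewrite size_filter; apply: (leq_trans (count_size _ _)).
by elim: xs => //= x xs IH; rewrite size_cat size_nbrs mulnS leq_add2l.
Qed.

Lemma no_outer_hit M n (w : V -> bool) : (M <= n)%N ->
  ~~ has w (outer n.+1 (rim M n w)) -> ~ hit M n.+1 w.
Proof.
move=> Mn /hasPn H [v /rimP[_ vN rv]].
have BM : {subset @ball D M <= ball n.+1} by apply: ball_sub; exact: leqW.
have [rv'|[x [u [rx xu uN [_ wu]]]]] := reach_exit (B := ball n.+1) BM rv.
  by move: vN; case: (reach_region rv') => [/BM ->|[->]].
have xB : x \in ball n.+1 by case: (reach_region rx) => [/BM|[]].
have xn : x \notin ball n by apply: contra uN => xn; exact: ball_adj xn xu.
have : u \in outer n.+1 (rim M n w).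
  rewrite mem_undup mem_filter uN; apply/flattenP; exists (nbrs x); last exact: mem_nbrs.
  apply: map_f; apply/rimP; split=> //.
  by apply: reach_sub rx => // y [yB [_ wy]].
by move=> /H; rewrite wu.
Qed.

(* Closing the outer neighbours of at most k hit points prevents all later hits. *)
Lemma few_hits_drop M n k : (M <= n)%N ->
  (1 - p) ^+ (2 * D * k) * PP (ball n.+1) (fun w => (0 < size (rim M n w) <= k)%N) <=
    hitp M n - hitp M n.+1.
Proof.
move=> Mn; pose s := @ball D n.+2; have us : uniq s by exact: ball_uniq.
have sub1 : {subset @ball D n.+1 <= s} by exact: ball_sub.
pose c (xs : seq V) := (0 < size xs <= k)%N.
pose g (xs : seq V) (w : V -> bool) : R :=
  if c xs then (~~ has w (outer n.+1 xs))%:R else 0.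
pose h (xs : seq V) : R := if c xs then (1 - p) ^+ (2 * D * k) else 0.
have -> : hitp M n - hitp M n.+1 = PP s (fun w => hit M n w /\ ~ hit M n.+1 w).
  rewrite Pr_diff; last by move=> w; exact: hit_le.
  by rewrite !hitp_widen.
apply: (@le_trans _ _ (Ex (fun=> p) s (fun w => h (rim M n w)) (fun=> false))).
  rewrite /Pr -(Ex_widen (fun=> p) (s := ball n.+1) (s' := s) (fun=> false) (fun=> false)) ?ball_uniq //; last first.
    by move=> w w' H; rewrite (rim_dep M H).
  rewrite -ExZ le_eqVlt; apply/orP; left; apply/eqP; apply: Ex_eq => w.
  by rewrite /h /c asboolb; case: ifP; rewrite ?mulr1 ?mulr0.
apply: (@le_trans _ _ (Ex (fun=> p) s (fun w => g (rim M n w) w) (fun=> false))).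
  apply: (@Ex_cond_ge _ _ (fun=> p) s _ (rim M n) (fun _ t => t \in ball n.+1)) => //.
  - by move=> w w' H; apply/esym/rim_dep => v vn; exact: H.
  - move=> w0 w w' H; rewrite /g; case: ifP => // _.
    congr (_%:R); congr (nat_of_bool (~~ _)); apply: eq_in_has => u.
    rewrite mem_undup mem_filter => /andP[/negP un _]; exact: H.
  - move=> w0; rewrite /h /g; case: ifPn => [/andP[_ sk]|_]; last by rewrite Ex_cst.
    set U := outer _ _.
    rewrite (Ex_has (fun=> p) (fun b => (~~ b)%:R)) ?undup_uniq //; last first.
      move=> u; rewrite mem_undup mem_filter => /andP[_ /flatten_mapP[x xr /nbrs_adj xu]].
      by apply: ball_adj xu; move/rimP: xr => [].
    rewrite mulr0 add0r mulr1 prodr_const_seq; have := p0; have := p1 => ? ?; apply: ler_wiXn2l; [lra|lra|].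
    by apply: leq_trans (size_outer _ _) _; rewrite leq_mul2l sk orbT.
apply: le_Ex => // w; rewrite /g /c; case: ifPn => [/andP[s0 _]|_]; last exact: ind_ge0.
case: (boolP (has _ _)) => [_|nh]; first exact: ind_ge0.
rewrite asboolT //; split; last exact: no_outer_hit nh.
by rewrite /hit; case: (rim M n w) s0 => // v l _; exists v; rewrite inE eqxx.
Qed.

(** The hitting probabilities are nonnegative, so some drop from one radius to the next is
    arbitrarily small, and [few_hits_drop] divides it by a constant depending only on [D], [p] and
    [k]. *)
Lemma few_hits M k n0 (eps : R) : (M <= n0)%N -> 0 < eps -> exists2 n, (n0 <= n)%N &
  PP (ball n.+1) (fun w => (0 < size (rim M n w) <= k)%N) <= eps.
Proof.
move=> Mn0 eps0; pose c := (1 - p) ^+ (2 * D * k).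
have c0 : 0 < c by apply: exprn_gt0; rewrite subr_gt0.
have [|j Hj] := @small_drop _ (fun j => hitp M (n0 + j)) (c * eps) _ (mulr_gt0 c0 eps0).
  by move=> j; exact: Pr_ge0.
exists (n0 + j)%N; first exact: leq_addr.
have := @few_hits_drop M (n0 + j) k (leq_trans Mn0 (leq_addr _ _)); rewrite -/c.
move: Hj; rewrite addnS; set x := Pr _ _ _ _ => H1 H2.
by rewrite -(ler_pM2l c0); lra.
Qed.

End FewHits.

Lemma sg_norm b (x : int) : `|sg b * x| = `|x|.
Proof. by rewrite /sg; case: b; lia. Qed.

Lemma sg_self (x : int) : sg (0 <= x) * x = `|x|.
Proof. by rewrite /sg; case: ifP => [x0|/negbT x0]; rewrite ?mul1r ?mulN1r; lia. Qed.

(** * Lattice symmetries and the square-root trick *)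

Section Symmetry.
Context {D : nat}.
Variable i0 : 'I_D.
Local Notation V := 'rV[int]_D.
Local Notation adj := (@Zd_adj D).

(** The lattice symmetry carrying the standard situation (centre 0, axis [i0], all signs positive)
    to centre [c], axis [i] and signs [b]. Estimates are proved in standard position only. *)
Definition orient (c : V) i (b : 'I_D -> bool) (v : V) : V :=
  \row_j (c 0 j + sg (b j) * v 0 (tperm i0 i j)).

Definition unorient (c : V) i (b : 'I_D -> bool) (v : V) : V :=
  \row_j (sg (b (tperm i0 i j)) * (v 0 (tperm i0 i j) - c 0 (tperm i0 i j))).

Lemma orientK c i b : cancel (orient c i b) (unorient c i b).
Proof.
move=> v; apply/rowP => j; rewrite !mxE tpermK.
by rewrite addrAC subrr add0r sgK.
Qed.

Lemma unorientK c i b : cancel (unorient c i b) (orient c i b).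
Proof. by move=> v; apply/rowP => j; rewrite !mxE tpermK sgK addrC subrK. Qed.

Lemma orient_adj c i b u v : adj (orient c i b u) (orient c i b v) = adj u v.
Proof.
congr (_ == _); rewrite [RHS](reindex_inj (@perm_inj _ (tperm i0 i))).
apply: eq_bigr => j _; rewrite !mxE opprD addrACA subrr add0r -mulrBr.
exact: sg_norm.
Qed.

Lemma unorient_adj c i b u v : adj (unorient c i b u) (unorient c i b v) = adj u v.
Proof. by rewrite -(orient_adj c i b) !unorientK. Qed.

Lemma mem_ball_orient N i b v : (orient 0 i b v \in ball N) = (v \in ball N).
Proof.
apply/ballP/ballP => H j; last by rewrite !mxE add0r sg_norm H.
by have := H (tperm i0 i j); rewrite !mxE add0r sg_norm tpermK.
Qed.

Definition face (N : nat) i (b : 'I_D -> bool) (v : V) : bool :=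
  (sg (b i) * v 0 i == N%:Z) && [forall j, 0 <= sg (b j) * v 0 j].

Lemma face_orient N i b v : face N i b (orient 0 i b v) = face N i0 xpredT v.
Proof.
rewrite /face !mxE add0r sgK tpermR /= mul1r; congr (_ && _).
apply/forallP/forallP => H j; have := H (tperm i0 i j).
  by rewrite !mxE add0r sgK tpermK mul1r.
by rewrite mul1r !mxE add0r sgK.
Qed.

Lemma face_cover N v : v \in ball N.+1 -> v \notin ball N ->
  exists i (b : {ffun 'I_D -> bool}), face N.+1 i b v.
Proof.
move=> /ballP vN; rewrite mem_ball negb_forall => /existsP[i vi].
exists i, [ffun j => 0 <= v 0 j].
have vi' : `|v 0 i| = N.+1%:Z by have := vN i; move: vi => /=; move: (v 0 i) => a; lia.
apply/andP; split.
  by rewrite ffunE sg_self vi'.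
by apply/forallP => j; rewrite ffunE sg_self.
Qed.

Definition face_rim (M N : nat) i b (w : V -> bool) : seq V :=
  [seq v <- rim M N w | face N.+1 i b v].

Lemma rim_orient M N i b w v :
  v \in rim M N w -> unorient 0 i b v \in rim M N (w \o orient 0 i b).
Proof.
move=> /rimP[v1 vN rv]; apply/rimP.
have ballE K u : (unorient 0 i b u \in ball K) = (u \in ball K).
  by rewrite -(mem_ball_orient K i b) unorientK.
split; rewrite ?ballE //; apply: reach_map rv => [u u'|u [uB wu]|u uB].
- by rewrite unorient_adj.
- by rewrite /= unorientK ballE.
- by rewrite ballE.
Qed.

Lemma size_face_rim_orient M N i b w :
  (size (face_rim M N i b w) <= size (face_rim M N i0 xpredT (w \o orient 0 i b)))%N.
Proof.
rewrite -(size_map (unorient 0 i b)); apply: uniq_leq_size.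
  rewrite map_inj_uniq; first exact/filter_uniq/filter_uniq/ball_uniq.
  exact: can_inj (@unorientK 0 i b).
move=> _ /mapP[v + ->]; rewrite !(mem_filter (face _ _ _)) => /andP[fv vr].
by rewrite -(face_orient _ i b) unorientK fv rim_orient.
Qed.

End Symmetry.

Lemma size_le_count (T : eqType) (J : finType) (a : J -> pred T) (s : seq T) :
  {in s, forall x, exists j, a j x} -> (size s <= \sum_j count (a j) s)%N.
Proof.
elim: s => [|x s IH] H; first exact: leq0n.
have [j aj] := H x (mem_head _ _).
have H1 : (1 <= \sum_j nat_of_bool (a j x))%N by rewrite (bigD1 j) //= aj.
have H2 : (size s <= \sum_j count (a j) s)%N.
  by apply: IH => y ys; apply: H; rewrite inE ys orbT.
by have := leq_add H1 H2; rewrite -big_split.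
Qed.

Section SquareRoot.
Context {R : realType} {D : nat}.
Variables (p : R) (i0 : 'I_D).
Hypothesis p01 : 0 <= p < 1.
Local Notation V := 'rV[int]_D.
Local Notation PP s A := (Pr (fun _ : V => p) s A (fun=> false)).
Local Notation J := ('I_D * {ffun 'I_D -> bool})%type.

Let p0 : 0 <= p. Proof. by case/andP: p01. Qed.
Let p1 : p < 1. Proof. by case/andP: p01. Qed.
Let hp : prob (fun _ : V => p). Proof. by move=> v; rewrite p0 ltW. Qed.

(* Square-root trick. *)
Lemma face_rim_few M N k (eta : R) : 0 <= eta ->
  PP (ball N.+1) (fun w => (size (rim M N w) <= #|{: J}| * k)%N) <= eta ^+ #|{: J}| ->
  PP (ball N.+1) (fun w => (size (face_rim M N i0 xpredT w) <= k)%N) <= eta.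
Proof.
move=> eta0 H; pose s := @ball D N.+1.
pose A (j : J) (w : V -> bool) := (size (face_rim M N j.1 j.2 w) <= k)%N.
pose A0 (w : V -> bool) := (size (face_rim M N i0 xpredT w) <= k)%N.
have mrim (w w' : V -> bool) (v : V) : (forall t, w t -> w' t) -> v \in rim M N w -> v \in rim M N w'.
  move=> ww /rimP[v1 vN rv]; apply/rimP; split=> //.
  by apply: reach_sub rv => // u [uB /ww].
have dA (j : J) (w w' : V -> bool) : (forall t, w t -> w' t) -> A j w' -> A j w.
  move=> ww; apply: leq_trans; apply: uniq_leq_size.
    exact/filter_uniq/filter_uniq/ball_uniq.
  by move=> v; rewrite !(mem_filter (face _ _ _)) => /andP[-> /mrim]; exact.
have A0A (j : J) : PP s A0 <= PP s (A j).
  rewrite -(@Pr_iso _ _ _ p (orient i0 0 j.1 j.2) s s A0 (fun=> false) (fun=> false)) ?ball_uniq //.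
  - by apply: le_Pr => // w; apply: leq_trans; exact: size_face_rim_orient.
  - exact: can_inj (@orientK _ i0 0 j.1 j.2).
  - by move=> w1 w2 w12; rewrite /A0 /face_rim (rim_dep M w12).
  - by move=> _ /mapP[v vs ->]; rewrite mem_ball_orient.
have cardJ : (0 < #|{: J}|)%N.
  by apply/card_gt0P; exists (i0, [ffun=> true]).
rewrite -(@ler_pXn2r _ #|{: J}|) ?nnegrE //; last exact: Pr_ge0.
apply: le_trans H; rewrite cardE -prodr_const_seq.
apply: le_trans (_ : \prod_(j <- enum {: J}) PP s (A j) <= _).
  by apply: ler_prod => j _; rewrite Pr_ge0 //=; exact: A0A.
apply: le_trans (Harris_decr_all _ _ _ hp dA) _.
(* The orthants of the faces cover the sphere, so few points in each of them bound the size of the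
   whole rim. *)
apply: le_Pr => // w Aw; apply: leq_trans (size_le_count (a := fun j : J => face N.+1 j.1 j.2) _) _.
  move=> v /rimP[v1 vN _]; have [i [b fb]] := face_cover v1 vN.
  by exists (i, b).
rewrite -cardE -sum_nat_const; apply: leq_sum => j _.
by rewrite -size_filter; apply: Aw; rewrite mem_enum.
Qed.

End SquareRoot.

(** Greedy selection: each chosen point discards at most [S] points, itself included. *)
Lemma separated (T : eqType) (near : T -> seq T) (S k : nat) (l : seq T) :
  uniq l -> (0 < S)%N -> (forall x, x \in near x) -> (forall x, size (near x) <= S)%N ->
  (k * S <= size l)%N -> exists l', [/\ {subset l' <= l}, size l' = k &
    pairwise (fun x y => y \notin near x) l'].
Proof.
move=> + S0 xx nS; elim: k l => [|k IH] l ul; first by move=> _; exists [::].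
case: l ul => [|x t] ul; first by rewrite leqn0 muln_eq0 /= => /eqP S00; rewrite S00 in S0.
move=> sl; have [||l' [sub sl' pl']] := IH [seq y <- x :: t | y \notin near x].
- exact: filter_uniq.
- rewrite size_filter -(leq_add2l (count (mem (near x)) (x :: t))) count_predC.
  apply: leq_trans sl; rewrite mulSn leq_add2r; apply: leq_trans (nS x).
  rewrite -size_filter; apply: uniq_leq_size; first exact: filter_uniq.
  by move=> y; rewrite mem_filter => /andP[].
exists (x :: l'); split=> /=; last 2 first.
- by rewrite sl'.
- by rewrite pl' andbT; apply/allP => y /sub; rewrite mem_filter => /andP[].
move=> y; rewrite inE => /orP[/eqP -> |/sub]; first exact: mem_head.
by rewrite mem_filter => /andP[].
Qed.

Lemma Pr_no_block (R : realFieldType) (T : eqType) (p : R) s (bs : seq (seq T)) (S : nat) w :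
  0 <= p <= 1 -> uniq s -> all uniq bs -> (forall b, b \in bs -> {subset b <= s}) ->
  all (fun b => size b <= S)%N bs -> pairwise (fun b b' : seq T => ~~ has (mem b) b') bs ->
  Pr (fun=> p) s (fun w => all (fun b => ~~ all w b) bs) w <= (1 - p ^+ S) ^+ size bs.
Proof.
move=> /andP[p0 p1] us.
have hp : prob (fun _ : T => p) by move=> t; rewrite p0.
elim: bs => [|b bs IH] /=; first by move=> *; rewrite expr0; exact: Pr_le1.
move=> /andP[ub ubs] sub /andP[sb sbs] /andP[db dbs].
have sub_b : {subset b <= s} by apply: sub; rewrite mem_head.
have dal (c : seq T) (w1 w2 : T -> bool) : (forall t, t \in c -> w1 t = w2 t) -> all w1 c = all w2 c.
  by move=> H; apply: eq_in_all => t /H.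
rewrite (@eq_Pr _ _ _ s _ (fun w : T -> bool => ~~ all w b /\ all (fun b => ~~ all w b) bs)); last first.
  by move=> w'; split=> [/andP|[-> ->]].
rewrite (@Pr_and_indep _ _ _ s (fun w : T -> bool => ~~ all w b) (fun w => all (fun b => ~~ all w b) bs)
  (fun t => t \in b) (fun t => t \in flatten bs)); last 3 first.
- by move=> w1 w2 H; rewrite (dal b w1 w2).
- move=> w1 w2 H; have -> // : all (fun b => ~~ all w1 b) bs = all (fun b => ~~ all w2 b) bs.
  apply: eq_in_all => c cb; rewrite (dal c w1 w2) // => t tc.
  by apply: H; apply/flattenP; exists c.
- move=> t tb /flattenP[c cbs tc]; move/allP: db => /(_ c cbs)/hasPn/(_ t tc).
  by rewrite /= tb.
have q1 : 0 <= 1 - p ^+ S by rewrite subr_ge0 exprn_ile1.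
rewrite exprS; apply: ler_pM; [exact: Pr_ge0|exact: Pr_ge0| |].
  have -> : Pr (fun=> p) s (fun w : T -> bool => ~~ all w b) w =
      Ex (fun=> p) s (fun w => (fun c : bool => (~~ c)%:R) (all w b)) w.
    by apply: Ex_eq => w'; rewrite asboolb.
  rewrite (Ex_all (fun=> p) (fun c : bool => (~~ c)%:R)) //= mulr0 add0r mulr1.
  by rewrite prodr_const_seq lerB //; exact: ler_wiXn2l.
by apply: IH => // c cbs; apply: sub; rewrite inE cbs orbT.
Qed.

(** * Seeds behind a face of a box *)

Section Blocks.
Context {D : nat}.
Variables (i0 : 'I_D) (m N : nat).
Hypothesis mN : (4 * m + 6 <= N)%N.
Local Notation V := 'rV[int]_D.
Local Notation adj := (@Zd_adj D).
Local Notation aa := (lat_min m).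
Local Notation ww := (lat_max m N).
Local Notation RR := (reg m N 0 i0 xpredT).
Local Notation far := (@face D N i0 xpredT).

(** A contact point may be too close to the border of its orthant for a seed straight behind it.
    Clamping moves the seed sideways by at most [aa], which fixes the lateral width of [block]. *)
Definition clampz (t : int) : int := if t < aa then aa else if ww < t then ww else t.

Lemma clampz_in t : aa <= clampz t <= ww.
Proof.
by rewrite /clampz /lat_max /lat_min; case: ltP => ?; [|case: ltP => ?]; lia.
Qed.

Lemma clampz_near t : 0 <= t <= N%:Z -> `|t - clampz t| <= aa.
Proof.
by rewrite /clampz /lat_max /lat_min; case: ltP => ?; [|case: ltP => ?]; lia.
Qed.

Definition bcen (x : V) : V := \row_j (if j == i0 then stride m N else clampz (x 0 j)).

(** One open block contains both the vertex behind [x] and an admissible seed, and it lies outside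
    [ball N], so its bits are independent of the contact points. *)
Definition block (x : V) : seq V :=
  boxseq (\row_j (if j == i0 then N%:Z + 1 else clampz (x 0 j) - aa))
         (\row_j (if j == i0 then reach_len m N else clampz (x 0 j) + aa)).

Lemma blockP x v : v \in block x <-> N%:Z + 1 <= v 0 i0 <= reach_len m N /\
  forall j, j != i0 -> `|v 0 j - clampz (x 0 j)| <= aa.
Proof.
rewrite mem_boxseq; split.
  move=> /boxP H; split; first by have := H i0; rewrite !mxE eqxx.
  by move=> j /negbTE ji; have := H j; rewrite !mxE ji; move: (v 0 j) (clampz _) aa => a b c; lia.
move=> [Hi Hj]; apply/boxP => j; rewrite !mxE; case: eqP => [->//|/eqP ji].
by have := Hj j ji; move: (v 0 j) (clampz _) aa => a b c; lia.
Qed.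

Lemma faceP x : far x -> x 0 i0 = N%:Z /\ forall j, 0 <= x 0 j.
Proof.
move=> /andP[/eqP + /forallP H]; rewrite mul1r => ->; split=> // j.
by have := H j; rewrite mul1r.
Qed.

Lemma block_reg x v : v \in block x -> v \in RR.
Proof.
move=> /blockP[Hi Hj]; apply/regP; rewrite /= mul1r mxE subr0; split.
  by move: Hi; move: (reach_len m N) (v 0 i0) => *; lia.
move=> j ji; rewrite mxE subr0; have := Hj j ji; have := clampz_in (x 0 j).
by rewrite /lat_max; move: aa (v 0 j) (clampz _) => a b c; lia.
Qed.

Lemma block_cube x v : v \in cube m (bcen x) -> v \in block x.
Proof.
move=> /cubeP H; apply/blockP; split.
  by have := H i0; rewrite mxE eqxx /stride /reach_len; move: (v 0 i0) => a; lia.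
move=> j /negbTE ji; have := H j; rewrite mxE ji /lat_min.
by move: (v 0 j) (clampz _) => a b; lia.
Qed.

Lemma block_out x v : v \in block x -> v \notin ball N.
Proof.
move=> /blockP[Hi _]; apply/negP => /ballP/(_ i0).
by move: Hi; move: (reach_len m N) (v 0 i0) => *; lia.
Qed.

Lemma block_entry x : x \in ball N -> far x -> x + unitv i0 \in block x.
Proof.
move=> /ballP xN /faceP[xi xj]; apply/blockP; split.
  by rewrite mxE unitvE eqxx xi /reach_len /=; lia.
move=> j /negbTE ji; rewrite mxE unitvE ji addr0; apply: clampz_near.
by have := xN j; have := xj j; move: (x 0 j) => a; lia.
Qed.

Lemma bcen_target x : bcen x \in tcen m N 0 i0 xpredT.
Proof.
apply/tcenP; rewrite !mxE eqxx /= mul1r subr0; split=> // j /negbTE ji.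
by rewrite !mxE ji mul1r subr0; exact: clampz_in.
Qed.

Lemma size_block x : (size (block x) <= size (@ball D (2 * m + 1)))%N.
Proof.
rewrite -(size_map (fun v : V => v - bcen x)); apply: uniq_leq_size.
  by rewrite map_inj_uniq; [exact: boxseq_uniq|exact: addIr].
move=> _ /mapP[v /blockP[Hi Hj] ->]; apply: in_ball => j; rewrite !mxE.
case: eqP => [->|/eqP ji].
  by move: Hi; rewrite /stride /reach_len; move: (v 0 i0) => a; lia.
by have := Hj j ji; rewrite /lat_min; move: (v 0 j) (clampz _) => a b; lia.
Qed.

(** Clamping and the block width contribute [aa] each, so both face points are within [2 * aa] of a
    common vertex of their blocks. *)
Lemma block_near x y v : x \in ball N -> y \in ball N -> far x -> far y ->
  v \in block x -> v \in block y -> y \in cube (4 * (2 * m + 1)) x.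
Proof.
move=> /ballP xN /ballP yN /faceP[xi xj] /faceP[yi yj] /blockP[_ vx] /blockP[_ vy].
apply/cubeP => j; have [->|ji] := eqVneq j i0; first by rewrite xi yi subrr normr0.
have := vx j ji; have := vy j ji; have := @clampz_near (x 0 j); have := @clampz_near (y 0 j).
have := xN j; have := yN j; have := xj j; have := yj j; rewrite /lat_min.
move: (x 0 j) (y 0 j) (v 0 j) (clampz (x 0 j)) (clampz (y 0 j)) => a b c cx cy.
move=> b0 a0 bN aN hy hx vy' vx'.
have {}hy : `|b - cy| <= 2 * m%:Z + 1 by apply: hy; lia.
have {}hx : `|a - cx| <= 2 * m%:Z + 1 by apply: hx; lia.
lia.
Qed.

Lemma block_crosses x (w : V -> bool) : far x ->
  reach adj (fun u => u \in ball N /\ w u) (fun u => u \in ball m) x -> x \in ball N ->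
  all w (block x) -> crosses adj RR (fun v => v \in cube m 0) (targets m N 0 i0 xpredT) w.
Proof.
move=> fx rx xN /allP wb; exists (cube m (bcen x)); first by apply: map_f; exact: bcen_target.
have cc : bcen x \in cube m (bcen x) by apply/cubeP => j; rewrite subrr normr0.
split; first by move=> y /block_cube/wb.
exists (bcen x) => //.
have NR : {subset ball N <= RR}.
  move=> v /ballP vN; apply/regP; rewrite /= mul1r mxE subr0; split.
    by have := vN i0; rewrite /reach_len; move: (v 0 i0) => a; lia.
  by move=> j _; rewrite mxE subr0.
have be := block_entry xN fx.
apply: reach_trans; apply: reach_sub (boxseq_reach be (block_cube cc)) => [u ub|u <-].
  by split; [exact: block_reg ub|exact: wb].
apply: (reach_step (u := x)); last 2 first.
- exact: Zd_adjD.
- by split; [exact: block_reg be|exact: wb].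
apply: reach_sub rx => [y [yN wy]|y /ballP yB]; first by split=> //; exact: NR.
by apply/cubeP => j; rewrite mxE subr0.
Qed.

End Blocks.

Section CrossingLaw.
Context {R : realType} {D : nat}.
Variables (p : R) (i0 : 'I_D).
Hypothesis p01 : 0 < p < 1.
Local Notation V := 'rV[int]_D.
Local Notation adj := (@Zd_adj D).
Local Notation PP s A := (Pr (fun _ : V => p) s A (fun=> false)).
Local Notation J := ('I_D * {ffun 'I_D -> bool})%type.

Let p0 : 0 < p. Proof. by case/andP: p01. Qed.
Let p1 : p < 1. Proof. by case/andP: p01. Qed.
Let p01w : 0 <= p <= 1. Proof. by rewrite !ltW. Qed.
Let p01' : 0 <= p < 1. Proof. by rewrite ltW. Qed.
Let hp : prob (fun _ : V => p). Proof. by move=> v. Qed.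

Definition crossing m n c i (b : 'I_D -> bool) (w : V -> bool) :=
  crosses adj (reg m n c i b) (fun v => v \in cube m c) (targets m n c i b) w.

(** The contact points are read inside [ball n.+1], the blocks outside. Among sufficiently many
    contact points, [k] have pairwise disjoint blocks; one open block would complete a crossing. *)
Lemma crossing_few m n k : (4 * m + 6 <= n.+1)%N ->
  PP (reg m n.+1 0 i0 xpredT) (fun w => ~ crossing m n.+1 0 i0 xpredT w) <=
  PP (ball n.+1) (fun w => (size (face_rim m n i0 xpredT w) <=
     k * size (@cube D (4 * (2 * m + 1)) 0))%N) +
  (1 - p ^+ size (@ball D (2 * m + 1))) ^+ k.
Proof.
set S := size (ball _); set S4 := size (cube _ _) => mn.
pose s := reg m n.+1 0 i0 xpredT; have us : uniq s by exact: boxseq_uniq.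
have subs : {subset @ball D n.+1 <= s}.
  move=> v /ballP vN; apply/regP; rewrite /= mul1r mxE subr0; split.
    by have := vN i0; rewrite /reach_len; move: (v 0 i0) => a; lia.
  by move=> j _; rewrite mxE subr0.
pose fr := @face_rim D m n i0 xpredT.
have frP w v : v \in fr w -> [/\ v \in ball n.+1, face n.+1 i0 xpredT v &
    reach adj (fun u => u \in ball n.+1 /\ w u) (fun u => u \in ball m) v].
  by rewrite (mem_filter (face _ _ _)) => /andP[fv /rimP[v1 _ rv]].
pose bl := @block D i0 m n.+1.
pose g (xs : seq V) (w : V -> bool) : R :=
  if (k * S4 < size xs)%N then (all (fun x => ~~ all w (bl x)) xs)%:R else 0.
pose few (w : V -> bool) := (size (fr w) <= k * S4)%N.
have q1 : 0 <= (1 - p ^+ S) ^+ k by rewrite exprn_ge0 // subr_ge0 exprn_ile1 ?ltW.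
have -> : PP (ball n.+1) few = PP s few.
  apply/esym; apply: Ex_widen => //; last exact: ball_uniq.
  by move=> w w' H; rewrite /few /fr /face_rim (rim_dep m H).
apply: (@le_trans _ _ (PP s few + Ex (fun=> p) s (fun w => g (fr w) w) (fun=> false))).
  rewrite /Pr -ExD; apply: le_Ex => // w; case: asboolP => [nc|_]; last first.
    by rewrite addr_ge0 ?ind_ge0 // /g; case: ifP.
  rewrite /g /few asboolb; case: leqP => /= h; rewrite ?addr0 // add0r.
  case: (boolP (all _ _)) => [//|/allPn[x /frP[x1 fx rx] /negPn wb]].
  by case: nc; exact: (block_crosses mn fx rx x1 wb).
rewrite lerD2l; apply: (@le_trans _ _ (Ex (fun=> p) s (fun w => (1 - p ^+ S) ^+ k) (fun=> false))); last by rewrite Ex_cst.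
apply: (@Ex_cond_le _ _ (fun=> p) s _ fr (fun _ t => t \in ball n.+1) g (fun=> (1 - p ^+ S) ^+ k)) => //.
- by move=> w w' H; rewrite /fr /face_rim (@rim_dep D m n w' w) // => t /H.
- move=> w0 w w' H; rewrite /g; case: ifP => // _; congr (_%:R); congr nat_of_bool.
  apply: eq_in_all => x _; congr (~~ _); apply: eq_in_all => v vb.
  by apply: H; apply/negP; exact: (block_out mn vb).
move=> w0; rewrite /g; case lt : (k * S4 < size (fr w0))%N; last by rewrite Ex_cst.
pose near (x : V) := cube (4 * (2 * m + 1)) x.
have [|||||l [sub sl pl]] := @separated _ near S4 k (fr w0).
- exact/filter_uniq/filter_uniq/ball_uniq.
- by rewrite lt0n size_eq0; apply/eqP => E; have : 0 \in @cube D (4 * (2 * m + 1)) 0;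
    [apply/cubeP => j; rewrite subrr normr0|rewrite E].
- by move=> x; apply/cubeP => j; rewrite subrr normr0.
- move=> x; rewrite -(size_map (fun v : V => v - x)); apply: uniq_leq_size.
    by rewrite map_inj_uniq; [exact: boxseq_uniq|exact: addIr].
  by move=> _ /mapP[v /cubeP H ->]; apply/cubeP => j; rewrite !mxE subr0.
- exact: ltnW.
rewrite -sl -(size_map bl).
apply: (@le_trans _ _ (PP s (fun w => all (fun b => ~~ all w b) (map bl l)))).
  apply: le_Ex => // w; rewrite asboolb ler_nat all_map.
  case: (boolP (all _ (fr _))) => // /allP H; rewrite (_ : all _ l) //.
  by apply/allP => x /sub/H.
apply: Pr_no_block => //.
- by apply/allP => _ /mapP[x _ ->]; exact: boxseq_uniq.
- by move=> _ /mapP[x _ ->] v; exact: block_reg.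
- by apply/allP => _ /mapP[x _ ->]; exact: size_block.
rewrite pairwise_map; apply: (sub_in_pairwise (P := mem l) _ _ pl) => [x y xl yl /= xy|]; last exact/allP.
have [x1 fx _] := frP _ _ (sub _ xl); have [y1 fy _] := frP _ _ (sub _ yl).
apply/hasPn => v vy; apply: contra xy => /= vx.
exact: (block_near mn x1 y1 fx fy vx vy).
Qed.

Lemma mem_cube_orient c i b r x v :
  (orient i0 c i b v \in cube r (orient i0 c i b x)) = (v \in cube r x).
Proof.
apply/cubeP/cubeP => H j.
  have := H (tperm i0 i j); rewrite !mxE tpermK opprD addrACA subrr add0r -mulrBr.
  by rewrite sg_norm.
by rewrite !mxE opprD addrACA subrr add0r -mulrBr sg_norm.
Qed.

Lemma orient0 c i b : orient i0 c i b 0 = c.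
Proof. by apply/rowP => j; rewrite !mxE mulr0 addr0. Qed.

Lemma orient_reg m n c i b v : v \in reg m n 0 i0 xpredT -> orient i0 c i b v \in reg m n c i b.
Proof.
move=> /regP[]; rewrite /= mul1r mxE subr0 => Hi Hj; apply/regP; split.
  by rewrite mxE addrAC subrr add0r sgK tpermR.
move=> j ji; rewrite mxE addrAC subrr add0r sg_norm.
have := Hj (tperm i0 i j); rewrite mxE subr0; apply.
by rewrite -{2}(tpermR i0 i) (inj_eq perm_inj).
Qed.

Lemma orient_tcen m n c i b v : v \in tcen m n 0 i0 xpredT -> orient i0 c i b v \in tcen m n c i b.
Proof.
move=> /tcenP[]; rewrite /= mul1r mxE subr0 => Hi Hj; apply/tcenP; split.
  by rewrite mxE addrAC subrr add0r sgK tpermR.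
move=> j ji; rewrite mxE addrAC subrr add0r sgK.
have := Hj (tperm i0 i j); rewrite mul1r mxE subr0; apply.
by rewrite -{2}(tpermR i0 i) (inj_eq perm_inj).
Qed.

Lemma orient_crossing m n c i b (w : V -> bool) :
  crossing m n 0 i0 xpredT (w \o orient i0 c i b) -> crossing m n c i b w.
Proof.
move=> [_ /mapP[x xT ->] [wx [y yx ry]]].
exists (cube m (orient i0 c i b x)); first by apply: map_f; exact: orient_tcen.
split.
  move=> z; rewrite -(unorientK i0 c i b z) mem_cube_orient; exact: wx.
exists (orient i0 c i b y); first by rewrite mem_cube_orient.
apply: reach_map ry => [u u'|u [uR wu]|u um].
- by rewrite orient_adj.
- by split=> //; exact: orient_reg.
- by rewrite -[X in cube m X](orient0 c i b) mem_cube_orient.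
Qed.

Lemma crossing_dep m n (w1 w2 : V -> bool) : (4 * m + 6 <= n)%N ->
  {in reg m n 0 i0 xpredT, w1 =1 w2} ->
  crossing m n 0 i0 xpredT w1 -> crossing m n 0 i0 xpredT w2.
Proof.
move=> mn E [_ /mapP[x xT ->] [wx [y yx ry]]].
exists (cube m x); first exact: map_f.
split; last first.
  by exists y => //; apply: reach_sub ry => // u [uR wu]; rewrite -E.
move=> z zx; rewrite -E ?wx //; apply/regP; rewrite /= mul1r mxE subr0.
have [+ Hj] := (tcenP m n 0 i0 xpredT x).1 xT; rewrite /= mul1r mxE subr0 => Hi.
move/cubeP: zx => zx; split.
  have := zx i0; rewrite Hi /stride /reach_len; move: (z 0 i0) => a; lia.
move=> j ji; have := zx j; have := Hj j ji; rewrite mul1r mxE !subr0 /lat_max /lat_min.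
move: (z 0 j) (x 0 j) => a b; lia.
Qed.

Lemma crossing_sym m n c i b : (4 * m + 6 <= n)%N ->
  PP (reg m n c i b) (fun w => ~ crossing m n c i b w) <=
  PP (reg m n 0 i0 xpredT) (fun w => ~ crossing m n 0 i0 xpredT w).
Proof.
move=> mn; rewrite -(@Pr_iso _ _ _ p (orient i0 c i b) (reg m n 0 i0 xpredT) (reg m n c i b)
  (fun w => ~ crossing m n 0 i0 xpredT w) (fun=> false) (fun=> false)) ?boxseq_uniq //.
- by apply: le_Pr => // w nc /orient_crossing.
- exact: can_inj (@orientK _ i0 c i b).
- move=> w1 w2 E nc /(crossing_dep mn) c2; apply: nc; apply: c2 => v vR.
  by rewrite E.
- by move=> _ /mapP[v vR ->]; exact: orient_reg.
Qed.

(** The order of choice matters: [t] from [del], the seed radius [m] from the zero-one law, the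
    number [k] of blocks from [m], and only then a radius [n] at which few contacts are unlikely. *)
Lemma good_scales (del eps th : R) : 0 < del <= 1 -> 0 < eps -> 0 < th ->
  (forall N, th <= @hitp R D p 0 N) -> exists m n t, (4 * m + 6 <= n)%N /\
  forall c i (b : 'I_D -> bool), (1 - del) ^+ t + (1 - p) ^- t *
    Pr (fun=> p) (reg m n c i b) (fun w => ~ crosses adj (reg m n c i b)
      (fun v => v \in cube m c) (targets m n c i b) w) (fun=> false) <= eps.
Proof.
move=> /andP[d0 d1] e0 th0 hth.
have [|t Ht] := @small_expr _ (1 - del) (eps / 2%:R) _ (divr_gt0 e0 (ltr0n _ 2)).
  by rewrite subr_ge0 d1 /=; lra.
have pt : 0 < (1 - p) ^+ t by rewrite exprn_gt0 // subr_gt0.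
(* The failure probability will be at most [eta + eta]; the factor [(1 - p) ^+ t] absorbs the weight
   [(1 - p) ^- t] and leaves [eps / 2]. *)
pose eta := eps / 4%:R * (1 - p) ^+ t.
have eta0 : 0 < eta by rewrite mulr_gt0 // divr_gt0.
pose eta1 := eta ^+ #|{: J}|; have eta10 : 0 < eta1 by exact: exprn_gt0.
have eta12 : 0 < eta1 / 2%:R by exact: divr_gt0.
have [m Hm] := zero_one i0 p01w th0 hth eta12.
have [|k Hk] := @small_expr _ (1 - p ^+ size (@ball D (2 * m + 1))) eta _ eta0.
  by rewrite subr_ge0 exprn_ile1 ?ltW //= ltrBlDr ltrDl exprn_gt0.
set K := (#|{: J}| * (k * size (@cube D (4 * (2 * m + 1)) 0)))%N.
have [n n0 Hn] := @few_hits R D p p01' m K _ _ (leq_addr (4 * m + 6)%N m) eta12.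
have mn : (4 * m + 6 <= n.+1)%N by rewrite (leq_trans _ (leqW n0)) ?leq_addl.
exists m, n.+1, t; split=> // c i b.
set x := Pr _ _ _ _; suff xe : x <= eta + eta.
  have : (1 - p) ^- t * x <= eps / 2%:R.
    rewrite mulrC ler_pdivrMr //; apply: le_trans xe _; rewrite /eta; lra.
  lra.
apply: (le_trans (crossing_sym c i b mn)).
apply: (le_trans (crossing_few k mn)); apply: lerD => //.
apply: face_rim_few => //; first exact: ltW.
rewrite -/eta1 -/K.
apply: (@le_trans _ _ (PP (ball n.+1) (fun w => ~ hit m n w) +
   PP (ball n.+1) (fun w => (0 < size (rim m n w) <= K)%N))).
  apply: le_trans (Pr_or _ _ _ _ hp); apply: le_Pr => // w le.
  have [E|E] := posnP (size (rim m n w)); last by right; apply/andP; split.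
  by left; move=> [v]; rewrite (size0nil E).
rewrite (PrC _ _ (hit m n)); have := Hm n; rewrite (leq_trans _ n0) ?leq_addr // => /(_ isT).
by rewrite /hitp; lra.
Qed.

End CrossingLaw.

(** * Comparison of the two graphs *)

Lemma Ex_grow (R : realFieldType) (T : eqType) (q : T -> R) s s' f w : prob q -> incr f ->
  uniq s -> uniq s' -> {subset s <= s'} -> (forall t, t \in s' -> ~~ w t) ->
  Ex q s f w <= Ex q s' f w.
Proof.
move=> hq mf us us' ss w0; pose r := [seq t <- s' | t \notin s].
have -> : Ex q s' f w = Ex q (r ++ s) f w.
  apply: (@Ex_incl _ _ q xpredT) => //.
  - by move=> w1 w2 H; congr f; apply/funext => t; exact: H.
  - rewrite cat_uniq filter_uniq //= us andbT; apply/hasPn => t ts.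
    by rewrite mem_filter ts.
  - by move=> t; rewrite mem_cat mem_filter => /orP[/andP[]|/ss].
  - by move=> t _ ts; rewrite mem_cat mem_filter ts andbT orNb.
have rw t : t \in r -> ~~ w t by rewrite mem_filter => /andP[_ /w0].
rewrite Ex_cat; elim: r rw => //= t r IH rw.
have wt : upd w t false = w.
  apply/funext => u; rewrite /upd; case: eqP => // ->.
  by apply/esym/negbTE/rw; rewrite mem_head.
have {}IH : Ex q s f w <= Ex q r (Ex q s f) w.
  by apply: IH => u ur; apply: rw; rewrite inE ur orbT.
have mE : incr (Ex q s f) by exact: Ex_incr.
have := Ex_upd_le r w t hq mE; rewrite wt => le.
have /andP[q0 q1] := hq t.
by nra.
Qed.

Lemma Ex_map_in (R : realFieldType) (T T' : eqType) (phi : T -> T') (q : R) (S s : seq T)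
    (f : (T -> bool) -> R) w : {in S &, injective phi} -> {subset s <= S} ->
  Ex (fun=> q) (map phi s) (fun w => f (fun t => (t \in S) && w (phi t))) w =
  Ex (fun=> q) s f (fun t => (t \in S) && w (phi t)).
Proof.
move=> iphi; elim: s w => //= t s IH w sS.
have tS : t \in S by apply: sS; exact: mem_head.
have sS' : {subset s <= S} by move=> u us; apply: sS; rewrite inE us orbT.
rewrite !IH //; have E b : (fun u => (u \in S) && upd w (phi t) b (phi u)) =
    upd (fun u => (u \in S) && w (phi u)) t b.
  apply/funext => u; rewrite /upd; have [->|ut] := eqVneq u t; first by rewrite tS eqxx.
  case uS : (u \in S) => //=; case: eqP => // /(iphi _ _ uS tS) E.
  by rewrite E eqxx in ut.
by rewrite !E.
Qed.

Lemma le_Ex_allc (R : realFieldType) (T : eqType) (q : T -> R) s f g w : prob q ->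
  allc s w (fun w => f w <= g w) -> Ex q s f w <= Ex q s g w.
Proof.
move=> hq; elim: s w => //= t s IH w [/IH H1 /IH H2].
have /andP[q0 q1] := hq t.
by apply: lerD; apply: ler_wpM2l => //; rewrite subr_ge0.
Qed.

(* An exploration of the cluster of [pi v0] can be lifted along [pi]: each newly
   examined vertex of the image graph is represented by a fresh vertex upstairs. *)
Section Lift.
Context {R : realFieldType} {U V : eqType}.
Variables (adjU : rel U) (adjV : rel V) (pi : V -> U) (p : R) (v0 : V).
Hypothesis lift : forall v u, adjU (pi v) u -> exists2 v', adjV v v' & pi v' = u.
Hypothesis p01 : 0 <= p <= 1.

Let hpU : prob (fun _ : U => p). Proof. by []. Qed.
Let hpV : prob (fun _ : V => p). Proof. by []. Qed.

Let many N (w : V -> bool) := reaches_many adjV N (fun v => w v) (eq v0).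

Let many_incr N : incr (fun w => ind (many N w) : R).
Proof. by move=> w w' ww; apply: ind_le; apply: reaches_many_sub. Qed.

Let lift_stuck (s : seq U) N (A F : seq V) (r : seq U) : v0 \in A -> uniq (map pi (A ++ F)) ->
  (forall a, a \in A -> reach adjV (fun v => v \in A) (eq v0) a) ->
  r = [seq u <- s | u \notin map pi (A ++ F)] ->
  ~ (exists u a, [/\ u \in r, a \in A & adjU (pi a) u]) ->
  Ex (fun=> p) r (fun w => ind (reaches_many adjU N (fun u => u \in s /\ w u) (eq (pi v0))))
      (fun u => u \in map pi A) <= ind (many N (fun v => v \in A)).
Proof.
move=> v0A uAF reA rE nE.
rewrite -[leRHS](Ex_cst (fun=> p) r _ (fun u => u \in map pi A)).
apply: le_Ex_allc => //; apply: allc_impl (allc_agree _ _) => w H.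
apply: ind_le => -[l [ul sl Hl]].
have sub v : reach adjU (fun u => u \in s /\ w u) (eq (pi v0)) v -> v \in map pi A.
  elim=> [u <-|u u' _ /mapP[a aA ->] uu' [u's wu']]; first exact: map_f.
  have [u'r|u'r] := boolP (u' \in r); first by case: nE; exists u', a.
  by move: wu'; rewrite H.
have : (N <= size A)%N.
  by rewrite -sl -(size_map pi); apply: uniq_leq_size => // v /Hl/sub.
exists (take N A); split.
- by move: uAF; rewrite map_cat cat_uniq => /andP[/map_uniq + _]; exact: take_uniq.
- exact: size_takel.
- by move=> v /mem_take; exact: reA.
Qed.

(** [A] holds the lifted open vertices and [F] the lifted closed ones, with [pi] injective on their
    union. Once no unexamined neighbour is left, the cluster below is covered by the image of [A],
    while [A] itself is connected above. *)
Lemma lift_explore (s : seq U) N n : uniq s -> forall A F : seq V,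
  v0 \in A -> uniq (map pi (A ++ F)) ->
  (forall a, a \in A -> reach adjV (fun v => v \in A) (eq v0) a) ->
  (forall r, r = [seq u <- s | u \notin map pi (A ++ F)] -> (size r <= n)%N ->
  exists s', [/\ uniq s', {in s', forall v, v \notin A ++ F} &
    Ex (fun=> p) r (fun w => ind (reaches_many adjU N (fun u => u \in s /\ w u) (eq (pi v0))))
      (fun u => u \in map pi A) <=
    Ex (fun=> p) s' (fun w => ind (many N w)) (fun v => v \in A)]).
Proof.
move=> us; elim: n => [|n IH] A F v0A uAF reA r rE rn.
all: have [[u [a [ur aA au]]]|nE] := pselect (exists u a, [/\ u \in r, a \in A & adjU (pi a) u]).
- by case: r ur rn {rE}.
- by exists [::]; split=> //; exact: lift_stuck rE nE.
- have [v' av' v'u] := lift au.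
  have u_new : u \notin map pi (A ++ F) by move: ur; rewrite rE mem_filter => /andP[].
  have ur' : u \in s by move: ur; rewrite rE mem_filter => /andP[].
  have v'_new : v' \notin A ++ F.
    by apply: contra u_new => H; rewrite -v'u map_f.
  have uA : u \notin map pi A by apply: contra u_new; rewrite map_cat mem_cat => ->.
  have ur1 : uniq r by rewrite rE filter_uniq.
  have remE : rem u r = [seq x <- s | x \notin map pi ((v' :: A) ++ F)].
    rewrite rem_filter // rE -filter_predI; apply: eq_filter => x /=.
    by rewrite inE negb_or v'u.
  have remE2 : rem u r = [seq x <- s | x \notin map pi (A ++ v' :: F)].
    rewrite remE; apply: eq_filter => x; rewrite !map_cat /= !(inE, mem_cat).
    by rewrite orbCA.
  have r0 : (0 < size r)%N by case: (r) ur.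
  have sz : (size (rem u r) <= n)%N by rewrite size_rem // -ltnS prednK.
  have [|||s1 [us1 d1 le1]] := IH (v' :: A) F _ _ _ (rem u r) remE sz.
  + by rewrite inE v0A orbT.
  + by rewrite /= v'u u_new uAF.
  + move=> b; rewrite inE => /orP[/eqP ->|bA].
      apply: (reach_step (u := a)) => //; last exact: mem_head.
      by apply: reach_sub (reA a aA) => // x xA; rewrite inE xA orbT.
    by apply: reach_sub (reA b bA) => // x xA; rewrite inE xA orbT.
  have [//||//|s2 [us2 d2 le2]] := IH A (v' :: F) _ _ _ (rem u r) remE2 sz.
  + move: uAF; rewrite !map_cat /= -[_ :: _]/([:: pi v'] ++ _) uniq_catCA /= v'u mem_cat.
    by move: u_new; rewrite map_cat mem_cat => -> ->.
  (* The two outcomes at [v'] continue with different lists. Their union serves both, since by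
     [Ex_grow] sampling further closed bits only raises the probability of an increasing event. *)
  pose t := undup (s1 ++ s2).
  have tE x : (x \in t) = (x \in s1) || (x \in s2) by rewrite mem_undup mem_cat.
  have v't : v' \notin t.
    rewrite tE; apply/negP => /orP[/d1|/d2]; rewrite !mem_cat !inE eqxx ?orbT //.
  have tA x : x \in t -> x \notin A ++ F.
    rewrite tE => /orP[/d1|/d2]; apply: contra; rewrite !mem_cat !inE.
      by move=> /orP[] ->; rewrite ?orbT.
    by move=> /orP[] ->; rewrite ?orbT.
  exists (v' :: t); split.
  + by rewrite /= v't undup_uniq.
  + by move=> x; rewrite inE => /orP[/eqP ->|/tA].
  rewrite (Ex_rem _ _ _ ur) /=.
  have up1 : upd (fun x => x \in map pi A) u true = (fun x => x \in map pi (v' :: A)).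
    by apply/funext => x; rewrite /upd /= inE v'u; case: eqP.
  have up0 : upd (fun x => x \in map pi A) u false = (fun x => x \in map pi A).
    by apply/funext => x; rewrite /upd /=; case: eqP => // ->; rewrite (negbTE uA).
  have v'A : v' \notin A by apply: contra v'_new; rewrite mem_cat => ->.
  have vp1 : upd (fun x => x \in A) v' true = (fun x => x \in v' :: A).
    by apply/funext => x; rewrite /upd inE; case: eqP.
  have vp0 : upd (fun x => x \in A) v' false = (fun x => x \in A).
    by apply/funext => x; rewrite /upd; case: eqP => // ->; rewrite (negbTE v'A).
  rewrite up1 up0 vp1 vp0; have /andP[p0 p1] := p01.
  apply: lerD; apply: ler_wpM2l; rewrite ?subr_ge0 //.
    apply: le_trans le1 _; apply: Ex_grow => //; first exact: undup_uniq.
      by move=> x; rewrite tE => ->.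
    move=> x xt; rewrite inE negb_or; apply/andP; split.
      by apply: contraNneq v't => <-.
    by have := tA x xt; rewrite mem_cat negb_or => /andP[].
  apply: le_trans le2 _; apply: Ex_grow => //; first exact: undup_uniq.
    by move=> x; rewrite tE orbC => ->.
  by move=> x xt; have := tA x xt; rewrite mem_cat negb_or => /andP[].
- by exists [::]; split=> //; exact: lift_stuck rE nE.
Qed.

Let Pr_root (T : eqType) (adj : rel T) (O : (T -> bool) -> T -> Prop) N (x : T) (r : seq T) :
  x \notin r ->
  Pr (fun=> p) (x :: r) (fun w => w x /\ reaches_many adj N (O w) (eq x)) (fun=> false) =
  p * Ex (fun=> p) r (fun w => ind (reaches_many adj N (O w) (eq x))) (fun u => u \in [:: x]).
Proof.
move=> xr; rewrite /Pr /= [X in _ + _ * X](_ : _ = 0); last first.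
  rewrite -[RHS](Ex_cst (fun=> p) r 0 (upd (fun=> false) x false)).
  apply: Ex_eq_allc; apply: allc_impl (allc_agree _ _) => w /(_ x xr) H.
  by rewrite asboolF // => -[]; rewrite H updxx.
rewrite mulr0 addr0; congr (_ * _).
have -> : upd (fun=> false) x true = (fun u => u \in [:: x]).
  by apply/funext => u; rewrite /upd inE; case: eqP.
apply: Ex_eq_allc; apply: allc_impl (allc_agree _ _) => w /(_ x xr) H.
congr (_%:R); congr nat_of_bool; apply: asbool_equiv_eq; split=> [[]//|E].
by split=> //; rewrite H mem_head.
Qed.

Lemma lift_compare (s : seq U) N : uniq s -> pi v0 \in s ->
  exists s', [/\ uniq s', v0 \in s' &
    Pr (fun=> p) s (fun w => w (pi v0) /\
      reaches_many adjU N (fun u => u \in s /\ w u) (eq (pi v0))) (fun=> false) <=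
    Pr (fun=> p) s' (fun w => w v0 /\
      reaches_many adjV N (fun v => v \in s' /\ w v) (eq v0)) (fun=> false)].
Proof.
move=> us s0; pose r := [seq u <- s | u \notin map pi ([:: v0] ++ [::])].
have [|//||s1 [us1 d1 le1]] :=
    @lift_explore s N (size r) us [:: v0] [::] _ _ _ r erefl (leqnn _).
  exact: mem_head.
  by move=> a; rewrite inE => /eqP ->; exact: reach_in.
have v0s1 : v0 \notin s1 by apply/negP => /d1; rewrite inE eqxx.
exists (v0 :: s1); split; [by rewrite /= v0s1|exact: mem_head|].
have rE : rem (pi v0) s = r.
  by rewrite rem_filter //; apply: eq_filter => x; rewrite /= inE.
rewrite /Pr (Ex_rem _ _ _ s0) rE.
have x0 : pi v0 \notin r by rewrite mem_filter /= inE eqxx.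
rewrite -!/(Pr _ _ _ _) (Pr_root adjU (fun w u => u \in s /\ w u)) //.
rewrite (Pr_root adjV (fun w v => v \in v0 :: s1 /\ w v)) //.
apply: ler_wpM2l; first by case/andP: p01.
apply: (le_trans le1); apply: le_Ex_allc => //; apply: allc_impl (allc_agree _ _) => w H.
apply: ind_le; apply: reaches_many_sub => // v wv; split=> //.
have [vs|vs] := boolP (v \in s1); first by rewrite inE vs orbT.
by move: (H v vs); rewrite wv !inE => <-.
Qed.

End Lift.

(** * From finite lists of bits to the product measure *)

Section FiniteEvents.
Context {R : realType} {V : countType}.
Variable p : {i01 R}.
Local Notation P := (site_measure V p).
Local Notation q := (p%:num).
Local Open Scope classical_set_scope.

Lemma cylinder_upd (t : seq V) (eta : V -> bool) v b (w : V -> bool) : v \notin t ->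
  cylinder (v :: t) (upd eta v b) w <-> w v = b /\ cylinder t eta w.
Proof.
move=> vt; split=> [H|[wv H] u].
  split=> [|u ut]; first by rewrite (H v) ?mem_head // updxx.
  rewrite (H u) ?inE ?ut ?orbT // upd_neq //.
  by apply: contraNneq vt => <-.
rewrite inE => /orP[/eqP ->|ut]; first by rewrite updxx.
by rewrite (H u) // upd_neq //; apply: contraNneq vt => <-.
Qed.

(** The induction moves bits from the sampled list [s] to the decided list [t]; [eta] is both the
    cylinder on [t] and the base configuration of [Pr]. *)
Lemma cylinder_event (A : (V -> bool) -> Prop) (s t : seq V) (eta : V -> bool) :
  uniq (s ++ t) -> (forall w1 w2, {in s ++ t, w1 =1 w2} -> A w1 -> A w2) ->
  measurable (cylinder t eta `&` [set w | A w] : set (config V)) /\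
  P (cylinder t eta `&` [set w | A w]) =
    (\prod_(v <- t) bernoulli_pmf q (eta v) * Pr (fun=> q) s A eta)%:E.
Proof.
elim: s t eta => [|v s IH] t eta.
  move=> ut dA; rewrite /Pr /=; case: asboolP => [Aeta|nA].
    have -> : cylinder t eta `&` [set w | A w] = cylinder t eta.
      apply/seteqP; split=> w; first by case.
      move=> wt; split=> //; apply: dA Aeta => u ut'; apply/esym; exact: wt.
    by split; [exact: cylinder_measurable|rewrite mulr1 site_measureP].
  have -> : cylinder t eta `&` [set w | A w] = set0.
    apply/seteqP; split=> // w [wt Aw]; apply: nA; apply: dA Aw => u ut'.
    exact: wt.
  by split; [exact: measurable0|rewrite measure0 mulr0].
rewrite cat_cons => /[dup] uvst /= /andP[vst ust] dA.
have vt : v \notin t by apply: contra vst; rewrite mem_cat => ->; rewrite orbT.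
have ust' : uniq (s ++ v :: t) by rewrite -[v :: t]/([:: v] ++ t) uniq_catCA.
have dA' w1 w2 : {in s ++ v :: t, w1 =1 w2} -> A w1 -> A w2.
  move=> H; apply: dA => u; rewrite inE mem_cat orbCA => H'.
  by apply: H; rewrite mem_cat inE.
have [m1 e1] := IH (v :: t) (upd eta v true) ust' dA'.
have [m0 e0] := IH (v :: t) (upd eta v false) ust' dA'.
have -> : cylinder t eta `&` [set w | A w] =
    (cylinder (v :: t) (upd eta v true) `&` [set w | A w]) `|`
    (cylinder (v :: t) (upd eta v false) `&` [set w | A w]).
  apply/seteqP; split=> w.
    move=> [wt Aw]; case wv : (w v); [left|right]; split=> //; exact/cylinder_upd.
  by move=> [] [/cylinder_upd -/(_ vt) [_ wt] Aw].
split; first exact: measurableU.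
set C1 := _ `&` _ in m1 e1 *; set C0 := _ `&` _ in m0 e0 *.
have dC : C1 `&` C0 = set0.
  apply/seteqP; split=> // w [[/cylinder_upd -/(_ vt)[w1 _] _] [/cylinder_upd -/(_ vt)[w0 _] _]].
  by rewrite w1 in w0.
transitivity (P C1 + P C0)%E; first exact: measureU.
rewrite e1 e0 -EFinD; congr EFin; rewrite !big_cons !updxx /Pr /=.
have E b : \prod_(u <- t) bernoulli_pmf q (upd eta v b u) = \prod_(u <- t) bernoulli_pmf q (eta u).
  apply: eq_big_seq => u ut; rewrite upd_neq //; by apply: contraNneq vt => <-.
by rewrite !E /bernoulli_pmf /=; ring.
Qed.

Lemma finite_event (A : (V -> bool) -> Prop) (s : seq V) : uniq s ->
  (forall w1 w2, {in s, w1 =1 w2} -> A w1 -> A w2) ->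
  measurable ([set w | A w] : set (config V)) /\
  P [set w | A w] = (Pr (fun=> q) s A (fun=> false))%:E.
Proof.
move=> us dA; have := @cylinder_event A s [::] (fun=> false).
rewrite cats0 big_nil mul1r (_ : cylinder [::] _ = setT) ?setTI; last by apply/seteqP; split.
exact.
Qed.

Variable adj : rel V.

Lemma open_connected_reach (w : V -> bool) u v : open_connected adj w u v <->
  w u /\ reach adj (fun v => w v) (eq u) v.
Proof.
split.
  move=> [s [ps ls _ /= /andP[wu]]]; split=> //.
  elim/last_ind: s v ps ls b => [|s x IH] v /=; first by move=> _ <- _; exact: reach_in.
  rewrite rcons_path last_rcons all_rcons => /andP[ps ax] <- /andP[wx ws].
  apply: (@reach_step _ adj (fun v => w v) (eq u) (last u s) x) => //.
  exact: (IH (last u s)).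
move=> [wu]; elim=> [_ <-|x y _ [s [ps ls us ws]] xy wy].
  by exists [::]; split=> //=; rewrite wu.
have ps' : path adj u (rcons s y) by rewrite rcons_path ps ls xy.
have ls' : last u (rcons s y) = y by rewrite last_rcons.
case/shortenP: ps' ls' => s' ps' us' sub ls'; exists s'; split=> //.
move: ws => /= /andP[_ /allP ws]; rewrite wu; apply/allP => z /sub.
by rewrite mem_rcons inE => /orP[/eqP ->|/ws].
Qed.

Lemma theta_le_finite (v0 : V) (A : (V -> bool) -> Prop) (s : seq V) : uniq s ->
  (forall w1 w2, {in s, w1 =1 w2} -> A w1 -> A w2) ->
  (forall w, percolates adj v0 w -> A w) ->
  (theta adj v0 p <= (Pr (fun=> q) s A (fun=> false))%:E)%E.
Proof.
move=> us dA pA; have [mA <-] := finite_event us dA.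
rewrite /theta; apply: le_measure; rewrite ?inE //.
exact: measurable_percolates.
Qed.

Let mU (I : countType) (D : set I) (F : I -> set (config V)) :
  (forall i, D i -> measurable (F i)) -> measurable (\bigcup_(i in D) F i).
Proof.
move=> mF; rewrite bigcup_mkcond; apply: countable_bigcupT_measurable => // i.
by case: ifPn => // /set_mem; exact: mF.
Qed.

Definition clusters_ge (v0 : V) (N : nat) : set (config V) :=
  \bigcup_(l in [set l : seq V | uniq l /\ size l = N])
    \bigcap_(u in [set` l]) [set w | open_connected adj w v0 u].

Lemma measurable_clusters_ge v0 N : measurable (clusters_ge v0 N).
Proof.
apply: mU => l _; apply: fin_bigcap_measurable; first exact: finite_seq.
move=> u _; rewrite [X in measurable X](_ : _ = \bigcup_(s in
    [set s | [/\ path adj v0 s, last v0 s = u & uniq (v0 :: s)]])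
    cylinder (v0 :: s) (fun=> true)).
  by apply: mU => // s _; exact: cylinder_measurable.
apply/seteqP; split => w.
  by move=> [s [ps ls us /allP aw]]; exists s.
by move=> [s [ps ls us] aw]; exists s; split => //; apply/allP => x /aw.
Qed.

(** Continuity from above: percolation contains the decreasing intersection of the events that the
    cluster has at least [N] vertices. *)
Lemma theta_ge_finite (v0 : V) (c : R) :
  (forall N, exists s, [/\ uniq s, v0 \in s & c <= Pr (fun=> q) s (fun w => w v0 /\
    reaches_many adj N (fun v => v \in s /\ w v) (eq v0)) (fun=> false)]) ->
  (c%:E <= theta adj v0 p)%E.
Proof.
move=> H; pose E := clusters_ge v0.
have mE N : measurable (E N) by exact: measurable_clusters_ge.
have mI : measurable (\bigcap_n E n) by exact: bigcap_measurableType.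
have niE : nonincreasing_seq E.
  apply/nonincreasing_seqP => n; apply/subsetPset => w [l [ul sl] wl].
  exists (take n l); first by rewrite /= take_uniq // size_takel // sl.
  by move=> u /mem_take; exact: wl.
have PE N : (c%:E <= P (E N))%E.
  have [s [us s0 cs]] := H N.
  pose A (w : V -> bool) := w v0 /\ reaches_many adj N (fun v => v \in s /\ w v) (eq v0).
  have [|mA PA] := @finite_event A s us.
    move=> w1 w2 w12 [w0 rw]; split; first by rewrite -w12.
    by apply: reaches_many_sub rw => // v [vs wv]; rewrite -w12.
  apply: (@le_trans _ _ (P [set w | A w])); first by rewrite PA lee_fin.
  apply: le_measure; rewrite ?inE // => w [w0 [l [ul sl lw]]].
  exists l => // u /lw ru; apply/open_connected_reach; split=> //.
  by apply: reach_sub ru => // v [].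
have PI : (c%:E <= P (\bigcap_n E n))%E.
  have cv : P \o E @ \oo --> P (\bigcap_n E n).
    apply: nonincreasing_cvg_mu => //.
    exact: le_lt_trans (probability_le1 P (mE 0%N)) (ltry _).
  by apply: cvge_ge cv; apply: nearW => n; exact: PE.
apply: (le_trans PI); rewrite /theta; apply: le_measure; rewrite ?inE //.
  exact: measurable_percolates.
move=> w wE /finite_seqP[F FE].
have [l [ul sl] wl] := wE (size F).+1 I.
have : (size l <= size F)%N.
  apply: uniq_leq_size => // u ul'.
  have : Defs.cluster adj w v0 u := wl u ul'.
  by rewrite FE.
by rewrite sl ltnn.
Qed.

End FiniteEvents.

(** * The weighted projection from dimension d(n+1) to dimension d *)

Definition scale (n : nat) (k : 'I_n -> nat) (j : nat) : nat := (\prod_(l < n | (l < j)%N) k l)%N.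

Lemma scale0 n (k : 'I_n -> nat) : scale k 0 = 1%N.
Proof. by rewrite /scale big_pred0. Qed.

Lemma scaleS n (k : 'I_n.+1 -> nat) j :
  scale k j.+1 = (k ord0 * scale (fun l => k (lift ord0 l)) j)%N.
Proof. by rewrite /scale big_mkcond big_ord_recl /= [in RHS]big_mkcond. Qed.

Lemma scale_le n (k : 'I_n -> nat) j : (forall i, (0 < k i)%N) -> (scale k j <= scale k n)%N.
Proof.
move=> k0; rewrite /scale [leqRHS](bigID (fun l : 'I_n => (l < j)%N)) /=.
rewrite [X in (_ <= X * _)%N](eq_bigl (fun l : 'I_n => (l < j)%N)) => [|l]; last by rewrite ltn_ord.
by apply: leq_pmulr; apply: prodn_gt0.
Qed.

(** Uniqueness of a mixed-radix expansion: the lowest digit is a multiple of [k ord0] of smaller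
    absolute value, hence 0, and the rest is divided by [k ord0]. The top digit is unrestricted,
    which lets the slab extend in coordinates of largest weight. *)
Lemma digits_eq0 n (k : 'I_n -> nat) (M : int) (x : 'I_n.+1 -> int) :
  (forall i, M < (k i)%:Z) -> (forall j : 'I_n.+1, (j < n)%N -> `|x j| <= M) ->
  \sum_j x j * (scale k j)%:Z = 0 -> forall j, x j = 0.
Proof.
elim: n k x => [|n IH] k x kM xM.
  by rewrite big_ord1 scale0 mulr1 => x0 j; rewrite ord1.
rewrite big_ord_recl scale0 mulr1.
set k' := fun l => k (lift ord0 l); set S := \sum_(j < n.+1) x (lift ord0 j) * (scale k' j)%:Z.
have -> : \sum_(i < n.+1) x (lift ord0 i) * (scale k (lift ord0 i))%:Z = (k ord0)%:Z * S.
  rewrite mulr_sumr; apply: eq_bigr => j _.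
  by rewrite lift0 scaleS PoszM mulrCA.
move=> E; have M0 : `|x ord0| < (k ord0)%:Z by apply: le_lt_trans (kM ord0); exact: xM.
have S0 : S = 0.
  apply/eqP; apply/negPn/negP => nS; have S1 : 1 <= `|S| by lia.
  have : (k ord0)%:Z <= `|(k ord0)%:Z * S| by rewrite normrM /= ler_peMr.
  by rewrite (_ : _ * S = - x ord0) ?normrN; lia.
have x0 : x ord0 = 0 by rewrite S0 mulr0 addr0 in E.
have R0 := IH k' (fun j => x (lift ord0 j)) (fun i => kM _) _ S0.
by move=> j; case: (unliftP ord0 j) => [l ->|->] //; apply: R0 => i im; apply: xM.
Qed.

Section Projection.
Context {d n : nat}.
Variable k : 'I_n -> nat.
Local Notation D := (d * n.+1)%N.
Local Notation V := 'rV[int]_D.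
Local Notation U := 'rV[int]_d.
Implicit Types (v : V) (u x : U).

Definition proj v : U := \row_i \sum_(j < n.+1) vec_mx v i j * (scale k j)%:Z.

Lemma projD v v' : proj (v + v') = proj v + proj v'.
Proof.
apply/rowP => i; rewrite !mxE -big_split; apply: eq_bigr => j _.
by rewrite linearD !mxE mulrDl.
Qed.

Lemma proj0 : proj 0 = 0.
Proof.
by apply/rowP => i; rewrite !mxE big1 // => j _; rewrite linear0 !mxE mul0r.
Qed.

Lemma proj_unitv i (j : 'I_n.+1) : proj (unitv (mxvec_index i j)) = (scale k j)%:Z *: unitv i.
Proof.
apply/rowP => i'; rewrite /unitv !mxE vec_mx_delta (bigD1 j) //= !mxE eqxx andbT.
rewrite big1 => [|j' jj]; last by rewrite !mxE (negbTE jj) andbF mul0r.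
by rewrite addr0 mulrC.
Qed.

Lemma unitv_add x (a : int) i j : (x + a *: unitv i) 0 j = x 0 j + a * (j == i)%:R.
Proof. by rewrite mxE [X in _ + X]mxE unitvE. Qed.

Lemma bondP m x u : bond m x u <-> exists i a, `|a| = m%:Z /\ u = x + a *: unitv i.
Proof.
split=> [/existsP[i /andP[/eqP xi /forallP H]]|[i [a [am ->]]]].
  exists i, (u 0 i - x 0 i); split=> //; apply/rowP => j; rewrite unitv_add.
  have [->|ji] := eqVneq j i; first by rewrite mulr1 addrC subrK.
  by have /implyP/(_ ji)/eqP -> := H j; rewrite mulr0 addr0.
apply/existsP; exists i; rewrite unitv_add eqxx mulr1 addrAC subrr add0r am eqxx /=.
by apply/forallP => j; apply/implyP => /negbTE ji; rewrite unitv_add ji mulr0 addr0.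
Qed.

Lemma Gk_adjP x u : Gk_adj k x u <-> exists j : 'I_n.+1, bond (scale k j) x u.
Proof.
split.
  move=> /orP[H|/existsP[i H]]; first by exists ord0; rewrite scale0.
  by exists (lift ord0 i); rewrite lift0.
move=> [j H]; apply/orP; case: (unliftP ord0 j) H => [i ->|->].
  by rewrite lift0 => H; right; apply/existsP; exists i.
by rewrite scale0; left.
Qed.

Lemma projZ (a : int) v : proj (a *: v) = a *: proj v.
Proof.
apply/rowP => i; rewrite !mxE mulr_sumr; apply: eq_bigr => j _.
by rewrite linearZ !mxE mulrA.
Qed.

Lemma proj_step v (a : int) i (j : 'I_n.+1) :
  proj (v + a *: unitv (mxvec_index i j)) = proj v + (a * (scale k j)%:Z) *: unitv i.
Proof. by rewrite projD projZ proj_unitv scalerA. Qed.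

Lemma Zd_adj_unitv v (a : int) l : `|a| = 1 -> Zd_adj v (v + a *: unitv l).
Proof.
move=> a1; have [->|->] : a = 1 \/ a = -1 by lia.
  by rewrite scale1r Zd_adjD.
by rewrite scaleN1r Zd_adjB.
Qed.

Lemma proj_adj v v' : Zd_adj v v' -> Gk_adj k (proj v) (proj v').
Proof.
move=> /Zd_adjP[l H]; have [a a1 ->] : exists2 a : int, `|a| = 1 & v' = v + a *: unitv l.
  by case: H => ->; [exists 1|exists (-1)]; rewrite ?scale1r ?scaleN1r.
case/mxvec_indexP: l {H} => i j; apply/Gk_adjP; exists j; apply/bondP.
by exists i, (a * (scale k j)%:Z); rewrite proj_step normrM a1 mul1r.
Qed.

Lemma proj_lift v u : Gk_adj k (proj v) u -> exists2 v', Zd_adj v v' & proj v' = u.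
Proof.
move=> /Gk_adjP[j /bondP[i [a [am ->]]]].
have [b b1 ->] : exists2 b : int, `|b| = 1 & a = b * (scale k j)%:Z.
  by have [a0|a0] := leP 0 a; [exists 1|exists (-1)]; rewrite -?am; lia.
exists (v + b *: unitv (mxvec_index i j)); last exact: proj_step.
exact: Zd_adj_unitv.
Qed.

Lemma Gk_adj_dist x u i : (forall l, (0 < k l)%N) -> Gk_adj k x u ->
  `|u 0 i - x 0 i| <= (scale k n)%:Z.
Proof.
move=> k0 /Gk_adjP[j /bondP[i' [a [am ->]]]].
have kn : (scale k j)%:Z <= (scale k n)%:Z by rewrite lez_nat scale_le.
rewrite unitv_add addrAC subrr add0r; case: eqP => _; rewrite ?mulr1 ?am //.
by rewrite mulr0 normr0.
Qed.

Lemma proj_inj (M : int) v v' : (forall l, M < (k l)%:Z) ->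
  (forall i (j : 'I_n.+1), (j < n)%N ->
     `|v 0 (mxvec_index i j) - v' 0 (mxvec_index i j)| <= M) ->
  proj v = proj v' -> v = v'.
Proof.
move=> kM small E; apply/rowP => l; case/mxvec_indexP: l => i j; apply/eqP.
rewrite -subr_eq0; apply/eqP.
apply: (@digits_eq0 n k M (fun j => v 0 (mxvec_index i j) - v' 0 (mxvec_index i j))) => //.
  exact: small.
have := congr1 (fun x : U => x 0 i) E; rewrite !mxE => /eqP; rewrite -subr_eq0 -sumrB => /eqP E0.
by rewrite -[RHS]E0; apply: eq_bigr => j' _; rewrite !mxE mulrBl.
Qed.

Lemma mxvec_index_inj i i' (j j' : 'I_n.+1) :
  @mxvec_index d n.+1 i j = mxvec_index i' j' -> i = i' /\ j = j'.
Proof.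
move=> E; pose A : 'M['I_d * 'I_n.+1]_(d, n.+1) := \matrix_(i, j) (i, j).
by have := mxvecE A i j; rewrite E mxvecE !mxE => -[-> ->].
Qed.

End Projection.

Lemma bernoulli_ineq (R : realFieldType) (x : R) n : 0 <= x <= 1 -> 1 - n%:R * x <= (1 - x) ^+ n.
Proof.
move=> /andP[x0 x1]; elim: n => [|n IH]; first by rewrite mul0r subr0.
have H : (1 - x) * (1 - n%:R * x) <= (1 - x) ^+ n.+1.
  by rewrite exprS; apply: ler_wpM2l; rewrite ?subr_ge0.
have xx : 0 <= n%:R * (x * x) by rewrite !mulr_ge0.
by rewrite -natr1; lra.
Qed.

Section Comparison.
Context {R : realType} {d n : nat}.
Variable k : 'I_n -> nat.
Hypothesis k0 : forall i, (0 < k i)%N.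
Local Notation D := (d * n.+1)%N.
Local Notation V := 'rV[int]_D.
Local Notation U := 'rV[int]_d.
Local Notation adjU := (@Gk_adj d n k).
Local Notation adjV := (@Zd_adj D).

(** An infinite cluster leaves the ball of radius [N * scale k n]. Bonds have length at most
    [scale k n], so a self-avoiding open path out of it has at least [N] steps, and its first [N]
    vertices stay inside. *)
Lemma percolates_many (w : U -> bool) N : percolates adjU 0 w ->
  w 0 /\ reaches_many adjU N
    (fun u => u \in ball (N * scale k n) /\ w u) (eq 0).
Proof.
set r := (N * _)%N => inf.
have [u cu uB] : exists2 u, Defs.cluster adjU w 0 u & u \notin ball r.
  apply: contrapT => nE; apply: inf; apply: (@sub_finite_set _ _ [set` ball r]%classic); last exact: finite_seq.
  by move=> u cu /=; apply: contrapT => /negP uB; apply: nE; exists u.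
have [s [ps ls us /allP ws]] := cu.
have w0 : w 0 by apply: ws; rewrite mem_head.
split=> //; pose a j := nth 0 (0 :: s) j.
have a_ball j : (j <= size s)%N -> a j \in ball (j * scale k n)%N.
  elim: j => [|j IH] js; first by apply: in_ball => i; rewrite mxE normr0.
  have aj := pathP 0 ps j js; have /ballP H := IH (ltnW js).
  apply: in_ball => i; have := H i; have := Gk_adj_dist i k0 aj; rewrite -/(a j).
  rewrite mulSn /a /=; move: (nth 0 s j) => x; move: (nth 0 (0 :: s) j) => y.
  by move: (x 0 i) (y 0 i) (scale k n) (j * scale k n)%N => *; lia.
have Ns : (N <= size s)%N.
  rewrite leqNgt; apply: contra uB => sN; rewrite -ls (last_nth 0).
  by apply: ball_sub (a_ball _ (leqnn _)); rewrite leq_mul2r ltnW ?orbT.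
have a_reach j : (j <= N)%N -> reach adjU (fun u => u \in ball r /\ w u) (eq 0) (a j).
  elim: j => [|j IH] jN; first exact: reach_in.
  have js : (j < size s)%N by exact: leq_trans jN Ns.
  apply: reach_step (IH (ltnW jN)) (pathP 0 ps j js) _; split.
    by apply: ball_sub (a_ball j.+1 js); rewrite leq_mul2r jN orbT.
  by apply: ws; rewrite inE mem_nth ?orbT.
have sT : size (take N (0 :: s)) = N by rewrite size_takel //= ltnW.
exists (take N (0 :: s)); split; [exact: take_uniq|exact: sT|].
move=> v /(nthP 0)[j]; rewrite sT => jN <-.
by rewrite nth_take //; apply: a_reach; exact: ltnW.
Qed.

Lemma theta_Gk_le (p : {i01 R}) : (theta adjU 0%R p <= theta adjV 0%R p)%E.
Proof.
have p01 : 0 <= p%:num <= 1 by rewrite ge0 le1.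
have fin : theta adjU 0 p \is a fin_num.
  by apply: fin_num_measure; exact: measurable_percolates.
rewrite -(fineK fin); apply: theta_ge_finite => N.
pose s := @ball d (N * scale k n).
pose A (w : U -> bool) := w 0 /\ reaches_many adjU N (fun u => u \in s /\ w u) (eq 0).
have s0 : 0 \in s by apply: in_ball => i; rewrite mxE normr0.
have := @lift_compare R U V adjU adjV (@proj d n k) p%:num 0 (@proj_lift d n k) p01 s N (ball_uniq _).
rewrite proj0 => /(_ s0)[s' [us' s'0 le]]; exists s'; split=> //.
apply: le_trans le; rewrite -lee_fin fineK //.
apply: (@theta_le_finite _ _ p adjU 0 A s (ball_uniq _)).
  move=> w1 w2 w12 [w0 rw]; split; first by rewrite -w12.
  by apply: reaches_many_sub rw => // u [us wu]; rewrite -w12.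
by move=> w /percolates_many; exact.
Qed.

Variables (i1 i2 : 'I_d) (m r : nat).
Hypothesis i12 : i1 != i2.
Let I1 : 'I_D := mxvec_index i1 ord_max.
Let I2 : 'I_D := mxvec_index i2 ord_max.
Hypothesis mr : (4 * m + 6 <= r)%N.
Hypothesis k_big : forall i, (4 * (r + m + 1) < k i)%N.

Lemma I12 : I1 != I2.
Proof. by apply: contraNneq i12 => /mxvec_index_inj [-> _]. Qed.

(** The coordinates of lower weight lie within two strides of 0, so those of two points of the slab
    differ by at most [4 * (r + m + 1)], the bound below every [k i]. *)
Lemma proj_slab_inj B : {in slab I1 I2 m r B &, injective (@proj d n k)}.
Proof.
move=> v v'; rewrite !mem_boxseq => /boxP H /boxP H'.
apply: (@proj_inj d n k (4 * (r + m + 1))%N); first by move=> i; rewrite ltz_nat.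
move=> i j jn; have := H (mxvec_index i j); have := H' (mxvec_index i j); rewrite !mxE.
have nI i' : (mxvec_index i j == @mxvec_index d n.+1 i' ord_max) = false.
  by apply/eqP => /mxvec_index_inj [_ E]; rewrite E /= ltnn in jn.
rewrite !nI /= /stride; move: (v 0 _) (v' 0 _) => x x'; lia.
Qed.

Lemma theta_Gk_gt0 (p del p' : R) t (q : {i01 R}) : 0 <= p < 1 -> 0 <= del <= 1 ->
  (forall c i (b : 'I_D -> bool), (1 - del) ^+ t + (1 - p) ^- t *
    Pr (fun=> p) (reg m r c i b) (fun w => ~ crosses adjV (reg m r c i b)
      (fun v => v \in cube m c) (targets m r c i b) w) (fun=> false) <= (2304 * 4)%:R^-1) ->
  1 - (1 - p) * (1 - del) ^+ 128 <= p' -> 0 < p' -> p' <= q%:num -> theta adjU 0 q <> 0%E.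
Proof.
move=> p01 del01 good p'p p'0 p'q.
have q1 : q%:num <= 1 by rewrite le1.
have q0 : 0 <= q%:num by rewrite ge0.
have c0 : 0 < p' ^+ size (@cube D m 0) / 2%:R by rewrite divr_gt0 ?exprn_gt0.
suff : ((p' ^+ size (@cube D m 0) / 2%:R)%:E <= theta adjU 0%R q)%E.
  by move=> + E; rewrite E lee_fin leNgt c0.
apply: theta_ge_finite => N.
pose S := slab I1 I2 m r (3 ^ N); pose pr := @proj d n k.
have uS : uniq S by exact: boxseq_uniq.
have iS : {in S &, injective pr} by exact: proj_slab_inj.
have S0 : 0 \in S.
  rewrite mem_boxseq; apply/boxP => j; rewrite !mxE.
  by apply: (@slab_bounds r m (3 ^ N)%N%:Z _ 0) => //; rewrite normr0.
exists (map pr S); split; first by rewrite map_inj_in_uniq.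
  by rewrite -(@proj0 d n k) map_f.
pose A (w : V -> bool) := w 0 /\ reaches_many adjV (2 ^ N) (fun v => v \in S /\ w v) (eq 0).
have /le_trans := @slab_percolates R D I1 I2 m r I12 mr p del t p01 del01 good N p'
  (le_trans p'q q1) p'p.
rewrite -/A; apply.
apply: (@le_trans _ _ (Pr (fun=> q%:num) S A (fun=> false))).
  apply: Ex_le_param => //.
  - by move=> v; rewrite (ltW p'0) (le_trans p'q q1).
  - by move=> v; rewrite q0 q1.
  - move=> w w' ww; apply: ind_le => -[w0 rw]; split; first exact: ww.
    by apply: reaches_many_sub rw => // v [vs wv]; split=> //; exact: ww.
have E := @Ex_map_in R V U pr q%:num S S (fun w => ind (A w)) (fun=> false) iS (fun _ H => H).
have EE : (fun t => (t \in S) && (fun=> false) (pr t)) = (fun=> false) :> (V -> bool).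
  by apply/funext => v; rewrite andbF.
rewrite EE in E; rewrite /Pr -E; apply: le_Ex; first by move=> u; rewrite q0 q1.
move=> w; apply: ind_le => -[w0 [l [ul sl lw]]].
have w0' : w 0 by move: w0; rewrite S0 /= /pr proj0.
split=> //; have lS v : v \in l -> v \in S.
  by move=> /lw rv; case: (reach_region rv) => [<-|[]].
have Nl : (N <= size l)%N by rewrite sl ltnW // ltn_expl.
exists (map pr (take N l)); split.
- rewrite map_inj_in_uniq; first exact: take_uniq.
  by move=> v v' /mem_take/lS vS /mem_take/lS v'S; exact: iS.
- by rewrite size_map size_takel.
move=> _ /mapP[v /mem_take/lw rv ->]; apply: reach_map rv => [u u'|u [uS' /andP[_ wu]]|u <-].
- exact: proj_adj.
- by split; rewrite ?map_f.
- by rewrite /pr proj0.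
Qed.

End Comparison.

(** * Comparison of the thresholds *)

Section Threshold.
Context {R : realType} {V : countType}.
Variables (adj : rel V) (v : V).
Local Open Scope classical_set_scope.

Let S : set R := [set p%:num | p in [set p : {i01 R} | theta adj v p = 0%E]].

Lemma pc_ub (p : {i01 R}) : theta adj v p = 0%E -> p%:num <= pc R adj v.
Proof.
move=> tp; apply: ub_le_sup; last by exists p.
by exists 1 => _ [q _ <-]; rewrite le1.
Qed.

Lemma pc_ge0 : 0 <= pc R adj v.
Proof.
(* The supremum of the empty set is 0 by convention. *)
have [SE|/set0P[x [p tp _]]] := eqVneq S set0; last by apply: le_trans (pc_ub tp); rewrite ge0.
by rewrite /pc -/S SE sup0.
Qed.

Lemma pc_le (c : R) : 0 <= c -> (forall p : {i01 R}, theta adj v p = 0%E -> p%:num <= c) ->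
  pc R adj v <= c.
Proof.
move=> c0 H; have [SE|/set0P S0] := eqVneq S set0; first by rewrite /pc -/S SE sup0.
by apply: ge_sup => // _ [p tp <-]; exact: H.
Qed.

End Threshold.

Lemma i01P (R : realType) (x : R) : 0 <= x <= 1 -> exists p : {i01 R}, p%:num = x.
Proof. by move=> /andP[x0 x1]; exists (Itv01 x0 x1). Qed.

Lemma pc_Gk_ge (R : realType) (d n : nat) (k : 'I_n -> nat) : (forall i, (0 < k i)%N) ->
  pc R (@Zd_adj (d * n.+1)%N) 0 <= pc R (@Gk_adj d n k) 0.
Proof.
move=> k0; apply: pc_le; first exact: pc_ge0.
move=> p tp; apply: pc_ub; apply/eqP; rewrite eq_le.
by rewrite -{1}tp theta_Gk_le //=.
Qed.

Lemma theta_hitp (R : realType) (D : nat) (p : {i01 R}) N :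
  (theta (@Zd_adj D) 0%R p <= (@hitp R D p%:num 0 N)%:E)%E.
Proof.
apply: theta_le_finite; first exact: ball_uniq.
  by move=> w1 w2; exact: hit_dep.
move=> w inf; have [u cu uB] : exists2 u, Defs.cluster (@Zd_adj D) w 0 u & u \notin ball N.
  apply: contrapT => nE; apply: inf; apply: (@sub_finite_set _ _ [set` ball N]%classic); last exact: finite_seq.
  by move=> u cu /=; apply: contrapT => /negP uB; apply: nE; exists u.
have [w0 ru] := (open_connected_reach _ _ _ _).1 cu.
apply: (@exit_hit D 0 N (fun v => w v) w u) => //.
by apply: reach_sub ru => // v <-; apply: in_ball => i; rewrite mxE normr0.
Qed.

Lemma pc_Gk_le (R : realType) (d n : nat) (e : R) : (2 <= d)%N -> 0 < e ->
  exists K : nat, forall k : 'I_n -> nat, (forall i, (K < k i)%N) ->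
  pc R (@Gk_adj d n k) 0 <= pc R (@Zd_adj (d * n.+1)%N) 0 + e.
Proof.
move=> d2 e0; set c := pc R (@Zd_adj _) 0.
have c0 : 0 <= c by exact: pc_ge0.
(* Thresholds are at most 1, so the remaining case is [c + e <= 1], where [c + e / 2] is a
   supercritical density strictly between 0 and 1. *)
have [big|small] := ltP 1 (c + e).
  exists 0%N => k _; apply: pc_le => [|p _]; first by rewrite addr_ge0 // ltW.
  by apply: le_trans (ltW big); rewrite le1.
pose x := c + e / 2%:R.
have [p pE] : exists p : {i01 R}, p%:num = x by apply: i01P; apply/andP; rewrite /x; split; lra.
have tp0 : theta (@Zd_adj (d * n.+1)%N) 0%R p <> 0%E.
  by move=> /pc_ub; rewrite pE -/c /x; lra.
have fin : theta (@Zd_adj (d * n.+1)%N) 0%R p \is a fin_num.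
  by apply: fin_num_measure; exact: measurable_percolates.
pose th := fine (theta (@Zd_adj (d * n.+1)%N) 0%R p).
have th0 : 0 < th.
  by rewrite fine_gt0 // lt_neqAle eq_sym measure_ge0 andbT ltey_eq fin andbT; apply/eqP.
have thN N : th <= @hitp R (d * n.+1)%N x 0 N.
  by rewrite -pE -lee_fin fineK //; exact: theta_hitp.
have x01 : 0 < x < 1 by rewrite /x; apply/andP; split; lra.
(* The 128 layers raise the density [x] by at most [128 * del = e / 2], that is, up to [c + e]. *)
pose del := e / 2%:R / 128%:R.
have del01 : 0 < del <= 1 by rewrite /del; apply/andP; split; lra.
pose i1 : 'I_d := Ordinal (ltnW d2); pose i2 : 'I_d := Ordinal d2.
have i12 : i1 != i2 by [].
have eps0 : 0 < (2304 * 4)%:R^-1 :> R by rewrite invr_gt0 ltr0n.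
have [m [r [t [mr good]]]] := good_scales (mxvec_index i1 (@ord_max n)) x01 del01 eps0 th0 thN.
exists (4 * (r + m + 1))%N => k kK; apply: pc_le; first by lra.
move=> q tq; rewrite leNgt; apply/negP => lt.
move: tq; apply: (@theta_Gk_gt0 R d n k i1 i2 m r i12 mr kK x del (c + e) t q).
- by case/andP: x01 => /ltW -> ->.
- by case/andP: del01 => /ltW -> ->.
- exact: good.
- have dl : 0 <= del <= 1 by case/andP: del01 => /ltW -> ->.
  have := bernoulli_ineq 128 dl.
  have : 0 <= 1 - x by case/andP: x01 => _ /ltW; rewrite subr_ge0.
  have -> : 128%:R * del = e / 2%:R by rewrite /del; field.
  move: ((1 - del) ^+ 128) => y x1 /(ler_wpM2l x1); rewrite /x; nra.
- by lra.
- exact: ltW.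
Qed.

Theorem theorem1 (R : realType) (d n : nat) (hd : (2 <= d)%N) (hn : (1 <= n)%N)
    (e : R) (he : 0 < e) :
  exists K : nat, forall k : 'I_n -> nat,
    (forall i, (2 <= k i)%N) -> (forall i, (K <= k i)%N) ->
    `|pc R (@Gk_adj d n k) 0 - pc R (@Zd_adj (d * n.+1)%N) 0| < e.
Proof.
have [K HK] := @pc_Gk_le R d n (e / 2%:R) hd (divr_gt0 he (ltr0n _ 2)).
exists K.+1 => k k2 kK; have le1 := HK k kK.
have le2 := @pc_Gk_ge R d n k (fun i => ltnW (k2 i)).
by rewrite ger0_norm; lra.
Qed.
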